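(* Let $H:T^*\mathbb{T}^n\to\mathbb{R}$ be a Tonelli Hamiltonian and, for $c\in H^1(\mathbb{T}^n,\mathbb{R})\cong\mathbb{R}^n$, let $H_c(x,p)=H(x,p+c)$. Assume that $H_c$ is Tonelli for $|c|$ sufficiently small and $H_c\to H$ in the $C^2$ topology as $|c|\to0$. Assume further that the Hamilton--Jacobi equation $H(x,du_0(x))=\alpha(0)$, $x\in\mathbb{T}^n$, admits a classical solution $u_0\in C^{1,1}(\mathbb{T}^n,\mathbb{R})$ such that $\widetilde{\mathcal{T}}_\omega=\{(x,du_0(x)):x\in\mathbb{T}^n\}$ is a KAM torus for $H$ with frequency $\omega\in\mathcal{D}_{\sigma,\tau}$. Then there is a constant $C=C(n,\omega,H)>0$ such that, for all $c$ with $|c|$ sufficiently small, $$W_1\bigl(\widetilde{\mathfrak{M}}(c),\widetilde{\mathfrak{M}}(0)\bigr)\le C\,|c|^{\ell},\qquad \ell=\frac{1}{n+\tau+1},$$ where $\widetilde{\mathfrak{M}}(c)$ denotes an arbitrary Mather measure associated with $H_c$ and $\widetilde{\mathfrak{M}}(0)$ is the unique Mather measure associated with $H$.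
   Context: $\mathbb{T}^n=\mathbb{R}^n/\mathbb{Z}^n$ is the flat torus; $T\mathbb{T}^n$ and $T^*\mathbb{T}^n$ are identified with $\mathbb{T}^n\times\mathbb{R}^n$ with Euclidean product distance; $\pi$ is the canonical projection to $\mathbb{T}^n$. A Hamiltonian $H(x,p)$ is Tonelli if it is $C^2$, strictly convex (as usual, with positive definite $\partial_{pp}H$) and superlinear in $p$; its Lagrangian is $L(x,v)=\sup_p\{\langle p,v\rangle-H(x,p)\}$. The Lagrangian of $H_c$ is $L(x,v)-\langle c,v\rangle$. $\alpha(c)$ denotes the ergodic constant (Mañé critical value) of $H_c$, i.e. the unique constant for which $H(x,c+du(x))=\alpha(c)$ has a viscosity solution on $\mathbb{T}^n$. For $\sigma>0$, $\tau\ge n-1$, $\mathcal{D}_{\sigma,\tau}$ is the set of $\omega\in\mathbb{R}^n$ with $|\langle\omega,k\rangle|\ge\sigma|k|^{-\tau}$ for all $k\in\mathbb{Z}^n\setminus\{0\}$. The torus $\widetilde{\mathcal{T}}_\omega=\{(x,du_0(x))\}$ is a KAM torus for $H$ with frequency $\omega$ if it is invariant under the Hamiltonian flow $\varphi_H^t$ and there is a diffeomorphism $\psi:\mathbb{T}^n\to\mathbb{T}^n$ with $\psi(\pi\circ\varphi_H^t(x,du_0(x)))=\psi(x)+\omega t\pmod{\mathbb{Z}^n}$ for all $x\in\mathbb{T}^n$, $t\in\mathbb{R}$. A Borel probability measure $\mu$ on $T\mathbb{T}^n$ is closed if $\int|v|\,d\mu<\infty$ and $\int d\phi(x)\cdot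 v\,d\mu=0$ for all $\phi\in C^1(\mathbb{T}^n,\mathbb{R})$. A Mather measure associated with a Hamiltonian is a closed probability measure minimizing the integral of the corresponding Lagrangian among all closed probability measures. Under the hypotheses, the Mather measure of $H$ is unique. $W_1(\mu,\nu)=\inf_{\Pi}\int d(x,y)\,d\Pi(x,y)$ is the 1-Wasserstein distance (infimum over couplings) on $T\mathbb{T}^n$. *)

(* Defs.v *)
From HB Require Import structures.
From mathcomp Require Import all_boot all_order all_algebra.
From mathcomp Require Import all_classical all_reals all_analysis.

Set Implicit Arguments.
Unset Strict Implicit.
Unset Printing Implicit Defensive.

Import Order.TTheory GRing.Theory Num.Theory.
Import numFieldNormedType.Exports.

Local Open Scope quotient_scope.
Local Open Scope classical_set_scope.
Local Open Scope ring_scope.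

(* The library norm on ['rV[R]_n] is the sup norm; the Euclidean one is used for
   every quantitative notion below (the two induce the same topology). *)
Definition dotp (R : realType) (n : nat) (u v : 'rV[R]_n) : R :=
  \sum_(i < n) u 0 i * v 0 i.

Definition enorm (R : realType) (n : nat) (u : 'rV[R]_n) : R :=
  Num.sqrt (dotp u u).

Section Torus.
Variables (R : realType) (n : nat).

Definition lattice_eq : rel 'rV[R]_n :=
  fun x y => (x - y) \is a mxOver Num.int.

Lemma lattice_eq_refl : reflexive lattice_eq.
Proof. by move=> x; apply/mxOverP => i j; rewrite subrr mxE rpred0. Qed.

Lemma lattice_eq_sym : symmetric lattice_eq.
Proof.
by move=> x y; apply/mxOverP/mxOverP => h i j;
  rewrite -opprB mxE rpredN; apply: h.
Qed.

Lemma lattice_eq_trans : transitive lattice_eq.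
Proof.
move=> y x z /mxOverP xy /mxOverP yz; apply/mxOverP => i j.
by rewrite -[x](subrK y) -addrA mxE rpredD.
Qed.

Canonical lattice_equiv :=
  EquivRel lattice_eq lattice_eq_refl lattice_eq_sym lattice_eq_trans.

Definition torus := quotient_topology {eq_quot lattice_equiv}.

HB.instance Definition _ := PointedTopological.on torus.

End Torus.

Definition tproj (R : realType) (n : nat) (x : 'rV[R]_n) : torus R n :=
  (\pi_(torus R n) x)%qT.

Definition trep (R : realType) (n : nat) (x : torus R n) : 'rV[R]_n :=
  generic_quotient.repr x.

Definition tshift (R : realType) (n : nat) (x : torus R n) (v : 'rV[R]_n) :
  torus R n := tproj (trep x + v).

Definition tdist (R : realType) (n : nat) (x y : torus R n) : R :=
  inf [set enorm (trep x - trep y + map_mx intr k) | k in [set: 'rV[int]_n]].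

(* Both the tangent and the cotangent bundle of the torus. *)
Definition bundle (R : realType) (n : nat) : Type :=
  (torus R n * 'rV[R]_n)%type.

HB.instance Definition _ (R : realType) (n : nat) :=
  Pointed.copy (bundle R n) (torus R n * 'rV[R]_n)%type.
HB.instance Definition _ (R : realType) (n : nat) :=
  Topological.copy (bundle R n) (torus R n * 'rV[R]_n)%type.

Definition bdist (R : realType) (n : nat) (z w : bundle R n) : R :=
  Num.sqrt (tdist z.1 w.1 ^+ 2 + enorm (z.2 - w.2) ^+ 2).

Definition borel_bundle (R : realType) (n : nat) : measurableType _ :=
  g_sigma_algebraType (@open (bundle R n)).

(* Class C^k, through iterated directional derivatives; meant for
   finite-dimensional [V], where it is equivalent to the existence and
   continuity of all partial derivatives of order at most [k]. *)
Fixpoint Ck (R : realType) (V W : normedModType R) (k : nat) (f : V -> W) :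
    Prop :=
  continuous f /\
  if k is k'.+1 then
    forall v : V, (forall x, derivable f x v) /\ Ck k' (fun x => 'D_v f x)
  else True.

Section TorusCalculus.
Variables (R : realType) (n : nat).

Definition tlift (f : torus R n -> R) : 'rV[R]_n -> R := fun x => f (tproj x).

Definition blift (F : bundle R n -> R) : 'rV[R]_n * 'rV[R]_n -> R :=
  fun z => F (tproj z.1, z.2).

Definition C1_torus (f : torus R n -> R) : Prop := Ck 1 (tlift f).

(* The differential, identified with a vector; independent of the
   representative since [tlift f] is periodic. *)
Definition tgrad (f : torus R n -> R) (x : torus R n) : 'rV[R]_n :=
  \row_i 'D_(delta_mx 0 i) (tlift f) (trep x).

Definition C11_torus (f : torus R n -> R) : Prop :=
  C1_torus f /\
  exists K : R, forall x y, enorm (tgrad f x - tgrad f y) <= K * tdist x y.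

(* A continuous self-map of the torus lifts to the universal cover, and it is
   C^1 iff one (equivalently, every) lift is. *)
Definition C1_torus_map (psi : torus R n -> torus R n) : Prop :=
  exists Psi : 'rV[R]_n -> 'rV[R]_n,
    Ck 1 Psi /\ forall x, psi (tproj x) = tproj (Psi x).

Definition torus_diffeo (psi : torus R n -> torus R n) : Prop :=
  exists psi' : torus R n -> torus R n,
    [/\ cancel psi psi', cancel psi' psi,
        C1_torus_map psi & C1_torus_map psi'].

End TorusCalculus.

Section Hamiltonians.
Variables (R : realType) (n : nat).
Implicit Types H : bundle R n -> R.

Definition tonelli H : Prop :=
  [/\ Ck 2 (blift H),
      forall z (v : 'rV[R]_n), v != 0 ->
        0 < 'D_((0 : 'rV[R]_n), v)
              (fun y => 'D_((0 : 'rV[R]_n), v) (blift H) y) z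
    & forall A : R, exists r : R, forall x p,
        r <= enorm p -> A * enorm p <= H (x, p)].

Definition Hshift H (c : 'rV[R]_n) : bundle R n -> R :=
  fun z => H (z.1, z.2 + c).

(* C^2 topology: locally uniform convergence of the derivatives of order at most
   2 (the fibres of the bundle are not compact). *)
Definition C2_cvg_Hshift H : Prop :=
  forall r e : R, 0 < e ->
  \forall c \near (0 : 'rV[R]_n), forall z, enorm z.2 <= r ->
    let F := blift (Hshift H c) in let G := blift H in
    [/\ `|F z - G z| <= e,
        forall v, `|v| <= 1 -> `|'D_v F z - 'D_v G z| <= e
      & forall v w, `|v| <= 1 -> `|w| <= 1 ->
          `|'D_w (fun y => 'D_v F y) z - 'D_w (fun y => 'D_v G y) z| <= e].

Definition lagrangian H : bundle R n -> R :=
  fun z => sup [set dotp p z.2 - H (z.1, p) | p in [set: 'rV[R]_n]].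

Definition viscosity_solution H (a : R) (u : torus R n -> R) : Prop :=
  continuous u /\
  forall f : torus R n -> R, C1_torus f -> forall x : torus R n,
    ((\forall y \near x, u y - f y <= u x - f x) -> H (x, tgrad f x) <= a) /\
    ((\forall y \near x, u x - f x <= u y - f y) -> a <= H (x, tgrad f x)).

Definition alpha H (c : 'rV[R]_n) : R :=
  get [set a | exists u, viscosity_solution (Hshift H c) a u].

Definition dHdx H (x p : 'rV[R]_n) : 'rV[R]_n :=
  \row_i 'D_((delta_mx 0 i : 'rV[R]_n), (0 : 'rV[R]_n)) (blift H) (x, p).

Definition dHdp H (x p : 'rV[R]_n) : 'rV[R]_n :=
  \row_i 'D_((0 : 'rV[R]_n), (delta_mx 0 i : 'rV[R]_n)) (blift H) (x, p).

(* Hamilton's equations, written on a lift [X] of the base component. *)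
Definition hamiltonian_flow H (phi : R -> bundle R n -> bundle R n) : Prop :=
  forall z, phi 0 z = z /\
  exists X P : R -> 'rV[R]_n,
    forall t, [/\ phi t z = (tproj (X t), P t),
                  is_derive t 1 X (dHdp H (X t) (P t))
                & is_derive t 1 P (- dHdx H (X t) (P t))].

Definition graph_du (u : torus R n -> R) : set (bundle R n) :=
  [set (x, tgrad u x) | x in [set: torus R n]].

Definition KAM_torus H (u : torus R n -> R) (omega : 'rV[R]_n) : Prop :=
  exists phi : R -> bundle R n -> bundle R n,
  [/\ hamiltonian_flow H phi,
      forall t, phi t @` graph_du u = graph_du u
    & exists psi : torus R n -> torus R n, torus_diffeo psi /\
        forall x t,
          psi (phi t (x, tgrad u x)).1 = tshift (psi x) (t *: omega)].

Definition diophantine (sigma tau : R) (omega : 'rV[R]_n) : Prop :=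
  forall k : 'rV[int]_n, k != 0 ->
    sigma * enorm (map_mx intr k : 'rV[R]_n) `^ (- tau)
      <= `|dotp omega (map_mx intr k)|.

End Hamiltonians.

Section Measures.
Variables (R : realType) (n : nat).
Local Open Scope ereal_scope.

Definition closed_measure (mu : probability (borel_bundle R n) R) : Prop :=
  \int[mu]_z (enorm (z : bundle R n).2)%:E < +oo /\
  forall f : torus R n -> R, C1_torus f ->
    \int[mu]_z (dotp (tgrad f (z : bundle R n).1) (z : bundle R n).2)%:E = 0.

Definition action (H : bundle R n -> R)
    (mu : probability (borel_bundle R n) R) : \bar R :=
  \int[mu]_z (lagrangian H z)%:E.

Definition mather_measure (H : bundle R n -> R)
    (mu : probability (borel_bundle R n) R) : Prop :=
  closed_measure mu /\
  forall nu : probability (borel_bundle R n) R,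
    closed_measure nu -> action H mu <= action H nu.

Definition coupling (mu nu : probability (borel_bundle R n) R)
    (Pi : probability (borel_bundle R n * borel_bundle R n)%type R) : Prop :=
  forall A : set (borel_bundle R n), measurable A ->
    Pi (A `*` setT) = mu A /\ Pi (setT `*` A) = nu A.

Definition W1 (mu nu : probability (borel_bundle R n) R) : \bar R :=
  ereal_inf [set \int[Pi]_z (bdist z.1 z.2)%:E | Pi in coupling mu nu].

End Measures.

(* Main.v *)
Require Import Defs.
From HB Require Import structures.
From mathcomp Require Import all_boot all_order all_algebra.
From mathcomp Require Import all_classical all_reals all_analysis.
From mathcomp Require Import measurable_realfun ring lra zify.

(** Let [Vel x] be the velocity [H_p (x, du0 x)] on the invariant graph and [Psi] a
    lift of the conjugacy [psi], so that the derivative of [Psi] along [Vel] is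
    [omega]. A closed measure [mu] is compared with the torus through its deviation
    [\int `|v - Vel x| dmu].

    The deviation is controlled by the action. Fenchel's inequality at momenta close
    to [du0] gives [s * `|v - Vel x| - K * s ^+ 2 <= L - du0 . v + h] for
    [0 <= s <= 1] ([graph_lower]). Closed curves of rational direction close to
    [omega] in the straightened coordinates carry closed measures of action close to
    [- h] ([near_minimizer]); hence a Mather measure [mu_0] of [H] has deviation zero
    ([mather_deviation0]). The Lagrangian of [H_c] is [L - c . v], so a Mather measure
    [mu_c] of [H_c] satisfies [\int L dmu_c + h <= c . (rho (mu_c) - rho (mu_0))],
    where [rho] is the rotation vector. The rotation vector of a closed measure
    differs from that of the torus by at most a multiple of the deviation
    ([KAM_rotation]). With [s] of order [`|c|] the deviation of [mu_c] is therefore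
    [O (`|c|)] ([mather_deviation_le]).

    It remains to compare the projections to the torus. Testing closedness against
    the characters of [psi], the Fourier coefficient of index [k] of the image of
    [mu_c] under [psi] is at most a multiple of [`|c| * `|k| / `|omega . k|], while
    those of the image of [mu_0] vanish for [k != 0] ([KAM_fourier]). Two
    such measures are coupled with a density given by a nonnegative trigonometric
    kernel of width [1 / N]; by Parseval the defect of its marginal is small in mean
    square, and the transport cost is at most a multiple of [1 / N + e ^ 2 * N ^ (n + 1)]
    if the coefficients of frequency at most [4 * N] are at most [e]
    ([fourier_coupling]). The Diophantine condition allows [e] of order
    [`|c| * N ^ (1 + tau)], and the best [N] gives the exponent
    [2 / (2 * tau + n + 4)] ([KAM_W1_rate]). It is at least [1 / (n + tau + 1)] for
    [n >= 2]; for [n = 1] the frequency is also Diophantine with exponent [-1], which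
    is enough.

    The constant must serve for every pair [sigma, tau]. Either the set of Diophantine
    exponents of [omega] has a least element, whose constant can be used for all, or every exponent lies above another one, whose faster rate absorbs
    its constant ([KAM_W1_holder_uniform]). *)

Set Implicit Arguments.
Unset Strict Implicit.
Unset Printing Implicit Defensive.

Import Order.TTheory GRing.Theory Num.Theory.
Import numFieldNormedType.Exports.

Local Open Scope classical_set_scope.
Local Open Scope ring_scope.

(** * Bounded measurable functions and measures with a density *)

(** [probability_setT] in the form in which integration lemmas leave it, on the
    underlying measure. *)
Lemma measure_probT d (T : measurableType d) (R : realType)
  (P : probability T R) : (P : {measure set T -> \bar R}) setT = 1%E.
Proof. exact: probability_setT. Qed.

Section BoundedMeasurable.
Context d (T : measurableType d) (R : realType).
Implicit Types f g : T -> R.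

(** These functions form an algebra and are integrable for every probability, so
    that the integrals below can be computed without integrability conditions. *)
Definition bmeas f := measurable_fun setT f /\ exists M : R, forall x, `|f x| <= M.

Lemma bmeas_cst (r : R) : bmeas (fun _ => r).
Proof. by split; [exact: measurable_cst | exists `|r|]. Qed.

Lemma bmeasD f g : bmeas f -> bmeas g -> bmeas (fun x => f x + g x).
Proof.
move=> [mf [M hM]] [mg [N hN]]; split; first exact: measurable_funD.
by exists (M + N) => x; rewrite (le_trans (ler_normD _ _)) ?lerD.
Qed.

Lemma bmeasM f g : bmeas f -> bmeas g -> bmeas (fun x => f x * g x).
Proof.
move=> [mf [M hM]] [mg [N hN]]; split; first exact: measurable_funM.
by exists (M * N) => x; rewrite normrM ler_pM.
Qed.

Lemma bmeasZ (r : R) f : bmeas f -> bmeas (fun x => r * f x).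
Proof. exact/bmeasM/bmeas_cst. Qed.

Lemma bmeasN f : bmeas f -> bmeas (fun x => - f x).
Proof.
move=> [mf [M hM]]; split; first exact: measurableT_comp.
by exists M => x; rewrite normrN.
Qed.

Lemma bmeasB f g : bmeas f -> bmeas g -> bmeas (fun x => f x - g x).
Proof. by move=> ? /bmeasN; exact: bmeasD. Qed.

Lemma bmeas_norm f : bmeas f -> bmeas (fun x => `|f x|).
Proof.
move=> [mf [M hM]]; split; first exact: measurableT_comp.
by exists M => x; rewrite normr_id.
Qed.

Lemma bmeas_sum (I : Type) (s : seq I) (P : pred I) (F : I -> T -> R) :
  (forall i, bmeas (F i)) -> bmeas (fun x => \sum_(i <- s | P i) F i x).
Proof.
move=> hF; elim: s => [|i s IH].
  rewrite (_ : (fun _ => _) = fun=> 0) ?bmeas_cst//.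
  exact: bmeas_cst.
  by apply/funext => x; rewrite big_nil.
case Pi: (P i); last first.
  rewrite (_ : (fun _ => _) = (fun x => \sum_(i <- s | P i) F i x))//.
  by apply/funext => x; rewrite big_cons Pi.
rewrite (_ : (fun _ => _) = (fun x => F i x + \sum_(i <- s | P i) F i x)).
  exact: bmeasD.
by apply/funext => x; rewrite big_cons Pi.
Qed.

Variable P : probability T R.

Lemma bmeas_integrable f : bmeas f -> P.-integrable setT (EFin \o f).
Proof.
move=> [mf [M hM]]; apply: measurable_bounded_integrable => //.
  by rewrite -ge0_fin_numE// fin_num_measure.
exists M; split; first exact: num_real.
by move=> x Mx y _; exact: le_trans (hM y) (ltW Mx).
Qed.

Lemma EFin_Rint f : bmeas f ->
  (\int[P]_x (f x)%:E)%E = (\int[P]_x f x)%:E.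
Proof.
by move=> /bmeas_integrable hf; rewrite fineK//; exact: integrable_fin_num.
Qed.

Lemma RintD f g : bmeas f -> bmeas g ->
  \int[P]_x (f x + g x) = \int[P]_x f x + \int[P]_x g x.
Proof. by move=> *; rewrite RintegralD//; exact: bmeas_integrable. Qed.

Lemma RintB f g : bmeas f -> bmeas g ->
  \int[P]_x (f x - g x) = \int[P]_x f x - \int[P]_x g x.
Proof. by move=> *; rewrite RintegralB//; exact: bmeas_integrable. Qed.

Lemma RintZ r f : bmeas f -> \int[P]_x (r * f x) = r * \int[P]_x f x.
Proof. by move=> *; rewrite RintegralZl//; exact: bmeas_integrable. Qed.

Lemma Rint_cst (r : R) : \int[P]_x r = r.
Proof. by rewrite Rintegral_cst// measure_probT mulr1. Qed.

Lemma Rint_sum (I : Type) (s : seq I) (p : pred I) (F : I -> T -> R) :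
  (forall i, bmeas (F i)) ->
  \int[P]_x (\sum_(i <- s | p i) F i x) = \sum_(i <- s | p i) \int[P]_x F i x.
Proof.
move=> hF; elim: s => [|i s IH].
  rewrite big_nil -[RHS](Rint_cst 0); apply: eq_Rintegral => x _.
  by rewrite big_nil.
rewrite big_cons -IH; case Pi: (p i).
  rewrite -RintD//; last exact: bmeas_sum.
  by apply: eq_Rintegral => x _; rewrite big_cons Pi.
by apply: eq_Rintegral => x _; rewrite big_cons Pi.
Qed.

Lemma Rint_le f g : bmeas f -> bmeas g -> (forall x, f x <= g x) ->
  \int[P]_x f x <= \int[P]_x g x.
Proof. by move=> hf hg fg; apply: le_Rintegral => //; exact: bmeas_integrable. Qed.

Lemma Rint_norm f M : bmeas f -> (forall x, `|f x| <= M) ->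
  `|\int[P]_x f x| <= M.
Proof.
move=> hf hM; rewrite (le_trans (le_normr_Rintegral _ (bmeas_integrable hf)))//.
rewrite -[leRHS]Rint_cst; apply: Rint_le => //; first exact: bmeas_norm.
exact: bmeas_cst.
Qed.

End BoundedMeasurable.

Lemma bmeas_comp d (T : measurableType d) d' (T' : measurableType d')
  (R : realType) (f : T' -> R) (g : T -> T') :
  measurable_fun setT g -> bmeas f -> bmeas (fun x => f (g x)).
Proof.
by move=> mg [mf [M hM]]; split; [exact: measurableT_comp | exists M => x].
Qed.

Section FubiniBounded.
Context d1 (T1 : measurableType d1) d2 (T2 : measurableType d2) (R : realType).
Variables (P : probability T1 R) (Q : probability T2 R) (F : T1 * T2 -> R).
Hypothesis bF : bmeas F.

Lemma bmeas_section1 x : bmeas (fun y => F (x, y)).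
Proof. by apply: (bmeas_comp (f := F) (g := fun y => (x, y))) bF; exact: pair1_measurable. Qed.

Lemma bmeas_section2 y : bmeas (fun x => F (x, y)).
Proof. by apply: (bmeas_comp (f := F) (g := fun x => (x, y))) bF; exact: pair2_measurable. Qed.

Let iF : (P \x Q)%E.-integrable setT (EFin \o F).
Proof.
case: bF => [mF [M hM]]; apply: measurable_bounded_integrable => //.
  rewrite [ltLHS](_ : _ = 1%E) ?ltry//; exact: (probability_setT (P \x Q)%E).
exists M; split; first exact: num_real.
by move=> x Mx y _; exact: le_trans (hM y) (ltW Mx).
Qed.

Lemma bmeas_fubini1 : bmeas (fun x => \int[Q]_y F (x, y)).
Proof.
split.
  apply/measurable_EFinP; have := measurable_fubini_F iF.
  rewrite /fubini_F; congr (measurable_fun _ _); apply/funext => x /=.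
  by rewrite EFin_Rint//; exact: bmeas_section1.
case: bF => _ [M hM]; exists M => x.
by apply: Rint_norm => //; exact: bmeas_section1.
Qed.

Lemma bmeas_fubini2 : bmeas (fun y => \int[P]_x F (x, y)).
Proof.
split.
  apply/measurable_EFinP; have := measurable_fubini_G iF.
  rewrite /fubini_G; congr (measurable_fun _ _); apply/funext => x /=.
  by rewrite EFin_Rint//; exact: bmeas_section2.
case: bF => _ [M hM]; exists M => x.
by apply: Rint_norm => //; exact: bmeas_section2.
Qed.

Lemma Rint_fubini1 :
  (\int[P \x Q]_z (F z)%:E)%E = (\int[P]_x \int[Q]_y F (x, y))%:E.
Proof.
rewrite -(integral12_prod_meas1 iF) /fubini_F -EFin_Rint; last exact: bmeas_fubini1.
apply: eq_integral => x _; rewrite EFin_Rint//; exact: bmeas_section1.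
Qed.

Lemma Rint_fubini2 :
  (\int[P \x Q]_z (F z)%:E)%E = (\int[Q]_y \int[P]_x F (x, y))%:E.
Proof.
rewrite -(integral21_prod_meas1 iF) /fubini_G -EFin_Rint; last exact: bmeas_fubini2.
apply: eq_integral => x _; rewrite EFin_Rint//; exact: bmeas_section2.
Qed.

Lemma Rint_swap :
  \int[P]_x \int[Q]_y F (x, y) = \int[Q]_y \int[P]_x F (x, y).
Proof. by apply: EFin_inj; rewrite -Rint_fubini1 Rint_fubini2. Qed.

End FubiniBounded.

Section DensityMeasure.
Context d (T : measurableType d) (R : realType).
Variables (m : {measure set T -> \bar R}) (q : T -> R).
Local Open Scope ereal_scope.

(** The proofs are arguments because the structure of measure, attached to this
    constant, depends on them. *)
Definition density_measure of measurable_fun setT q & (forall x, 0 <= q x)%R :=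
  fun A : set T => \int[m]_(x in A) (q x)%:E.

Variables (mq : measurable_fun setT q) (q0 : (forall x, 0 <= q x)%R).
Local Notation mu := (density_measure mq q0).

Let mu0 : mu set0 = 0.
Proof. by rewrite /density_measure integral_set0. Qed.

Let mu_ge0 A : 0 <= mu A.
Proof. by apply: integral_ge0 => x _; rewrite lee_fin. Qed.

Let mu_sigma : semi_sigma_additive mu.
Proof.
move=> /= F mF tF mUF; rewrite /density_measure; apply: cvg_toP.
  apply: ereal_nondecreasing_is_cvgn => n k nk.
  by apply: lee_sum_nneg_natr => // i _ _; exact: mu_ge0.
rewrite ge0_integral_bigcup//=.
- by apply/measurable_funTS/measurableT_comp.
- by move=> x _; rewrite lee_fin.
Qed.

HB.instance Definition _ := isMeasure.Build _ _ _ mu mu0 mu_ge0 mu_sigma.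

Import HBNNSimple.

Lemma integral_density (f : T -> \bar R) :
  measurable_fun setT f -> (forall x, 0 <= f x) ->
  \int[mu]_x f x = \int[m]_x (f x * (q x)%:E).
Proof.
move=> mf f0.
pose h := nnsfun_approx measurableT mf.
have mqE : measurable_fun setT (EFin \o q) by exact/measurable_EFinP.
have -> : \int[mu]_x f x = lim (\int[mu]_x (EFin \o h n) x @[n --> \oo]).
  have fE x : f x = lim ((EFin \o h n) x @[n --> \oo]).
    by apply/esym/cvg_lim => //; exact: cvg_nnsfun_approx.
  under eq_integral => x _ do rewrite fE.
  apply: monotone_convergence => //.
  - by move=> n; exact/measurable_EFinP.
  - by move=> n x _ /=; rewrite lee_fin.
  - by move=> x _ a b ab; rewrite lee_fin; exact/lefP/nd_nnsfun_approx.
have -> : \int[m]_x (f x * (q x)%:E) =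
    lim (\int[m]_x ((h n x)%:E * (q x)%:E) @[n --> \oo]).
  have fg x : f x * (q x)%:E = lim ((h n x)%:E * (q x)%:E @[n --> \oo]).
    apply/esym/cvg_lim => //; apply: cvgeZr => //.
    exact: cvg_nnsfun_approx.
  under eq_integral => x _ do rewrite fg.
  apply: monotone_convergence => [//| | |].
  - move=> n; apply/emeasurable_funM => //; exact/measurable_EFinP.
  - by move=> n x Ex /=; rewrite mule_ge0 ?lee_fin.
  - by move=> x Ex a b ab/=; rewrite lee_wpmul2r ?lee_fin//; exact/lefP/nd_nnsfun_approx.
suff suf n : \int[mu]_x (EFin \o h n) x = \int[m]_x ((h n x)%:E * (q x)%:E).
  by under eq_fun do rewrite suf.
have indich r : measurable_fun setT (fun x => (r * \1_(h n @^-1` [set r]) x)%:E).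
  by apply: measurableT_comp => //; exact: measurable_funM.
transitivity (\int[mu]_x
   (\sum_(y \in range (h n)) (y * \1_(h n @^-1` [set y]) x)%:E)).
  by apply: eq_integral => t tE; rewrite /= fimfunE -fsumEFin.
rewrite ge0_integral_fsum//; last by move=> m' y Ey; exact: nnfun_muleindic_ge0.
transitivity (\int[m]_x (\sum_(y \in range (h n))
    (y * \1_(h n @^-1` [set y]) x)%:E * (q x)%:E)); last first.
  under [LHS]eq_integral => x xE.
    rewrite -ge0_mule_fsuml => [|y]; last exact: nnfun_muleindic_ge0.
    rewrite fsumEFin // -(fimfunE _ x); over.
  by [].
rewrite [RHS]ge0_integral_fsum//; last 2 first.
  - by move=> y; apply: emeasurable_funM.
  - by move=> r y Ey; apply: mule_ge0; [exact: nnfun_muleindic_ge0|rewrite lee_fin].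
apply: eq_fsbigr => r rhn.
have r0 : (0 <= r)%R by move: rhn; rewrite inE => -[t _ <-].
under [LHS]eq_integral do rewrite EFinM.
rewrite integralZl_indic_nnsfun => //.
under [RHS]eq_integral do rewrite EFinM -muleA.
rewrite [RHS]ge0_integralZl//.
- congr (_ * _).
  under [RHS]eq_integral do rewrite muleC.
  rewrite [RHS](eq_integral ((EFin \o q) \_ (h n @^-1` [set r]))); last first.
    by move=> x xE; rewrite epatch_indic.
  by rewrite -integral_mkcond integral_indic// setIT.
- by apply: emeasurable_funM => //; exact/measurable_EFinP.
- by move=> t Et; rewrite mule_ge0 ?lee_fin.
Qed.

End DensityMeasure.

(** * Couplings from a nonnegative kernel *)

Lemma bmeas_indic d (T : measurableType d) (R : realType) (A : set T) :
  measurable A -> bmeas (\1_A : T -> R).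
Proof.
move=> mA; split; first exact: measurable_indic.
by exists 1 => x; rewrite indicE ger0_norm ?ler0n// lern1; case: (_ \in _).
Qed.

Section KernelCoupling.
Context d1 (T1 : measurableType d1) d2 (T2 : measurableType d2) (R : realType).
Variables (P : probability T1 R) (Q : probability T2 R) (K : T1 * T2 -> R).
Hypotheses (bK : bmeas K) (K0 : forall z, 0 <= K z).
Hypothesis K1 : forall x, \int[Q]_y K (x, y) = 1.

Let rho (y : T2) : R := \int[P]_x K (x, y).
(** Where the second marginal [rho] of [K] exceeds [1], dividing by it makes the
   kernel subcritical. *)
Let theta (y : T2) : R := (Num.max (rho y) 1)^-1.

Let bKx x : bmeas (fun y => K (x, y)).
Proof. exact: bmeas_section1. Qed.
Let bKy y : bmeas (fun x => K (x, y)).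
Proof. exact: bmeas_section2. Qed.

Let brho : bmeas rho.
Proof. exact: (bmeas_fubini2 P Q). Qed.

Let theta01 y : 0 <= theta y <= 1.
Proof.
have h : 1 <= Num.max (rho y) 1 by rewrite le_max lexx orbT.
rewrite invr_ge0 (le_trans _ h)//= invf_le1//.
exact: lt_le_trans h.
Qed.

Let btheta : bmeas theta.
Proof.
split; last by exists 1 => y; case/andP: (theta01 y) => h0 h1; rewrite ger0_norm.
rewrite /theta; have [mr _] := brho.
apply: (measurableT_comp (f := fun t : R => (Num.max t 1)^-1)) => //.
apply: continuous_measurable_fun => t.
apply: (@continuousV R R (fun t => Num.max t 1)).
  by rewrite gt_eqF// lt_max ltr01 orbT.
by apply: continuous_max; [exact: cvg_id|exact: cst_continuous].
Qed.

Let s (y : T2) : R := 1 - rho y * theta y.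
Let r (x : T1) : R := 1 - \int[Q]_y (K (x, y) * theta y).

Let bKt : bmeas (fun z => K z * theta z.2).
Proof. by apply: bmeasM => //; apply: bmeas_comp btheta. Qed.

Let bs : bmeas s.
Proof. by apply: bmeasB; [exact: bmeas_cst|exact: bmeasM]. Qed.

Let br : bmeas r.
Proof.
rewrite /r; apply: bmeasB; first exact: bmeas_cst.
exact: (bmeas_fubini1 P Q bKt).
Qed.

Let s0 y : 0 <= s y.
Proof.
have h : 0 < Num.max (rho y) 1 by rewrite lt_max ltr01 orbT.
by rewrite subr_ge0 ler_pdivrMr// mul1r le_max lexx.
Qed.

Let s_le y : s y <= `|1 - rho y|.
Proof.
rewrite /s /theta; case: (lerP (rho y) 1) => h.
  by rewrite invr1 mulr1.
by rewrite divff ?subrr ?subr_ge0 ?(ltW h)// gt_eqF// (lt_trans _ h).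
Qed.

Let r01 x : 0 <= r x.
Proof.
rewrite subr_ge0 -[leRHS](K1 x); apply: Rint_le => //.
  exact: (bmeas_section1 bKt).
by move=> y; case/andP: (theta01 y) => h0 h1; rewrite ler_piMr.
Qed.

Let M0 : R := \int[Q]_y s y.

Let M0_ge0 : 0 <= M0. Proof. exact: Rintegral_ge0. Qed.

Let int_r : \int[P]_x r x = M0.
Proof.
rewrite /r /M0 RintB; [|exact: bmeas_cst|exact: (bmeas_fubini1 P Q bKt)].
rewrite /s RintB; [|exact: bmeas_cst|exact: bmeasM].
rewrite !Rint_cst; congr (_ - _).
rewrite (Rint_swap P Q bKt); apply: eq_Rintegral => y _ /=.
rewrite /rho mulrC -RintZ//; apply: eq_Rintegral => x _; exact: mulrC.
Qed.

Let q (z : T1 * T2) : R := K z * theta z.2 + M0^-1 * (r z.1 * s z.2).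

Let q0 z : 0 <= q z.
Proof.
rewrite /q addr_ge0 //; first by rewrite mulr_ge0 //; case/andP: (theta01 z.2).
by rewrite mulr_ge0 ?invr_ge0 // mulr_ge0.
Qed.

Let br1 : bmeas (fun z : T1 * T2 => r z.1). Proof. by apply: bmeas_comp br. Qed.
Let bs2 : bmeas (fun z : T1 * T2 => s z.2). Proof. by apply: bmeas_comp bs. Qed.

Let bq : bmeas q.
Proof. by apply: bmeasD => //; apply: bmeasZ; exact: bmeasM. Qed.

Let mq : measurable_fun setT q. Proof. by case: bq. Qed.

Let Pi := density_measure (P \x Q)%E mq q0.

Let PiE A : measurable A ->
  Pi A = (\int[P \x Q]_z (\1_A z * q z)%:E)%E.
Proof.
move=> mA; rewrite /Pi /density_measure integral_mkcond.
apply: eq_integral => z _; rewrite patchE indicE.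
by case: ifP => _ /=; rewrite ?mul1r ?mul0r.
Qed.

(** When [M0 = 0], the convention [0^-1 = 0] is harmless: then [c = 0]. *)
Let degenerate (c : R) : 0 <= c <= M0 -> c * (M0^-1 * M0) = c.
Proof.
move=> /andP[c0]; have [->|h] := eqVneq M0 0.
  by move=> c1; rewrite mulr0 mulr0; apply/eqP; rewrite eq_le c0 c1.
by rewrite mulVf// mulr1.
Qed.

Let int_q1 x : \int[Q]_y q (x, y) = 1 - r x + M0^-1 * r x * M0.
Proof.
rewrite /q /= RintD; last 2 first.
  exact: (bmeas_section1 bKt).
  by apply: bmeasZ; apply: bmeasZ.
under [X in _ + X = _]eq_Rintegral do rewrite mulrA.
by rewrite RintZ// subKr.
Qed.

Let int_q2 y : \int[P]_x q (x, y) = 1 - s y + M0^-1 * s y * M0.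
Proof.
rewrite /q /= RintD; last 2 first.
  exact: (bmeas_section2 bKt).
  by apply: bmeasZ; apply: bmeasM => //; exact: bmeas_cst.
congr (_ + _).
  rewrite /s subKr mulrC -RintZ//; apply: eq_Rintegral => x _; exact: mulrC.
rewrite -int_r -RintZ//; apply: eq_Rintegral => x _ /=.
by rewrite -mulrA (mulrC (s y)).
Qed.

Let indic_setXT (A : set T1) (z : T1 * T2) :
  \1_(A `*` setT) z = \1_A z.1 :> R.
Proof.
rewrite !indicE; congr (nat_of_bool _)%:R.
by apply/idP/idP; rewrite !inE; [case|split].
Qed.

Let indic_setTX (B : set T2) (z : T1 * T2) :
  \1_(setT `*` B) z = \1_B z.2 :> R.
Proof.
rewrite !indicE; congr (nat_of_bool _)%:R.
by apply/idP/idP; rewrite !inE; [case|split].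
Qed.

Let indic01 d (T : measurableType d) (A : set T) x : 0 <= (\1_A x : R) <= 1.
Proof. by rewrite indicE ler0n lern1; case: (_ \in _). Qed.

Let Pi_fst A : measurable A -> Pi (A `*` setT) = P A.
Proof.
move=> mA; rewrite PiE; last exact: measurableX.
under eq_integral do rewrite indic_setXT.
have bA := bmeas_indic R mA.
have bA1 : bmeas (fun z : T1 * T2 => \1_A z.1 : R) by apply: bmeas_comp bA.
rewrite (Rint_fubini1 P Q (bmeasM bA1 bq)) /=.
have -> : (P A = \int[P]_x (\1_A x)%:E)%E by rewrite integral_indic// setIT.
rewrite EFin_Rint//; congr EFin.
transitivity (\int[P]_x (\1_A x - \1_A x * r x + (M0^-1 * M0) * (\1_A x * r x))).
  apply: eq_Rintegral => x _; rewrite RintZ ?int_q1; last exact: bmeas_section1.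
  by ring.
have bAr : bmeas (fun x => \1_A x * r x) by exact: bmeasM.
rewrite RintD; [|exact: bmeasB|exact: bmeasZ].
rewrite RintB// RintZ// [_ * \int[P]_x _]mulrC degenerate ?subrK//.
rewrite Rintegral_ge0/=; last first.
  by move=> x _; rewrite mulr_ge0//; case/andP: (indic01 A x).
rewrite -int_r; apply: Rint_le => // x.
by rewrite ler_piMl//; case/andP: (indic01 A x).
Qed.

Let Pi_snd B : measurable B -> Pi (setT `*` B) = Q B.
Proof.
move=> mB; rewrite PiE; last exact: measurableX.
under eq_integral do rewrite indic_setTX.
have bB := bmeas_indic R mB.
have bB2 : bmeas (fun z : T1 * T2 => \1_B z.2 : R) by apply: bmeas_comp bB.
rewrite (Rint_fubini2 P Q (bmeasM bB2 bq)) /=.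
have -> : (Q B = \int[Q]_x (\1_B x)%:E)%E by rewrite integral_indic// setIT.
rewrite EFin_Rint//; congr EFin.
transitivity (\int[Q]_y (\1_B y - \1_B y * s y + (M0^-1 * M0) * (\1_B y * s y))).
  apply: eq_Rintegral => y _; rewrite RintZ ?int_q2; last exact: bmeas_section2.
  by ring.
have bBs : bmeas (fun y => \1_B y * s y) by exact: bmeasM.
rewrite RintD; [|exact: bmeasB|exact: bmeasZ].
rewrite RintB// RintZ// [_ * \int[Q]_y _]mulrC degenerate ?subrK//.
rewrite Rintegral_ge0/=; last first.
  by move=> x _; rewrite mulr_ge0//; case/andP: (indic01 B x).
apply: Rint_le => // x.
by rewrite ler_piMl//; case/andP: (indic01 B x).
Qed.

Let Pi_setT : Pi setT = 1%E.
Proof. by rewrite -setXTT Pi_fst// probability_setT. Qed.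

HB.instance Definition _ := Measure.on Pi.
HB.instance Definition _ := @Measure_isProbability.Build _ _ R Pi Pi_setT.

(** The measure [K dP dQ] has first marginal [P] but second marginal [rho dQ].
    After division by [max rho 1] both marginals are too small, by densities [r]
    and [s] with the same total mass [M0]; adding [r s / M0] repairs both at once.
    The repair costs at most [M] times the missing mass, and
    [s <= `|1 - rho|]. *)
Lemma kernel_coupling : exists Pi : probability (T1 * T2)%type R,
  [/\ forall A, measurable A -> Pi (A `*` setT) = P A,
      forall B, measurable B -> Pi (setT `*` B) = Q B
    & forall (F : T1 * T2 -> R) M, 0 <= M -> measurable_fun setT F ->
        (forall z, 0 <= F z <= M) ->
        (\int[Pi]_z (F z)%:E <=
          (\int[P]_x \int[Q]_y (F (x, y) * K (x, y))
            + M * \int[Q]_y `|1 - \int[P]_x K (x, y)|)%:E)%E].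
Proof.
exists Pi; split; [exact: Pi_fst|exact: Pi_snd|] => F M M_ge0 mF F01.
have bF : bmeas F.
  split => //; exists M => z; case/andP: (F01 z) => h0 h1.
  by rewrite ger0_norm.
rewrite integral_density; [|exact/measurable_EFinP|]; last first.
  by move=> z; rewrite lee_fin; case/andP: (F01 z).
under eq_integral do rewrite -EFinM.
rewrite (Rint_fubini1 P Q (bmeasM bF bq)) lee_fin.
apply: (@le_trans _ _ (\int[P]_x (\int[Q]_y (F (x, y) * K (x, y)) + M * M0^-1 * r x * M0))).
  apply: Rint_le.
  - exact: (bmeas_fubini1 P Q (bmeasM bF bq)).
  - apply: bmeasD; first exact: (bmeas_fubini1 P Q (bmeasM bF bK)).
    by apply: bmeasM; [exact: bmeasZ|exact: bmeas_cst].
  - move=> x; rewrite -[M * _ * _ * _]RintZ// -RintD; last 2 first.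
    + exact: (bmeas_section1 (bmeasM bF bK)).
    + exact: bmeasZ.
    apply: Rint_le.
    + exact: (bmeas_section1 (bmeasM bF bq)).
    + apply: bmeasD; last exact: bmeasZ.
      exact: (bmeas_section1 (bmeasM bF bK)).
    move=> y; rewrite /q /= mulrDr lerD//.
      rewrite ler_wpM2l//; first by case/andP: (F01 (x, y)).
      by case/andP: (theta01 y) => ? ?; rewrite ler_piMr.
    rewrite -!mulrA ler_wpM2r ?mulr_ge0 ?invr_ge0//.
    by case/andP: (F01 (x, y)).
rewrite RintD; last 2 first.
  - exact: (bmeas_fubini1 P Q (bmeasM bF bK)).
  - by apply: bmeasM; [exact: bmeasZ|exact: bmeas_cst].
rewrite lerD2l.
have -> : \int[P]_x (M * M0^-1 * r x * M0) = M * M0^-1 * M0 * \int[P]_x r x.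
  by rewrite -RintZ//; apply: eq_Rintegral => x _; ring.
rewrite int_r (_ : _ * M0 = M * (M0 * (M0^-1 * M0))); last by ring.
rewrite degenerate ?M0_ge0 ?lexx// ler_wpM2l//; apply: Rint_le => //.
by apply: bmeas_norm; apply: bmeasB => //; exact: bmeas_cst.
Qed.

End KernelCoupling.

(** * Couplings from a trigonometric kernel *)

Section Characters.
Context (R : realType) (n : nat).
Implicit Types (k l : 'rV[int]_n) (y : 'rV[R]_n).

Definition phase k y : R := 2 * pi * dotp (map_mx intr k) y.

Lemma phaseD k l y : phase (k + l) y = phase k y + phase l y.
Proof.
rewrite /phase -mulrDr; congr (_ * _); rewrite -big_split/=.
by apply: eq_bigr => i _; rewrite !mxE rmorphD mulrDl.
Qed.

Lemma phaseN k y : phase (- k) y = - phase k y.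
Proof.
rewrite /phase -mulrN; congr (_ * _); rewrite /dotp -sumrN.
by apply: eq_bigr => i _; rewrite !mxE rmorphN mulNr.
Qed.

Lemma phase0 y : phase 0 y = 0.
Proof. by rewrite -[0 as X in phase X](subrr 0) phaseD phaseN subrr. Qed.

Lemma phase_delta i y : phase (delta_mx 0 i) y = 2 * pi * y 0 i.
Proof.
rewrite /phase /dotp (bigD1 i)//= big1 ?addr0 ?mxE ?eqxx ?mul1r//.
by move=> j /negbTE ji; rewrite !mxE ji andbF mul0r.
Qed.

End Characters.

Section TrigCoupling.
Context d (T : measurableType d) (R : realType) (n : nat).
Variables (P Q : probability T R) (Y : T -> 'rV[R]_n).

Let C k z : R := cos (phase k (Y z)).
Let S k z : R := sin (phase k (Y z)).
(** The real part of the character of index [k] at [Y w - Y z]. *)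
Let E k (z w : T) : R := C k z * C k w + S k z * S k w.

Hypothesis mC : forall k, measurable_fun setT (C k).
Hypothesis mS : forall k, measurable_fun setT (S k).
Hypothesis hQ : forall k, k != 0 ->
  \int[Q]_z C k z = 0 /\ \int[Q]_z S k z = 0.

Let bC k : bmeas (C k).
Proof. by split; [exact: mC | exists 1 => z; rewrite ler_norml cos_geN1 cos_le1]. Qed.

Let bS k : bmeas (S k).
Proof. by split; [exact: mS | exists 1 => z; rewrite ler_norml sin_geN1 sin_le1]. Qed.

Let QC k : \int[Q]_z C k z = (k == 0)%:R.
Proof.
have [->|/hQ[]//] := eqVneq k 0.
rewrite -[RHS](Rint_cst Q); apply: eq_Rintegral => z _.
by rewrite /C phase0 cos0.
Qed.

Let QS k : \int[Q]_z S k z = 0.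
Proof.
have [->|/hQ[]//] := eqVneq k 0.
rewrite -[RHS](Rint_cst Q); apply: eq_Rintegral => z _.
by rewrite /S phase0 sin0.
Qed.

Let CN k z : C (- k) z = C k z. Proof. by rewrite /C phaseN cosN. Qed.
Let SN k z : S (- k) z = - S k z. Proof. by rewrite /S phaseN sinN. Qed.
Let CD k l z : C (k + l) z = C k z * C l z - S k z * S l z.
Proof. by rewrite /C /S phaseD cosD. Qed.
Let SD k l z : S (k + l) z = S k z * C l z + C k z * S l z.
Proof. by rewrite /C /S phaseD sinD. Qed.

Let CC k l z : C k z * C l z = 2^-1 * (C (k - l) z + C (k + l) z).
Proof. by rewrite !CD CN SN; field. Qed.
Let SS k l z : S k z * S l z = 2^-1 * (C (k - l) z - C (k + l) z).
Proof. by rewrite !CD CN SN; field. Qed.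
Let SC k l z : S k z * C l z = 2^-1 * (S (k + l) z + S (k - l) z).
Proof. by rewrite !SD CN SN; field. Qed.

Let EM k l z w : E k z w * E l z w = 2^-1 * (E (k - l) z w + E (k + l) z w).
Proof. by rewrite /E !CD !SD !CN !SN; field. Qed.

Let E_le1 k z w : `|E k z w| <= 1.
Proof.
rewrite /E (_ : _ + _ = cos (phase k (Y w) - phase k (Y z))).
  by rewrite ler_norml cos_geN1 cos_le1.
by rewrite cosB /C /S; ring.
Qed.

Let bE k : bmeas (fun zw : T * T => E k zw.1 zw.2).
Proof. by apply: bmeasD; apply: bmeasM; apply: bmeas_comp. Qed.

Let QE k z : \int[Q]_w E k z w = (k == 0)%:R.
Proof.
rewrite RintD; [|exact: bmeasZ|exact: bmeasZ].
rewrite !RintZ// QC QS mulr0 addr0.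
have [->|] := eqVneq k 0; last by rewrite mulr0.
by rewrite /C phase0 cos0 mulr1.
Qed.

Let Cov k l : \int[Q]_z (C k z * C l z) = 2^-1 * ((k == l)%:R + (k == - l)%:R).
Proof.
under eq_Rintegral do rewrite CC.
by rewrite RintZ ?RintD ?QC ?subr_eq0 ?addr_eq0//; exact: bmeasD.
Qed.
Let Sov k l : \int[Q]_z (S k z * S l z) = 2^-1 * ((k == l)%:R - (k == - l)%:R).
Proof.
under eq_Rintegral do rewrite SS.
by rewrite RintZ ?RintB ?QC ?subr_eq0 ?addr_eq0//; exact: bmeasB.
Qed.
Let SCov k l : \int[Q]_z (S k z * C l z) = 0.
Proof.
under eq_Rintegral do rewrite SC.
by rewrite RintZ ?RintD ?QS ?addr0 ?mulr0//; exact: bmeasD.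
Qed.

Variables (J : finType) (b : J -> R) (kap : J -> 'rV[int]_n).
Hypotheses (b01 : forall j, 0 <= b j <= 1) (kap_inj : injective kap).
Let B : R := \sum_j b j ^+ 2.
Hypothesis B_gt0 : 0 < B.

Let wt (p : J * J) : R := b p.1 * b p.2 / B.
Let fr (p : J * J) := kap p.1 - kap p.2.

Let wt0 p : 0 <= wt p.
Proof.
by case/andP: (b01 p.1) => ? _; case/andP: (b01 p.2) => ? _;
  rewrite !mulr_ge0// invr_ge0 ltW.
Qed.

Let K (zw : T * T) : R := \sum_p wt p * E (fr p) zw.1 zw.2.

Let bK : bmeas K.
Proof. by apply: bmeas_sum => p; exact: bmeasZ. Qed.

(** The kernel is a square modulus, hence nonnegative. *)
Let K0 zw : 0 <= K zw.
Proof.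
have -> : K zw = B^-1 *
   ((\sum_j b j * E (kap j) zw.1 zw.2) ^+ 2
    + (\sum_j b j * (S (kap j) zw.1 * C (kap j) zw.2
                     - C (kap j) zw.1 * S (kap j) zw.2)) ^+ 2).
  rewrite !expr2 !big_distrlr/= -big_split/= /K -[LHS](pair_bigA _ (fun j l => wt (j,l) * E (fr (j,l)) zw.1 zw.2))/=.
  rewrite mulr_sumr; apply: eq_bigr => j _.
  rewrite -big_split mulr_sumr; apply: eq_bigr => l _ /=.
  rewrite /wt /fr /= /E !CD !SD !CN !SN.
  by field; rewrite gt_eqF.
by apply: mulr_ge0; [rewrite invr_ge0 ltW|apply: addr_ge0; exact: sqr_ge0].
Qed.

Let bE1 k z : bmeas (fun w => E k z w).
Proof. exact: (bmeas_section1 (bE k)). Qed.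
Let bE2 k w : bmeas (fun z => E k z w).
Proof. exact: (bmeas_section2 (bE k)). Qed.

Let sum_pair (F : J * J -> R) : \sum_p F p = \sum_j \sum_l F (j, l).
Proof. by rewrite pair_bigA; apply: eq_bigr => -[]. Qed.

Let sum_wt0 : \sum_p wt p * (fr p == 0)%:R = 1.
Proof.
rewrite sum_pair -[RHS](divff (lt0r_neq0 B_gt0)) {1}/B mulr_suml.
apply: eq_bigr => j _; rewrite (bigD1 j)//= big1 ?addr0.
  by rewrite /wt /fr /= subrr eqxx mulr1.
by move=> l lj; rewrite /fr /= subr_eq0 (inj_eq kap_inj) eq_sym (negbTE lj) mulr0.
Qed.

Let K1 z : \int[Q]_w K (z, w) = 1.
Proof.
rewrite Rint_sum; last by move=> p /=; exact: bmeasZ.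
by rewrite -[RHS]sum_wt0; apply: eq_bigr => p _; rewrite /= RintZ// QE.
Qed.

(** The autocorrelation of the weights [b] at lag [e]. *)
Let Gam (e : 'rV[int]_n) : R :=
  \sum_j \sum_l b j * b l * (kap l == kap j + e)%:R.

(** Orthogonality of characters under [Q] keeps only the pairs of frequencies that
    differ by [e]. *)
Let QEK e z : \int[Q]_w (E e z w * K (z, w)) = Gam e / B.
Proof.
transitivity (\int[Q]_w \sum_p wt p * 2^-1 * (E (e - fr p) z w + E (e + fr p) z w)).
  apply: eq_Rintegral => w _; rewrite /K mulr_sumr; apply: eq_bigr => p _.
  by rewrite mulrCA EM mulrA.
rewrite Rint_sum; last by move=> p; apply: bmeasZ; exact: bmeasD.
transitivity (\sum_p wt p * 2^-1 * ((kap p.1 == kap p.2 + e)%:R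
                                   + (kap p.2 == kap p.1 + e)%:R)).
  apply: eq_bigr => p _; rewrite RintZ; last exact: bmeasD.
  rewrite (RintD Q (bE1 (e - fr p) z) (bE1 (e + fr p) z)) !QE /fr; congr (_ * (_%:R + _%:R)); congr nat_of_bool.
    by rewrite subr_eq0 eq_sym subr_eq addrC.
  by rewrite addrA subr_eq0 addrC eq_sym.
rewrite sum_pair /=.
transitivity (2^-1 * (\sum_j \sum_l b j * b l / B * (kap j == kap l + e)%:R
  + \sum_j \sum_l b j * b l / B * (kap l == kap j + e)%:R)).
  rewrite -big_split mulr_sumr; apply: eq_bigr => j _ /=.
  rewrite -big_split mulr_sumr; apply: eq_bigr => l _ /=.
  by rewrite /wt /=; ring.
rewrite exchange_big /=.
have -> : \sum_j \sum_l b j * b l / B * (kap l == kap j + e)%:R = Gam e / B.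
  rewrite /Gam mulr_suml; apply: eq_bigr => j _.
  by rewrite mulr_suml; apply: eq_bigr => l _; rewrite mulrAC.
have -> : \sum_j \sum_l b l * b j / B * (kap l == kap j + e)%:R = Gam e / B.
  rewrite /Gam mulr_suml; apply: eq_bigr => j _.
  by rewrite mulr_suml; apply: eq_bigr => l _; rewrite mulrAC [b l * _]mulrC.
by field; rewrite gt_eqF.
Qed.

Let dl (i : 'I_n) : 'rV[int]_n := delta_mx 0 i.
Let D2 (zw : T * T) : R := \sum_i (1 - E (dl i) zw.1 zw.2).

Let bD2 : bmeas D2.
Proof. by apply: bmeas_sum => i; apply: bmeasB => //; exact: bmeas_cst. Qed.

Let D2_ge0 zw : 0 <= D2 zw.
Proof.
by apply: sumr_ge0 => i _; rewrite subr_ge0 (le_trans (ler_norm _)).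
Qed.

Let D2_le zw : D2 zw <= 2 * n%:R.
Proof.
rewrite mulr_natr -[X in _ *+ X]card_ord -sumr_const; apply: ler_sum => i _.
rewrite lerBlDr -lerBlDl (_ : 1 - 2 = -1); last by ring.
by have := E_le1 (dl i) zw.1 zw.2; rewrite ler_norml => /andP[].
Qed.

Let QD2K z : \int[Q]_w (D2 (z, w) * K (z, w)) = \sum_i (1 - Gam (dl i) / B).
Proof.
have bKz : bmeas (fun w => K (z, w)) := bmeas_section1 bK z.
transitivity (\int[Q]_w \sum_i (K (z, w) - E (dl i) z w * K (z, w))).
  apply: eq_Rintegral => w _; rewrite /D2 mulr_suml; apply: eq_bigr => i _ /=.
  by rewrite mulrBl mul1r.
rewrite Rint_sum; last by move=> i; apply: bmeasB => //; exact: bmeasM.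
by apply: eq_bigr => i _; rewrite RintB ?K1 ?QEK//; exact: bmeasM.
Qed.

Variable Eb : R.
Hypothesis hP : forall j l, j != l ->
  `|\int[P]_z C (kap j - kap l) z| <= Eb /\ `|\int[P]_z S (kap j - kap l) z| <= Eb.

Let c k : R := \int[P]_z C k z.
Let s k : R := \int[P]_z S k z.
Let nu k w : R := c k * C k w + s k * S k w.

Let bnu k : bmeas (nu k).
Proof. by apply: bmeasD; exact: bmeasZ. Qed.

Let PE k w : \int[P]_z E k z w = nu k w.
Proof.
rewrite /E RintD; [|by apply: bmeasM => //; exact: bmeas_cst..].
by congr (_ + _); under eq_Rintegral do rewrite mulrC;
  rewrite RintZ// mulrC.
Qed.

Let nu0 w : nu 0 w = 1.
Proof.
rewrite -PE -[RHS](Rint_cst P); apply: eq_Rintegral => z _.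
by rewrite /E /C /S !phase0 cos0 sin0 mul1r mul0r addr0.
Qed.

(** Parseval for two characters: only [l = k] and [l = - k] correlate. *)
Let Qnu k l : (`|c k| <= Eb /\ `|s k| <= Eb) -> (`|c l| <= Eb /\ `|s l| <= Eb) ->
  \int[Q]_w (nu k w * nu l w) <= Eb ^+ 2 * ((k == l)%:R + (k == - l)%:R).
Proof.
move=> [ck sk] [cl sl].
have -> : \int[Q]_w (nu k w * nu l w) =
  2^-1 * (k == l)%:R * (c k * c l + s k * s l)
  + 2^-1 * (k == - l)%:R * (c k * c l - s k * s l).
  transitivity (\int[Q]_w (c k * c l * (C k w * C l w) +
     (s k * s l * (S k w * S l w) +
     (s k * c l * (S k w * C l w) + c k * s l * (S l w * C k w))))).
    by apply: eq_Rintegral => w _; rewrite /nu; ring.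
  rewrite RintD ?RintZ; [|by do ?[apply: bmeasD|apply: bmeasZ|apply: bmeasM|]..].
  rewrite RintD ?RintZ; [|by do ?[apply: bmeasD|apply: bmeasZ|apply: bmeasM|]..].
  rewrite RintD ?RintZ; [|by do ?[apply: bmeasD|apply: bmeasZ|apply: bmeasM|]..].
  by rewrite Cov Sov !SCov; ring.
have Eb0 : 0 <= Eb := le_trans (normr_ge0 _) ck.
have h (x y : R) : `|x| <= Eb -> `|y| <= Eb -> `|x * y| <= Eb ^+ 2.
  by move=> hx hy; rewrite normrM expr2 ler_pM.
have := h _ _ ck cl; have := h _ _ sk sl; rewrite !ler_norml.
move=> /andP[h1 h2] /andP[h3 h4].
rewrite [leRHS]mulrDr lerD//.
  case: (k == l); rewrite ?mulr0 ?mul0r ?mulr1//=; lra.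
by case: (k == - l); rewrite ?mulr0 ?mul0r ?mulr1//=; lra.
Qed.

Let rho w : R := \int[P]_z K (z, w).

Let brho : bmeas rho.
Proof. exact: (bmeas_fubini2 P Q bK). Qed.

Let rhoE w : rho w - 1 = \sum_(p | fr p != 0) wt p * nu (fr p) w.
Proof.
rewrite /rho Rint_sum; last by move=> p /=; exact: bmeasZ.
rewrite -sum_wt0 -sumrB [RHS]big_mkcond/=; apply: eq_bigr => p _.
rewrite RintZ// PE; have [->|] := eqVneq (fr p) 0; first by rewrite nu0 subrr.
by rewrite mulr0 subr0.
Qed.

Let at_most_one v : \sum_l ((kap l == v)%:R : R) <= 1.
Proof.
have [/existsP[l0 /eqP <-]|] := boolP [exists l, kap l == v].
  rewrite (bigD1 l0)//= eqxx big1 ?addr0// => l ll0.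
  by rewrite (inj_eq kap_inj) (negbTE ll0).
by rewrite negb_exists => /forallP h; rewrite big1// => l _; rewrite (negbTE (h l)).
Qed.

Let wt_le p : wt p <= B^-1.
Proof.
case/andP: (b01 p.1) => ? ?; case/andP: (b01 p.2) => ? ?.
rewrite /wt -[leRHS]mul1r; apply: ler_wpM2r; first by rewrite invr_ge0 ltW.
exact: mulr_ile1.
Qed.

Let row_sum k : \sum_p wt p * (k == fr p)%:R <= #|J|%:R / B.
Proof.
rewrite sum_pair -sum1_card natr_sum mulr_suml; apply: ler_sum => j _.
rewrite mul1r (@le_trans _ _ (\sum_l B^-1 * (kap l == kap j - k)%:R))//.
  apply: ler_sum => l _; rewrite /fr /=.
  rewrite (_ : (k == _) = (kap l == kap j - k)) ?ler_wpM2r ?wt_le//.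
  by rewrite eq_sym subr_eq eq_sym [RHS]eq_sym subr_eq addrC.
by rewrite -mulr_sumr ler_piMr ?invr_ge0 ?(ltW B_gt0)// at_most_one.
Qed.

Let row_sumN k : \sum_p wt p * (k == - fr p)%:R <= #|J|%:R / B.
Proof.
rewrite (le_trans _ (row_sum (- k)))//; apply: ler_sum => p _.
by rewrite eqr_oppLR.
Qed.

Let sum_wt : \sum_p wt p <= #|J|%:R ^+ 2 / B.
Proof.
rewrite sum_pair (@le_trans _ _ (\sum_(j : J) \sum_(l : J) B^-1))//.
  by apply: ler_sum => j _; apply: ler_sum => l _.
rewrite !sumr_const -mulrnA -[leLHS]mulr_natr natrM mulrC.
by rewrite -[_%:R * _%:R]/(_%:R ^+ 2).
Qed.

(** By [rhoE], [rho - 1] is a trigonometric polynomial whose coefficients are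
    Fourier coefficients of [P], so that Parseval bounds its square. *)
Let Qrho2 : \int[Q]_w (rho w - 1) ^+ 2 <=
  Eb ^+ 2 * (#|J|%:R ^+ 2 / B * (2 * #|J|%:R / B)).
Proof.
have hfr p : fr p != 0 -> `|c (fr p)| <= Eb /\ `|s (fr p)| <= Eb.
  move=> frp; apply: hP; apply: contraNneq frp.
  by rewrite /fr => ->; rewrite subrr.
have -> : \int[Q]_w (rho w - 1) ^+ 2 =
    \int[Q]_w \sum_(p | fr p != 0) \sum_(p' | fr p' != 0)
      wt p * wt p' * (nu (fr p) w * nu (fr p') w).
  apply: eq_Rintegral => w _; rewrite rhoE expr2 big_distrlr.
  by apply: eq_bigr => p _; apply: eq_bigr => p' _ => /=; ring.
rewrite Rint_sum; last first.
  by move=> p; apply: bmeas_sum => p'; apply: bmeasZ; exact: bmeasM.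
apply: (@le_trans _ _ (\sum_(p | fr p != 0) \sum_(p' | fr p' != 0)
   wt p * wt p' * (Eb ^+ 2 * ((fr p == fr p')%:R + (fr p == - fr p')%:R)))).
  apply: ler_sum => p hp; rewrite Rint_sum; last first.
    by move=> p'; apply: bmeasZ; exact: bmeasM.
  apply: ler_sum => p' hp'; rewrite RintZ; last exact: bmeasM.
  by apply: ler_wpM2l; [exact: mulr_ge0|apply: Qnu; exact: hfr].
have J0 : 0 <= 2 * #|J|%:R / B by apply: divr_ge0; [exact: mulr_ge0|exact: ltW].
apply: (@le_trans _ _ (\sum_p Eb ^+ 2 * (wt p * (2 * #|J|%:R / B)))).
  rewrite big_mkcond /=; apply: ler_sum => p _; case: ifP => _; last first.
    by apply: mulr_ge0; [exact: sqr_ge0|exact: mulr_ge0].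
  apply: (@le_trans _ _ (Eb ^+ 2 * (wt p * (\sum_p' wt p' * (fr p == fr p')%:R
     + \sum_p' wt p' * (fr p == - fr p')%:R)))); last first.
    apply: ler_wpM2l; first exact: sqr_ge0.
    apply: ler_wpM2l => //; rewrite -mulrA mulrDl mul1r.
    by apply: lerD; [exact: row_sum|exact: row_sumN].
  rewrite -big_split/= !mulr_sumr big_mkcond/=; apply: ler_sum => p' _.
  case: ifP => _; first by rewrite le_eqVlt; apply/orP; left; apply/eqP; ring.
  rewrite -mulrDr; apply: mulr_ge0; first exact: sqr_ge0.
  by rewrite mulr_ge0// mulr_ge0// addr_ge0.
rewrite -mulr_sumr -mulr_suml; apply: ler_wpM2l; first exact: sqr_ge0.
exact: ler_wpM2r.
Qed.

(** By [x <= (N x^2 + 1 / N) / 2] the cost [sqrt D2] and the error [`|rho - 1|] of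
    [kernel_coupling] are replaced by squares, whose integrals are finite sums of
    Fourier coefficients. *)
Lemma trig_coupling (N : R) : 0 < N ->
  exists Pi : probability (T * T)%type R,
  [/\ forall A, measurable A -> Pi (A `*` setT) = P A,
      forall A, measurable A -> Pi (setT `*` A) = Q A
    & (\int[Pi]_z (Num.sqrt (D2 z))%:E <= (
        2^-1 * (N * \sum_i (1 - Gam (dl i) / B) + N^-1) +
        Num.sqrt (2 * n%:R) * (2^-1 *
         (N * (Eb ^+ 2 * (#|J|%:R ^+ 2 / B * (2 * #|J|%:R / B))) + N^-1)))%:E)%E].
Proof.
move=> N0; have [Pi [Pi1 Pi2 hPi]] := kernel_coupling P bK K0 K1.
exists Pi; split => //.
(* The arithmetic-geometric inequality, with the free parameter [N]. *)
have amgm (x : R) : x <= 2^-1 * (N * x ^+ 2 + N^-1).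
  rewrite -subr_ge0 (_ : _ - _ = 2^-1 * N * (x - N^-1) ^+ 2).
    by apply: mulr_ge0; [rewrite mulr_ge0 // ltW|exact: sqr_ge0].
  by field; rewrite gt_eqF.
have [mD2 _] := bD2.
have mD : measurable_fun setT (fun z => Num.sqrt (D2 z)).
  by apply: (measurableT_comp (f := @Num.sqrt R)) => //; apply: continuous_measurable_fun; exact: sqrt_continuous.
have D_le z : 0 <= Num.sqrt (D2 z) <= Num.sqrt (2 * n%:R).
  by rewrite sqrtr_ge0 ler_sqrt ?D2_le// mulr_ge0.
have bD : bmeas (fun z => Num.sqrt (D2 z)).
  split=> //; exists (Num.sqrt (2 * n%:R)) => z.
  by case/andP: (D_le z) => h1 h2; rewrite ger0_norm.
apply: (le_trans (hPi _ _ (sqrtr_ge0 _) mD D_le)).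
rewrite lee_fin lerD//; last first.
  rewrite ler_wpM2l ?sqrtr_ge0//.
  apply: (@le_trans _ _ (\int[Q]_w (2^-1 * (N * (rho w - 1) ^+ 2 + N^-1)))).
    apply: Rint_le => //.
    - by apply: bmeas_norm; apply: bmeasB => //; exact: bmeas_cst.
    - apply: bmeasZ; apply: bmeasD; last exact: bmeas_cst.
      by apply: bmeasZ; apply: bmeasM; apply: bmeasB => //; exact: bmeas_cst.
    by move=> w; rewrite -normrN opprB -[X in _ <= _ * (_ * X + _)]real_normK ?num_real// amgm.
  have br2 : bmeas (fun w => (rho w - 1) ^+ 2).
    by apply: bmeasM; apply: bmeasB => //; exact: bmeas_cst.
  rewrite RintZ; last by apply: bmeasD; [exact: bmeasZ|exact: bmeas_cst].
  rewrite ler_wpM2l// RintD; [|exact: bmeasZ|exact: bmeas_cst].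
  by rewrite Rint_cst RintZ// lerD2r ler_wpM2l ?(ltW N0).
rewrite -[leRHS](Rint_cst P); apply: Rint_le.
- exact: (bmeas_fubini1 P Q (bmeasM bD bK)).
- exact: bmeas_cst.
move=> z.
have bKz : bmeas (fun w => K (z, w)) := bmeas_section1 bK z.
have bDK : bmeas (fun w => D2 (z, w) * K (z, w)) := bmeas_section1 (bmeasM bD2 bK) z.
apply: (@le_trans _ _ (\int[Q]_w (2^-1 * (N * (D2 (z, w) * K (z, w)) + N^-1 * K (z, w))))).
  apply: Rint_le.
  - exact: (bmeas_section1 (bmeasM bD bK)).
  - by apply: bmeasZ; apply: bmeasD; exact: bmeasZ.
  move=> w; rewrite mulrA -mulrDl mulrA ler_wpM2r//.
  by rewrite -{2}(sqr_sqrtr (D2_ge0 (z, w))) amgm.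
rewrite RintZ; last by apply: bmeasD; exact: bmeasZ.
by rewrite RintD ?RintZ ?QD2K ?K1 ?mulr1//; exact: bmeasZ.
Qed.

End TrigCoupling.

(** * Tent weights and the Fourier estimate of transport *)

Section TentWeights.
Context (R : realType) (n m : nat).
Let M := m.+1.
Let L := (4 * M)%N.

(** Weights of period [L = 4 M] on the frequencies: their slope is [1 / (2 M)] while
    their mass is of order [M], hence the kernel with weights a product of tents
    has width of order [1 / M]. *)
Definition tent (t : nat) : R := (minn t (L - t))%:R / (2 * M)%:R.

Lemma tent01 (t : nat) : 0 <= tent t <= 1.
Proof.
rewrite divr_ge0//= ler_pdivrMr ?ltr0n// mul1r ler_nat /L geq_min.
by apply/orP; lia.
Qed.

Lemma tent_diff (t : 'I_L) : `|tent t - tent (ordS t)| <= (2 * M)%:R^-1.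
Proof.
have hM : (0 < (2 * M)%:R :> R) by rewrite ltr0n.
rewrite -mulrBl normrM [X in _ * X]ger0_norm ?invr_ge0 ?(ltW hM)//.
apply: ler_piMl; first by rewrite invr_ge0 ltW.
have ht := ltn_ord t; rewrite /ordS /=.
have [e|ne] := eqVneq t.+1 L.
  rewrite e modnn min0n subr0 ger0_norm// lern1.
  by clear -e; lia.
rewrite modn_small; last by rewrite ltn_neqAle ne.
have : (minn t (L - t) <= (minn t.+1 (L - t.+1)).+1)%N by lia.
have : (minn t.+1 (L - t.+1) <= (minn t (L - t)).+1)%N by lia.
rewrite -2!(ler_nat R) -2!natr1 ler_norml => ? ?; lra.
Qed.

Lemma tent_sum : (M%:R / 2 : R) <= \sum_(t < L) tent t ^+ 2.
Proof.
rewrite -(big_mkord xpredT (fun t => tent t ^+ 2)).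
rewrite (@big_cat_nat _ _ _ M)//=; last by rewrite /L; lia.
rewrite (@big_cat_nat _ _ _ (3 * M) M)//=; [|by lia|by rewrite /L; lia].
rewrite addrCA ler_wpDr//.
  by apply: addr_ge0; apply: sumr_ge0 => t _; exact: sqr_ge0.
apply: (@le_trans _ _ (\sum_(M <= t < 3 * M) 4^-1)).
  rewrite sumr_const_nat (_ : (3 * M - M = 2 * M)%N); last by lia.
  by rewrite -[leRHS]mulr_natr natrM; lra.
apply: ler_sum_nat => t /andP[t1 t2].
have h2 : 2^-1 <= tent t.
  rewrite /tent ler_pdivlMr ?ltr0n// natrM mulKf ?pnatr_eq0// ler_nat.
  by rewrite /L; lia.
by rewrite (_ : 4^-1 = 2^-1 ^+ 2 :> R) ?lerXn2r ?nnegrE ?invr_ge0//; [exact: le_trans h2|field].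
Qed.

Definition tentw (j : {ffun 'I_n -> 'I_L}) : R := \prod_i tent (j i).
Definition tentfr (j : {ffun 'I_n -> 'I_L}) : 'rV[int]_n := \row_i (j i : nat)%:Z.

Lemma tentw01 j : 0 <= tentw j <= 1.
Proof.
apply/andP; split; last by apply: prodr_ile1 => i _; exact: tent01.
by apply: prodr_ge0 => i _; have /andP[] := tent01 (j i).
Qed.

Lemma tentfr_inj : injective tentfr.
Proof.
move=> j l /rowP jl; apply/ffunP => i; apply: val_inj => /=.
by have := jl i; rewrite !mxE => -[].
Qed.

Let B := \sum_j tentw j ^+ 2.

Lemma tentw_norm : B = (\sum_(t < L) tent t ^+ 2) ^+ n.
Proof.
rewrite /B (eq_bigr (fun j : {ffun 'I_n -> 'I_L} => \prod_i tent (j i) ^+ 2)).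
  by rewrite -(bigA_distr_bigA (fun (i : 'I_n) (t : 'I_L) => tent t ^+ 2)) prodr_const card_ord.
by move=> j _; rewrite prodrXl.
Qed.

Lemma tentw_norm_gt0 : 0 < B.
Proof.
rewrite tentw_norm exprn_gt0// (lt_le_trans _ tent_sum)// divr_gt0// ltr0n.
Qed.

Lemma card_tent : #|{ffun 'I_n -> 'I_L}|%:R / B <= 8 ^+ n.
Proof.
rewrite ler_pdivrMr ?tentw_norm_gt0// tentw_norm -exprMn card_ffun !card_ord natrX.
rewrite lerXn2r ?nnegrE//.
  by rewrite mulr_ge0// sumr_ge0// => t _; rewrite sqr_ge0.
rewrite (@le_trans _ _ (8 * (M%:R / 2)))//; last by rewrite ler_wpM2l ?tent_sum.
by rewrite /L natrM; lra.
Qed.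

Let shift i (j : {ffun 'I_n -> 'I_L}) : {ffun 'I_n -> 'I_L} :=
  [ffun i' => if i' == i then ordS (j i) else j i'].

Let shift_inj i : injective (shift i).
Proof.
move=> j l /ffunP h; apply/ffunP => i'; have := h i'; rewrite !ffunE.
by case: eqP => [->|//]; exact: ordS_inj.
Qed.

Let tentw_shift i j : `|tentw j - tentw (shift i j)| <= (2 * M)%:R^-1.
Proof.
rewrite /tentw (bigD1 i)//= [X in _ - X](bigD1 i)//= ffunE eqxx.
rewrite [X in _ - _ * X](eq_bigr (fun i' => tent (j i'))); last first.
  by move=> i' /negbTE i'i; rewrite ffunE i'i.
rewrite -mulrBl normrM (le_trans _ (tent_diff (j i)))// ler_piMr//.
rewrite ger0_norm; last by apply: prodr_ge0 => i' _; case/andP: (tent01 (j i')).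
by apply: prodr_ile1 => i' _; exact: tent01.
Qed.

(** The gap is at most half the sum of the squared increments of [tentw] under a unit
    shift. The shift is made cyclic to be a bijection; the tent vanishes where it
    wraps around. *)
Lemma tentw_autocorrelation (i : 'I_n) :
  B - \sum_j \sum_l tentw j * tentw l * (tentfr l == tentfr j + delta_mx 0 i)%:R
  <= 2^-1 * #|{ffun 'I_n -> 'I_L}|%:R * (2 * M)%:R^-1 ^+ 2.
Proof.
apply: (@le_trans _ _ (B - \sum_j tentw j * tentw (shift i j))).
  rewrite lerD2l lerN2; apply: ler_sum => j _.
  have h0 l : 0 <= tentw j * tentw l * (tentfr l == tentfr j + delta_mx 0 i)%:R.
    by rewrite !mulr_ge0//; [have /andP[] := tentw01 j|have /andP[] := tentw01 l].
  have [e|ne] := eqVneq (j i).+1 L.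
    rewrite (_ : tentw (shift i j) = 0) ?mulr0 ?sumr_ge0//.
    rewrite /tentw (bigD1 i)//= ffunE eqxx /tent /= e modnn min0n !mul0r//.
  rewrite (bigD1 (shift i j))//= (_ : (_ == _) = true) ?mulr1 ?lerDl ?sumr_ge0//.
  apply/eqP/rowP => i'; rewrite !mxE ffunE /=; case: eqP => [->|_].
    have -> : ordS (j i) = (j i).+1 :> nat.
      by rewrite /= modn_small// ltn_neqAle ne ltn_ord.
    by rewrite -addn1 PoszD.
  by rewrite addr0.
rewrite (_ : B - _ = 2^-1 * \sum_j (tentw j - tentw (shift i j)) ^+ 2).
  rewrite -mulrA ler_wpM2l// -sum1_card natr_sum mulr_suml; apply: ler_sum => j _.
  by rewrite mul1r -real_normK ?num_real// lerXn2r ?nnegrE ?tentw_shift// invr_ge0.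
have hB : \sum_j tentw (shift i j) ^+ 2 = B.
  by rewrite /B [RHS](reindex_inj (@shift_inj i)).
have -> : \sum_j (tentw j - tentw (shift i j)) ^+ 2 =
    B + B - 2 * \sum_j tentw j * tentw (shift i j).
  rewrite -{2}hB /B -big_split/= mulr_sumr -sumrB; apply: eq_bigr => j _.
  by ring.
by field.
Qed.

End TentWeights.

(** The Euclidean distance, divided by [sqrt 2], of the images in the product of
    unit circles: a distance modulo the integer lattice which is a trigonometric
    polynomial up to the square root. *)
Definition chi_dist (R : realType) n (y y' : 'rV[R]_n) : R :=
  Num.sqrt (\sum_(i < n) (1 - cos (2 * pi * (y 0 i - y' 0 i)))).

Lemma chi_distE (R : realType) n (y y' : 'rV[R]_n) :
  chi_dist y y' = Num.sqrt (\sum_(i < n)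
    (1 - (cos (phase (delta_mx 0 i) y) * cos (phase (delta_mx 0 i) y') +
          sin (phase (delta_mx 0 i) y) * sin (phase (delta_mx 0 i) y')))).
Proof. by congr Num.sqrt; apply: eq_bigr => i _; rewrite !phase_delta mulrBr cosB. Qed.

(** If the Fourier coefficients of nonzero frequency vanish for the image of [Q] and,
    up to frequency [4 M], are at most [e] for the image of [P], where [M = m.+1],
    the two can be coupled at a cost of order
    [1 / M + e^2 M^(n+1)]: the first term is the width of the kernel, the second
    one the mismatch of its marginal, a sum over about [M^n] frequencies multiplied
    by the factor [M] of the arithmetic-geometric inequality. *)
Lemma fourier_coupling d (T : measurableType d) (R : realType) (n : nat)
  (P Q : probability T R) (Y : T -> 'rV[R]_n) :
  (forall k : 'rV[int]_n, measurable_fun setT (fun z => cos (phase k (Y z)))) ->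
  (forall k : 'rV[int]_n, measurable_fun setT (fun z => sin (phase k (Y z)))) ->
  (forall k : 'rV[int]_n, k != 0 -> \int[Q]_z cos (phase k (Y z)) = 0 /\
                       \int[Q]_z sin (phase k (Y z)) = 0) ->
  forall (m : nat) (e : R),
  (forall k : 'rV[int]_n, k != 0 -> (forall i, `|k 0 i| <= (4 * m.+1)%:Z) ->
    `|\int[P]_z cos (phase k (Y z))| <= e /\
    `|\int[P]_z sin (phase k (Y z))| <= e) ->
  exists Pi : probability (T * T)%type R,
  [/\ forall A, measurable A -> Pi (A `*` setT) = P A,
      forall A, measurable A -> Pi (setT `*` A) = Q A
    & (\int[Pi]_z (chi_dist (Y z.1) (Y z.2))%:E <=
       ((n%:R * 8 ^+ n + 1 + Num.sqrt (2 * n%:R) * (64 ^+ n * 4 ^+ n + 1)) *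
        (m.+1%:R^-1 + e ^+ 2 * m.+1%:R ^+ n.+1))%:E)%E].
Proof.
move=> mC mS hQ m e hP.
have hP' j l : j != l ->
  `|\int[P]_z cos (phase (@tentfr n m j - tentfr l) (Y z))| <= e /\
  `|\int[P]_z sin (phase (@tentfr n m j - tentfr l) (Y z))| <= e.
  move=> jl; apply: hP; first by rewrite subr_eq0 (inj_eq (@tentfr_inj n m)).
  move=> i; rewrite !mxE; have := ltn_ord (j i); have := ltn_ord (l i).
  by move: (nat_of_ord (j i)) (nat_of_ord (l i)) => a b ? ?; rewrite ler_norml; lia.
have M0 : (0 < m.+1%:R :> R) by rewrite ltr0n.
have [Pi [Pi1 Pi2 hPi]] := trig_coupling mC mS hQ (@tentw01 R n m) (@tentfr_inj n m)
  (@tentw_norm_gt0 R n m) hP' M0.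
exists Pi; split => //.
under eq_integral do rewrite chi_distE.
apply: (le_trans hPi); rewrite lee_fin.
set B := \sum_j tentw R j ^+ 2; set J := #|_|%:R.
have B0 : 0 < B := @tentw_norm_gt0 R n m.
have JB : J / B <= 8 ^+ n := @card_tent R n m.
have JB0 : 0 <= J / B by rewrite divr_ge0// ltW.
set M : R := m.+1%:R in M0 *.
have JE : J = 4 ^+ n * M ^+ n by rewrite /J card_ffun !card_ord natrX natrM exprMn.
have M1 : 0 <= M^-1 by rewrite invr_ge0 ltW.
apply: (@le_trans _ _ (((n%:R * 8 ^+ n + 1) + Num.sqrt (2 * n%:R)) * M^-1
   + Num.sqrt (2 * n%:R) * (64 ^+ n * 4 ^+ n) * (e ^+ 2 * M ^+ n.+1))); last first.
  have s0 := sqrtr_ge0 (2 * n%:R : R).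
  have e0 : 0 <= e ^+ 2 * M ^+ n.+1 by rewrite mulr_ge0 ?sqr_ge0// exprn_ge0// ltW.
  have u0 : 0 <= (64 ^+ n * 4 ^+ n : R) by rewrite mulr_ge0 ?exprn_ge0.
  have v0 : 0 <= (n%:R * 8 ^+ n : R) by rewrite mulr_ge0 ?exprn_ge0.
  rewrite -subr_ge0 (_ : _ - _ = Num.sqrt (2 * n%:R) * (64 ^+ n * 4 ^+ n) * M^-1
    + (n%:R * 8 ^+ n + 1 + Num.sqrt (2 * n%:R)) * (e ^+ 2 * M ^+ n.+1)).
    apply: addr_ge0; first by rewrite !mulr_ge0.
    by apply: mulr_ge0 => //; rewrite !addr_ge0.
  by ring.
have hgap i : 1 - (\sum_(j : {ffun 'I_n -> 'I_(4 * m.+1)}) \sum_(l : {ffun 'I_n -> 'I_(4 * m.+1)}) tentw R j * tentw R l *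
    (tentfr l == tentfr j + delta_mx 0 i :> 'rV[int]_n)%:R) / B <=
    2^-1 * 8 ^+ n * M^-1 ^+ 2.
  rewrite -[X in X - _](divff (lt0r_neq0 B0)) -mulrBl.
  apply: (@le_trans _ _ (2^-1 * (J / B) * (2 * m.+1)%:R^-1 ^+ 2)).
    rewrite mulrA mulrAC ler_wpM2r ?invr_ge0 ?(ltW B0)//.
    exact: (@tentw_autocorrelation R n m i).
  have : (2 * m.+1)%:R^-1 ^+ 2 <= M^-1 ^+ 2.
    rewrite lerXn2r ?nnegrE ?invr_ge0// lef_pV2 ?posrE ?ltr0n// ler_nat; lia.
  have : 0 <= (2 * m.+1)%:R^-1 ^+ 2 :> R by rewrite sqr_ge0.
  by move=> h1 h2; apply: ler_pM => //; [exact: mulr_ge0|exact: ler_wpM2l].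
have hsum : \sum_(i < n) (1 - (\sum_(j : {ffun 'I_n -> 'I_(4 * m.+1)}) \sum_(l : {ffun 'I_n -> 'I_(4 * m.+1)}) tentw R j * tentw R l *
    (tentfr l == tentfr j + delta_mx 0 i :> 'rV[int]_n)%:R) / B) <=
    n%:R * (2^-1 * 8 ^+ n * M^-1 ^+ 2).
  rewrite -[X in _ <= X%:R * _]card_ord -sum1_card natr_sum mulr_suml.
  by apply: ler_sum => i _; rewrite mul1r.
have Mn0 : M != 0 by rewrite gt_eqF.
have s0 := sqrtr_ge0 (2 * n%:R : R).
have hJ : J ^+ 2 / B * (2 * J / B) <= 2 * (64 ^+ n * 4 ^+ n) * M ^+ n.
  rewrite (_ : _ / B * _ = 2 * ((J / B) ^+ 2 * J)); last by ring.
  rewrite -mulrA ler_wpM2l// JE -mulrA ler_wpM2r//.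
    by rewrite mulr_ge0 ?exprn_ge0// ltW.
  rewrite (_ : 64 ^+ n = (8 ^+ n) ^+ 2 :> R) -?JE; last first.
    by rewrite -exprM mulnC exprM; congr (_ ^+ n); ring.
  by rewrite lerXn2r ?nnegrE ?exprn_ge0.
rewrite [(_ + Num.sqrt _) * _]mulrDl -[leRHS]addrA; apply: lerD.
  apply: (@le_trans _ _ (2^-1 * (M * (n%:R * (2^-1 * 8 ^+ n * M^-1 ^+ 2)) + M^-1))).
    by rewrite ler_wpM2l// lerD2r ler_wpM2l// ltW.
  rewrite (_ : M * _ = n%:R * 8 ^+ n * 2^-1 * M^-1); last by field.
  have : 0 <= n%:R * 8 ^+ n * M^-1 by rewrite !mulr_ge0 ?exprn_ge0.
  move=> h; rewrite -subr_ge0 (_ : _ - _ =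
    3 / 4 * (n%:R * 8 ^+ n * M^-1) + 2^-1 * M^-1); last by field.
  by rewrite addr_ge0 ?mulr_ge0.
rewrite -[_ * _ * (e ^+ 2 * _)]mulrA -mulrDr; apply: ler_wpM2l => //.
apply: (@le_trans _ _ (2^-1 * (M * (e ^+ 2 * (2 * (64 ^+ n * 4 ^+ n) * M ^+ n)) + M^-1))).
  rewrite ler_wpM2l// lerD2r ler_wpM2l ?(ltW M0)//.
  by apply: ler_wpM2l => //; exact: sqr_ge0.
rewrite (_ : 2^-1 * _ = 2^-1 * M^-1 + 64 ^+ n * 4 ^+ n * (e ^+ 2 * M ^+ n.+1)).
  by rewrite lerD2r ler_piMl// invf_le1// ler1n.
by rewrite [M ^+ n.+1]exprS; move: (64 ^+ n * 4 ^+ n) (M ^+ n) M^-1 => a b c; field.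
Qed.

(** * Calculus with directional derivatives *)

Section LineDerivative.
Context (R : realType) (V : normedModType R).
Implicit Types (f : V -> R) (x v w : V).

Let line_quotient (W : normedModType R) (f : V -> W) x v (t : R) :
  (fun h : R => h^-1 *: (f (x + (h *: 1 + t) *: v) - f (x + t *: v))) =
  (fun h => h^-1 *: (f (h *: v + (x + t *: v)) - f (x + t *: v))).
Proof. by apply/funext => h; rewrite scalerDl [_ *: 1]mulr1 addrCA. Qed.

Lemma is_derive_line (W : normedModType R) (f : V -> W) x v (t : R) :
  derivable f (x + t *: v) v ->
  is_derive t 1 (fun s => f (x + s *: v)) ('D_v f (x + t *: v)).
Proof.
by move=> df; apply: DeriveDef; rewrite /derivable /derive /= line_quotient.
Qed.

Lemma derive_line (W : normedModType R) (f : V -> W) x v :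
  'D_v f x = 'D_1 (fun s : R => f (x + s *: v)) 0.
Proof. by rewrite {2}/derive /= line_quotient scale0r addr0. Qed.

Lemma derivable_line (W : normedModType R) (f : V -> W) x v :
  derivable (fun s : R => f (x + s *: v)) 0 1 -> derivable f x v.
Proof. by rewrite {1}/derivable /= line_quotient scale0r addr0. Qed.

Lemma line_mvt f x v : (forall y, derivable f y v) ->
  exists2 c : R, 0 < c < 1 & f (x + v) - f x = 'D_v f (x + c *: v).
Proof.
move=> df.
have dl (t : R) : is_derive t 1 (fun s => f (x + s *: v)) ('D_v f (x + t *: v)).
  exact: is_derive_line.
have cl : {within `[0, 1], continuous (fun s : R => f (x + s *: v))}.
  apply: continuous_subspaceT => t.
  apply: differentiable_continuous; apply/derivable1_diffP.
  by have [] := dl t.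
have [c] := MVT ltr01 (fun t _ => dl t) cl.
by rewrite in_itv/= scale1r scale0r addr0 subr0 mulr1 => ? ?; exists c.
Qed.

Lemma deriveZv f x (a : R) v : derivable f x v ->
  derivable f x (a *: v) /\ 'D_(a *: v) f x = a * 'D_v f x.
Proof.
move=> df.
have h1 : is_derive (a * 0) 1 (fun s : R => f (x + s *: v)) ('D_v f x).
  have := @is_derive_line _ f x v 0; rewrite mulr0 scale0r addr0; exact.
have h2 : is_derive (0 : R) 1 (fun s : R => a * s) a.
  by apply: is_derive_eq; rewrite [_ *: 1]mulr1.
have [h3 h4] := @is_derive1_comp _ _ _ _ _ _ h1 h2.
have E : (fun s : R => f (x + s *: v)) \o (fun s => a * s) =
   (fun s => f (x + s *: (a *: v))).
  by apply/funext => s /=; rewrite scalerA mulrC.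
rewrite E in h3 h4; split; first exact: derivable_line.
by rewrite derive_line h4 mulrC.
Qed.

(** The increment along [v + w] splits into one along [v] and one along [w] from a
    moving base point; the mean value theorem and the continuity of ['D_w f] give
    the limit of the second. *)
Lemma deriveDv f x v w :
  (forall y, derivable f y v) -> (forall y, derivable f y w) ->
  {for x, continuous ('D_w f)} -> 
  'D_(v + w) f x = 'D_v f x + 'D_w f x.
Proof.
move=> dv dw cw; apply/cvg_lim => //.
have hv : (fun h : R => h^-1 *: (f (h *: v + x) - f x)) @ 0^' --> 'D_v f x.
  by have := dv x; rewrite /derivable => /cvg_ex[l hl]; rewrite (_ : 'D_v f x = l)//; apply/cvg_lim.
suff hw : (fun h : R => h^-1 *: (f (h *: (v + w) + x) - f (h *: v + x))) @ 0^' --> 'D_w f x.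
  rewrite (_ : (fun h : R => h^-1 *: ((f \o shift x) (h *: (v + w)) - f x)) =
    (fun h => h^-1 *: (f (h *: v + x) - f x) +
              h^-1 *: (f (h *: (v + w) + x) - f (h *: v + x)))).
    exact: cvgD hv hw.
  by apply/funext => h /=; rewrite -scalerDr; congr (_ *: _); ring.
apply/cvgrPdist_le => e e0.
have /cvgrPdist_le/(_ e e0)/nbhs_ballP[d /= d0 hd] := cw.
have D0 : 0 < `|v| + `|w| + 1 by rewrite ltr_wpDl ?addr_ge0.
near=> h.
have h0 : h != 0 by near: h; exact: nbhs_dnbhs_neq.
have hh : `|h| < d / (`|v| + `|w| + 1) by near: h; apply: dnbhs0_lt; rewrite divr_gt0.
have dhw y : derivable f y (h *: w) by have [] := deriveZv h (dw y).
have [c /andP[c0 c1] E] := line_mvt (h *: v + x) dhw.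
have -> : h *: (v + w) + x = h *: v + x + h *: w by rewrite scalerDr addrAC.
rewrite E (deriveZv h (dw _)).2 [_ *: _]mulKf//.
apply: hd; rewrite -ball_normE /= distrC [_ + _ - x]addrAC addrK.
rewrite (le_lt_trans (ler_normD _ _))// !normrZ (gtr0_norm c0).
rewrite (@le_lt_trans _ _ (`|h| * (`|v| + `|w| + 1)))//; last by rewrite -ltr_pdivlMr.
rewrite mulrDr mulrDr -addrA lerD2l ler_wpDr ?mulr1// mulrA ler_wpM2r//.
by rewrite ler_piMl// ltW.
Unshelve. all: by end_near. Qed.

Lemma derive_bigsum f x (I : Type) (s : seq I) (v : I -> V) :
  Ck 1 f -> 'D_(\sum_(i <- s) v i) f x = \sum_(i <- s) 'D_(v i) f x.
Proof.
move=> [_ C1f]; elim: s => [|i s IH]; first by rewrite !big_nil derive0.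
rewrite !big_cons deriveDv ?IH//; first exact: (C1f _).1.
- exact: (C1f _).1.
- exact: (C1f _).2.1.
Qed.

End LineDerivative.

Lemma continuous_bigsum (R : realType) (T : topologicalType)
  (W : normedModType R) (I : Type) (s : seq I) (F : I -> T -> W) :
  (forall i, continuous (F i)) -> continuous (fun x => \sum_(i <- s) F i x).
Proof.
move=> cF; elim: s => [|i s IH].
  rewrite (_ : (fun _ => _) = cst 0); first exact: cst_continuous.
  by apply/funext => x; rewrite big_nil.
rewrite (_ : (fun _ => _) = (fun x => F i x + \sum_(j <- s) F j x)).
  by move=> x; apply: cvgD; [exact: cF|exact: IH].
by apply/funext => x; rewrite big_cons.
Qed.

Section RowCalculus.
Context (R : realType) (n : nat).
Implicit Types (f : 'rV[R]_n -> R) (x v : 'rV[R]_n).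

Lemma derive_coordE f x v : Ck 1 f ->
  'D_v f x = \sum_i v 0 i * 'D_(delta_mx 0 i) f x.
Proof.
move=> C1f; rewrite {1}[v]row_sum_delta derive_bigsum//; apply: eq_bigr => i _.
by apply: (deriveZv _ _).2; exact: (C1f.2 _).1.
Qed.

Lemma rV_norm_coord x i : `|x 0 i| <= `|x|.
Proof.
by rewrite [leRHS]/Num.Def.normr/= mx_normrE; exact: (le_bigmax _ _ (0, i)).
Qed.

Lemma rV_norm_le x (e : R) : 0 <= e -> (forall i, `|x 0 i| <= e) -> `|x| <= e.
Proof.
move=> e0 h; rewrite [leLHS]/Num.Def.normr/= mx_normrE.
by rewrite (bigmax_le _ e0)//= => -[i j] _; rewrite (ord1 i).
Qed.

Definition gradient f x : 'rV[R]_n := \row_i 'D_(delta_mx 0 i) f x.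

(** By the mean value theorem along [h] and the coordinate formula for ['D_h f],
    whose coefficients are continuous. *)
Lemma C1_differentiable f x : Ck 1 f -> differentiable f x.
Proof.
move=> C1f.
pose L : 'rV[R]_n -> R := fun h => \sum_i h 0 i * 'D_(delta_mx 0 i) f x.
have lL : linear L.
  move=> a u v; rewrite /L scaler_sumr -big_split/=; apply: eq_bigr => i _.
  by rewrite !mxE mulrDl -mulrA.
pose LL : {linear 'rV[R]_n -> R} := HB.pack L (GRing.isLinear.Build _ _ _ _ L lL).
have cL : continuous LL.
  apply: continuous_bigsum => i y.
  have cc : continuous (fun h : 'rV[R]_n => h 0 i) := @coord_continuous _ _ _ 0 i.
  exact: cvgMr_tmp (cc y).
have E : f \o shift x = cst (f x) + LL +o_ (0 : 'rV[R]_n) id.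
  apply/eqaddoP => e e0.
  have hc i : \forall y \near x, `|'D_(delta_mx 0 i) f x - 'D_(delta_mx 0 i) f y| <= e / n.+1%:R.
    have /cvgrPdist_le := (C1f.2 (delta_mx 0 i)).2.1 x; apply.
    by rewrite divr_gt0.
  have /nbhs_ballP[d /= d0 hd] : \forall y \near x, forall i : 'I_n, `|'D_(delta_mx 0 i) f x - 'D_(delta_mx 0 i) f y| <= e / n.+1%:R.
    exact: (@filter_forall _ 'I_n (fun i y => `|'D_(delta_mx 0 i) f x - 'D_(delta_mx 0 i) f y| <= e / n.+1%:R) _ _ hc).
  have N : \forall h \near (0 : 'rV[R]_n), `|h| < d by exact: nbhs0_lt.
  apply: filterS N => h hh.
  have [c /andP[c0 c1] Ec] : exists2 c : R, 0 < c < 1 &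
      f (x + h) - f x = 'D_h f (x + c *: h).
    by apply: line_mvt; exact: (C1f.2 _).1.
  have -> : (f \o shift x - (cst (f x) + LL)) h =
      \sum_i h 0 i * ('D_(delta_mx 0 i) f (x + c *: h) - 'D_(delta_mx 0 i) f x).
    rewrite -![(_ - _) h]/(_ - _) /= [h + x]addrC opprD addrA Ec derive_coordE//.
    by rewrite -sumrB; apply: eq_bigr => i _; rewrite mulrBr.
  rewrite (le_trans (ler_norm_sum _ _ _))// (@le_trans _ _ (\sum_(i < n) `|h| * (e / n.+1%:R)))//.
    apply: ler_sum => i _; rewrite normrM ler_pM ?rV_norm_coord// distrC.
    apply: hd; rewrite -ball_normE /= opprD addrA subrr add0r normrN normrZ gtr0_norm//.
    by rewrite (le_lt_trans _ hh)// ler_piMl// ltW.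
  rewrite sumr_const card_ord -mulrnAr mulrC ler_wpM2r//.
  by rewrite -[leLHS]mulr_natr mulrAC ler_pdivrMr// ler_wpM2l ?(ltW e0)// ler_nat.
by apply/diff_locallyP; rewrite (diff_unique cL E); split.
Qed.

(** A curve may approach its limit from any direction, so that this chain rule
    rests on total differentiability. *)
Lemma is_derive_curve f (X : R -> 'rV[R]_n) (t : R) (v : 'rV[R]_n) :
  Ck 1 f -> is_derive t 1 X v -> is_derive t 1 (f \o X) ('D_v f (X t)).
Proof.
move=> C1f [dX eX].
have dX' : differentiable X t by exact/derivable1_diffP.
have df := C1_differentiable (X t) C1f.
have dfX : differentiable (f \o X) t by exact: differentiable_comp.
apply: DeriveDef; first exact/derivable1_diffP.
rewrite deriveE// diff_comp//= -eX [in RHS]deriveE//.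
by rewrite deriveE.
Qed.

End RowCalculus.

(** * Maps of class C^1, periodicity, integer-valued functions *)

Section MoreCalculus.
Context (R : realType).

Lemma continuous_of_comp (A B D : topologicalType) (f : A -> B) (g : B -> D) :
  continuous f -> continuous g -> continuous (fun x => g (f x)).
Proof. by move=> cf cg x; exact: (continuous_comp (cf x) (cg (f x))). Qed.

Lemma continuous_mul (T : topologicalType) (f g : T -> R) :
  continuous f -> continuous g -> continuous (fun x => f x * g x).
Proof. by move=> cf cg x; apply: (@continuousM R T f g x); [exact: cf|exact: cg]. Qed.

Lemma continuous_coord (T : topologicalType) m (g : T -> 'rV[R]_m) i :
  continuous g -> continuous (fun x => g x 0 i).
Proof.
move=> cg; apply: (@continuous_of_comp _ _ _ g (fun h : 'rV[R]_m => h 0 i)) => //.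
exact: coord_continuous.
Qed.

Lemma derive_periodic (V W : normedModType R) (f : V -> W) (c : V) :
  (forall z, f (z + c) = f z) -> forall v z, 'D_v f (z + c) = 'D_v f z.
Proof.
move=> fc v z; rewrite /derive.
rewrite (_ : (fun h : R => h^-1 *: ((f \o shift (z + c)) (h *: v) - f (z + c))) =
   (fun h : R => h^-1 *: ((f \o shift z) (h *: v) - f z)))//.
by apply/funext => h /=; rewrite addrA !fc.
Qed.

Section Coord.
Context (V : normedModType R) (m : nat) (Psi : V -> 'rV[R]_m).
Hypothesis C1Psi : Ck 1 Psi.

Lemma derive_coord v x i : 'D_v (fun y => Psi y 0 i) x = ('D_v Psi x) 0 i.
Proof. by rewrite derive_mx ?mxE//; exact: (C1Psi.2 v).1. Qed.

Lemma C1_coord i : Ck 1 (fun x => Psi x 0 i).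
Proof.
have [cP dP] := C1Psi.
split; first exact: continuous_coord.
move=> v; split; first by move=> x; exact: ((derivable_mxP _ _ _).1 ((dP v).1 x) 0 i).
split=> //; rewrite (_ : (fun x => _) = (fun x => 'D_v Psi x 0 i)).
  exact/continuous_coord/(dP v).2.1.
by apply/funext => x /=; rewrite derive_coord.
Qed.

End Coord.

Lemma C1_comp (V : normedModType R) m (f : 'rV[R]_m -> R) (Psi : V -> 'rV[R]_m) :
  Ck 1 f -> Ck 1 Psi ->
  (forall v x, 'D_v (f \o Psi) x = 'D_('D_v Psi x) f (Psi x)) /\ Ck 1 (f \o Psi).
Proof.
move=> C1f C1P.
have isd v x : is_derive (0 : R) 1 (fun s : R => f (Psi (x + s *: v))) ('D_('D_v Psi x) f (Psi x)).
  have := @is_derive_line _ _ _ Psi x v 0; rewrite scale0r addr0.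
  move=> /(_ ((C1P.2 v).1 x)) h.
  by have := is_derive_curve C1f h; rewrite scale0r addr0.
have E v x : 'D_v (f \o Psi) x = 'D_('D_v Psi x) f (Psi x).
  by rewrite derive_line; have [_ <-] := isd v x.
split=> //; split; first exact: (continuous_of_comp C1P.1 C1f.1).
move=> v; split; first by move=> x; apply: derivable_line; have [] := isd v x.
split=> //; rewrite (_ : (fun x => _) = fun x => \sum_i ('D_v Psi x) 0 i * 'D_(delta_mx 0 i) f (Psi x)).
  apply: continuous_bigsum => i; apply: continuous_mul.
    exact/continuous_coord/(C1P.2 v).2.1.
  exact: (continuous_of_comp C1P.1 (C1f.2 _).2.1).
by apply/funext => x /=; rewrite E derive_coordE.
Qed.

Definition jac n m (Psi : 'rV[R]_n -> 'rV[R]_m) x : 'M[R]_(n, m) :=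
  \matrix_(i, j) ('D_(delta_mx 0 i) Psi x) 0 j.

Lemma derive_jac n m (Psi : 'rV[R]_n -> 'rV[R]_m) v x : Ck 1 Psi ->
  'D_v Psi x = v *m jac Psi x.
Proof.
move=> C1P; apply/rowP => j; rewrite -derive_coord// derive_coordE; last exact: C1_coord.
by rewrite mxE; apply: eq_bigr => i _; rewrite mxE derive_coord.
Qed.

Lemma pair_sum_delta n (a b : 'rV[R]_n) : (a, b) =
  \sum_(i < n) (a 0 i *: (delta_mx 0 i : 'rV[R]_n, 0 : 'rV[R]_n)) +
  \sum_(i < n) (b 0 i *: (0 : 'rV[R]_n, delta_mx 0 i : 'rV[R]_n)).
Proof.
have h (F G : 'I_n -> 'rV[R]_n) : \sum_i (F i, G i) = (\sum_i F i, \sum_i G i).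
  by apply: (big_ind3 (fun x y z => x = (y, z))) => // x1 x2 x3 y1 y2 y3 -> ->.
have sp (c : R) (u w : 'rV[R]_n) : c *: (u, w) = (c *: u, c *: w) by [].
have ap (u w u' w' : 'rV[R]_n) : (u, w) + (u', w') = (u + u', w + w') by [].
under eq_bigr do rewrite sp scaler0.
under [X in _ = _ + X]eq_bigr do rewrite sp scaler0.
by rewrite !h -!row_sum_delta ap !big1 ?addr0 ?add0r.
Qed.

Lemma derive_pair_coordE n (f : 'rV[R]_n * 'rV[R]_n -> R) z (a b : 'rV[R]_n) :
  Ck 1 f -> 'D_(a, b) f z =
  \sum_i a 0 i * 'D_(delta_mx 0 i : 'rV[R]_n, 0 : 'rV[R]_n) f z +
  \sum_i b 0 i * 'D_(0 : 'rV[R]_n, delta_mx 0 i : 'rV[R]_n) f z.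
Proof.
move=> C1f.
have dv y v : derivable f y v := (C1f.2 v).1 y.
rewrite pair_sum_delta deriveDv//; last exact: (C1f.2 _).2.1.
rewrite !derive_bigsum//.
by congr (_ + _); apply: eq_bigr => i _; rewrite (deriveZv _ (dv _ _)).2.
Qed.

Definition intr_row n (k : 'rV[int]_n) : 'rV[R]_n := map_mx intr k.

(** Periodicity brings the base point into the compact unit cube. *)
Lemma periodic_bounded n (g : 'rV[R]_n * 'rV[R]_n -> R) (r : R) :
  continuous g -> (forall x p k, g (x + intr_row k, p) = g (x, p)) ->
  exists2 K : R, 0 <= K & forall x p, `|p| <= r -> `|g (x, p)| <= K.
Proof.
move=> cg pg; have [r0|r0] := ltP r 0.
  by exists 0 => // x p pr; have := le_lt_trans pr r0; rewrite ltNge normr_ge0.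
pose A := [set v : 'rV[R]_n | forall i, (`[0, 1]%classic : set R) (v 0 i)].
pose B := [set v : 'rV[R]_n | forall i, (`[- r, r]%classic : set R) (v 0 i)].
have cA : compact A by apply: (@rV_compact _ _ (fun=> (`[0, 1]%classic : set R))) => i; exact: segment_compact.
have cB : compact B by apply: (@rV_compact _ _ (fun=> (`[- r, r]%classic : set R))) => i; exact: segment_compact.
have [c _ hc] : exists2 c, c \in A `*` B & forall t, t \in A `*` B -> `|g t| <= `|g c|.
  apply: (@compact_EVT_max _ _ (fun t => `|g t|)).
  - exists (0, 0); split=> i /=; rewrite mxE in_itv/= ?lexx ?ler01//.
    by rewrite oppr_le0 r0.
  - exact: compact_setX.
  - apply: continuous_subspaceT => t; apply: continuous_comp; first exact: cg.
    exact: norm_continuous.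
exists `|g c| => // x p pr.
pose k : 'rV[int]_n := \row_i Num.floor (x 0 i).
rewrite -(subrK (intr_row k) x) pg; apply: hc; rewrite inE; split => i /=.
  rewrite !mxE in_itv/= subr_ge0 floor_le_tmp lerBlDr addrC.
  by have := floorD1_gt (x 0 i); rewrite intrD1 => /ltW.
by rewrite in_itv/= -ler_norml (le_trans _ pr)// rV_norm_coord.
Qed.

Lemma int_locally_const (T : topologicalType) (g : T -> R) :
  continuous g -> (forall x, g x \is a Num.int) ->
  forall x, \forall y \near x, g y = g x.
Proof.
move=> cg ig x; have /cvgrPdist_lt/(_ 1 ltr01) := cg x.
apply: filterS => y /=.
have /intrP[m ->] := ig x; have /intrP[l ->] := ig y.
rewrite -rmorphB -intr_norm ltrz1 => h; congr (_%:~R).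
by move: h; rewrite ltr_norml; lia.
Qed.

(** Such a function is locally constant, so that its directional derivatives vanish
    and the mean value theorem applies. *)
Lemma int_const (V : normedModType R) (g : V -> R) :
  continuous g -> (forall x, g x \is a Num.int) -> forall x y, g x = g y.
Proof.
move=> cg ig x y.
have isd v z : is_derive z v g 0.
  apply: near_eq_is_derive (is_derive_cst (g z) z v).
  by apply: filterS (int_locally_const cg ig z) => t ->.
have [|c _] := @line_mvt _ _ g y (x - y).
  by move=> z; have [] := isd (x - y) z.
have [_ ->] := isd (x - y) (y + c *: (x - y)).
by rewrite [y + _]addrC subrK => /eqP; rewrite subr_eq0 => /eqP.
Qed.

End MoreCalculus.

(** * Euclidean norm, torus and Borel structure of the bundle *)

Section EuclideanNorm.
Context (R : realType) (n : nat).
Implicit Types (u v w : 'rV[R]_n).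

Lemma dotpC u v : dotp u v = dotp v u.
Proof. by apply: eq_bigr => i _; rewrite mulrC. Qed.

Lemma dotpDr u v w : dotp u (v + w) = dotp u v + dotp u w.
Proof. by rewrite -big_split/=; apply: eq_bigr => i _; rewrite mxE mulrDr. Qed.

Lemma dotp0r u : dotp u 0 = 0.
Proof. by rewrite /dotp big1// => i _; rewrite mxE mulr0. Qed.

Lemma dotpZr u (a : R) v : dotp u (a *: v) = a * dotp u v.
Proof. by rewrite mulr_sumr; apply: eq_bigr => i _; rewrite mxE mulrCA. Qed.

Lemma dotpNr u v : dotp u (- v) = - dotp u v.
Proof. by rewrite -scaleN1r dotpZr mulN1r. Qed.

Lemma dotpBr u v w : dotp u (v - w) = dotp u v - dotp u w.
Proof. by rewrite dotpDr dotpNr. Qed.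

Lemma dotpDl u v w : dotp (u + v) w = dotp u w + dotp v w.
Proof. by rewrite dotpC dotpDr ![dotp w _]dotpC. Qed.

Lemma dotpBl u v w : dotp (u - v) w = dotp u w - dotp v w.
Proof. by rewrite dotpC dotpBr ![dotp w _]dotpC. Qed.

Lemma dotp_mulmxl m (u : 'rV[R]_m) (A : 'M[R]_(m, n)) v :
  dotp (u *m A) v = dotp u (v *m A^T).
Proof.
rewrite /dotp (eq_bigr (fun j => \sum_i u 0 i * A i j * v 0 j)); last first.
  by move=> j _; rewrite mxE mulr_suml.
rewrite exchange_big; apply: eq_bigr => i _ /=.
by rewrite mxE mulr_sumr; apply: eq_bigr => j _; rewrite mxE -mulrA [v 0 j * _]mulrC.
Qed.

Lemma dotp_le u v : `|dotp u v| <= n%:R * (`|u| * `|v|).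
Proof.
rewrite (le_trans (ler_norm_sum _ _ _))//.
rewrite mulr_natl -[X in _ *+ X]card_ord -sumr_const; apply: ler_sum => i _.
by rewrite normrM ler_pM// rV_norm_coord.
Qed.

Lemma dotp_ge0 u : 0 <= dotp u u.
Proof. by apply: sumr_ge0 => i _; rewrite -expr2 sqr_ge0. Qed.

Lemma enorm_ge0 u : 0 <= enorm u. Proof. exact: sqrtr_ge0. Qed.

Lemma norm_le_enorm u : `|u| <= enorm u.
Proof.
apply: rV_norm_le => [|i]; first exact: enorm_ge0.
rewrite -sqrtr_sqr ler_sqrt ?dotp_ge0// /dotp (bigD1 i)//= expr2 lerDl.
by apply: sumr_ge0 => j _; rewrite -expr2 sqr_ge0.
Qed.

Lemma enorm_le_norm u : enorm u <= Num.sqrt n%:R * `|u|.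
Proof.
rewrite -[X in _ * X]ger0_norm// -sqrtr_sqr -sqrtrM// ler_sqrt.
  by rewrite (le_trans (ler_norm _))// (le_trans (dotp_le u u))// expr2.
by rewrite mulr_ge0// sqr_ge0.
Qed.

Lemma continuous_row (T : topologicalType) (F : T -> 'rV[R]_n) :
  (forall i, continuous (fun x => F x 0 i)) -> continuous F.
Proof.
move=> cF x; apply/cvgrPdist_le => e e0.
have h : \forall y \near x, forall i : 'I_n, `|F x 0 i - F y 0 i| <= e.
  apply: (@filter_forall _ 'I_n (fun i y => `|F x 0 i - F y 0 i| <= e)) => i.
  by have /cvgrPdist_le/(_ e e0) := cF i x.
apply: filterS h => y hy; apply: rV_norm_le; first exact: ltW.
by move=> i; have := hy i; rewrite !mxE.
Qed.

Lemma continuous_dotp (T : topologicalType) (F G : T -> 'rV[R]_n) :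
  continuous F -> continuous G -> continuous (fun x => dotp (F x) (G x)).
Proof.
move=> cF cG; apply: continuous_bigsum => i; apply: continuous_mul;
  exact: continuous_coord.
Qed.

Lemma continuous_enorm (T : topologicalType) (F : T -> 'rV[R]_n) :
  continuous F -> continuous (fun x => enorm (F x)).
Proof.
move=> cF; apply: (continuous_of_comp (g := @Num.sqrt R)) => //.
  exact: continuous_dotp.
exact: sqrt_continuous.
Qed.

End EuclideanNorm.

Section TorusBasics.
Context (R : realType) (n : nat).
Local Notation T := (torus R n).

Lemma tprojP (x y : 'rV[R]_n) :
  tproj x = tproj y <-> exists k : 'rV[int]_n, x = y + intr_row R k.
Proof.
split=> [/eqmodP /= /mxOverP h|[k ->]].
  exists (map_mx Num.floor (x - y)); apply/rowP => i; rewrite !mxE.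
  have := h 0 i; rewrite !mxE => /floorK ->.
  by rewrite addrC subrK.
apply/eqmodP/mxOverP => i j; rewrite !mxE addrAC subrr add0r.
exact: intr_int.
Qed.

Lemma tproj_int (x : 'rV[R]_n) k : tproj (x + intr_row R k) = tproj x.
Proof. by apply/tprojP; exists k. Qed.

Lemma trepK (x : T) : tproj (trep x) = x.
Proof. exact: reprK. Qed.

Lemma trep_tproj (x : 'rV[R]_n) : exists k, trep (tproj x) = x + intr_row R k.
Proof. by apply/tprojP; rewrite trepK. Qed.

Lemma continuous_tproj : continuous (@tproj R n).
Proof. exact: pi_continuous. Qed.

Lemma torus_continuous (Z : topologicalType) (f : T -> Z) :
  continuous (fun x => f (tproj x)) -> continuous f.
Proof. by move=> cf; apply/quotient_continuous. Qed.

Lemma tlift_int (f : T -> R) x k : tlift f (x + intr_row R k) = tlift f x.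
Proof. by rewrite /tlift tproj_int. Qed.

Lemma tgrad_tproj (f : T -> R) x : tgrad f (tproj x) = gradient (tlift f) x.
Proof.
have [k Ek] := trep_tproj x; apply/rowP => i; rewrite !mxE Ek.
by apply: derive_periodic => z; rewrite tlift_int.
Qed.

Lemma derive_tlift (f : T -> R) x v : C1_torus f ->
  'D_v (tlift f) x = dotp (tgrad f (tproj x)) v.
Proof.
move=> C1f; rewrite derive_coordE// tgrad_tproj dotpC.
by apply: eq_bigr => i _; rewrite mxE.
Qed.

Lemma continuous_tgrad (f : T -> R) : C1_torus f -> continuous (tgrad f).
Proof.
move=> C1f; apply: torus_continuous; apply: continuous_row => i.
rewrite (_ : (fun x => _) = 'D_(delta_mx 0 i) (tlift f)).
  exact: (C1f.2 _).2.1.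
by apply/funext => x; rewrite tgrad_tproj mxE.
Qed.

Lemma tdist_ge0 (x y : T) : 0 <= tdist x y.
Proof.
apply: lb_le_inf; first by exists (enorm (trep x - trep y + map_mx intr 0)); exists 0.
by move=> _ [k _ <-]; exact: enorm_ge0.
Qed.

Lemma tdist_tproj (a b : 'rV[R]_n) : tdist (tproj a) (tproj b) <= enorm (a - b).
Proof.
have [k Ek] := trep_tproj a; have [l El] := trep_tproj b.
apply: ge_inf; first by exists 0 => _ [m _ <-]; exact: enorm_ge0.
exists (l - k) => //; congr enorm; rewrite Ek El.
by apply/rowP => i; rewrite !mxE rmorphB /=; ring.
Qed.

End TorusBasics.

Lemma continuous_pairing (A B D : topologicalType) (f : A -> B) (g : A -> D) :
  continuous f -> continuous g -> continuous (fun x => (f x, g x)).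
Proof. by move=> cf cg x; exact: (cvg_pair (cf x) (cg x)). Qed.

Section BorelBundle.
Context (R : realType) (n : nat).

Lemma continuous_bfst : continuous (fun z : bundle R n => z.1).
Proof. by move=> z; exact: cvg_fst. Qed.
Lemma continuous_bsnd : continuous (fun z : bundle R n => z.2).
Proof. by move=> z; exact: cvg_snd. Qed.

(** Lower semicontinuity suffices, which covers suprema of continuous functions such
    as the Lagrangian. *)
Lemma lsc_measurable (f : bundle R n -> R) :
  (forall a, open [set z | a < f z]) ->
  measurable_fun (setT : set (borel_bundle R n)) f.
Proof.
move=> of_; apply: (measurability _ (RGenOInfty.measurableE R)) => //.
move=> /= _ [_ [a ->] <-]; rewrite setTI preimage_itvoy.
by apply: sub_sigma_algebra; exact: of_.
Qed.

Lemma continuous_measurable_bundle (f : bundle R n -> R) :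
  continuous f -> measurable_fun (setT : set (borel_bundle R n)) f.
Proof.
move=> /continuousP cf; apply: lsc_measurable => a.
rewrite (_ : [set z | _] = f @^-1` [set x | a < x])//.
by apply: cf; exact: open_gt.
Qed.

End BorelBundle.

(** * Tonelli Hamiltonians and their Lagrangians *)

Lemma uniform_bound (R : realType) (I : finType) (T : Type) (P : T -> Prop)
  (F : I -> T -> R) :
  (forall i, exists2 K : R, 0 <= K & forall t, P t -> `|F i t| <= K) ->
  exists2 K : R, 0 <= K & forall i t, P t -> `|F i t| <= K.
Proof.
move=> h; have /choice[K hK] : forall i, exists K : R, 0 <= K /\
    forall t, P t -> `|F i t| <= K.
  by move=> i; have [K K0 hK] := h i; exists K.
exists (\sum_i K i); first by apply: sumr_ge0 => i _; exact: (hK i).1.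
move=> i t Pt; rewrite (le_trans ((hK i).2 t Pt))// (bigD1 i)//= lerDl.
by apply: sumr_ge0 => j _; exact: (hK j).1.
Qed.

Section PeriodicDerivative.
Context (R : realType) (n : nat).
Local Notation V := ('rV[R]_n).

Lemma pair_rowD (u w u' w' : V) : (u, w) + (u', w') = (u + u', w + w').
Proof. by []. Qed.

Lemma pair_rowZ (c : R) (u w : V) : c *: (u, w) = (c *: u, c *: w).
Proof. by []. Qed.

Definition bperiodic (g : V * V -> R) :=
  forall x p k, g (x + intr_row R k, p) = g (x, p).

Lemma bperiodic_derive g w : bperiodic g -> bperiodic ('D_w g).
Proof.
move=> pg x p k.
have -> : (x + intr_row R k, p) = (x, p) + (intr_row R k, 0 : V).
  by rewrite pair_rowD addr0.
by apply: derive_periodic => -[y q]; rewrite pair_rowD addr0 pg.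
Qed.

Lemma C1_bperiodic_bound g (r : R) : Ck 1 g -> bperiodic g ->
  exists2 K : R, 0 <= K & forall x p a b, `|p| <= r ->
    `|'D_(a, b) g (x, p)| <= K * (`|a| + `|b|).
Proof.
move=> C1g pg.
have hb (w : 'I_n -> V * V) : exists2 K : R, 0 <= K &
    forall i (z : V * V), `|z.2| <= r -> `|'D_(w i) g z| <= K.
  apply: uniform_bound => i.
  have [K K0 hK] := @periodic_bounded _ _ _ r (C1g.2 (w i)).2.1
    (bperiodic_derive (w i) pg).
  by exists K => // -[x p] /=; exact: hK.
have [K1 K10 hK1] := hb (fun i => (delta_mx 0 i, 0)).
have [K2 K20 hK2] := hb (fun i => (0, delta_mx 0 i)).
exists (n%:R * (K1 + K2)); first by rewrite mulr_ge0 ?addr_ge0.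
move=> x p a b pr; rewrite derive_pair_coordE//.
have hs (F : 'I_n -> R) (c : V) K : 0 <= K -> (forall i, `|F i| <= K) ->
    `|\sum_i c 0 i * F i| <= n%:R * (K * `|c|).
  move=> K0 hF; rewrite (le_trans (ler_norm_sum _ _ _))//.
  rewrite mulr_natl -[X in _ *+ X]card_ord -sumr_const; apply: ler_sum => i _.
  by rewrite normrM mulrC ler_pM// rV_norm_coord.
rewrite (le_trans (ler_normD _ _))//.
apply: (@le_trans _ _ (n%:R * (K1 * `|a|) + n%:R * (K2 * `|b|))).
  by apply: lerD; apply: hs => // i; [exact: hK1|exact: hK2].
rewrite -mulrA -mulrDr ler_wpM2l//.
rewrite -subr_ge0 (_ : _ - _ = K1 * `|b| + K2 * `|a|); last by ring.
by rewrite addr_ge0 ?mulr_ge0.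
Qed.

Lemma C1_bperiodic_lipschitz g (r : R) : Ck 1 g -> bperiodic g ->
  exists2 K : R, 0 <= K & forall x p a b, `|p| <= r -> `|p + b| <= r ->
    `|g (x + a, p + b) - g (x, p)| <= K * (`|a| + `|b|).
Proof.
move=> C1g pg; have [K K0 hK] := C1_bperiodic_bound r C1g pg.
exists K => // x p a b pr pbr.
have [c /andP[c0 c1]] := @line_mvt _ _ g (x, p) (a, b) (C1g.2 _).1.
rewrite pair_rowD pair_rowZ pair_rowD => ->; apply: hK.
rewrite (_ : p + c *: b = (1 - c) *: p + c *: (p + b)); last first.
  by rewrite scalerBl scale1r scalerDr addrA subrK.
rewrite (le_trans (ler_normD _ _))// !normrZ (gtr0_norm c0) gtr0_norm ?subr_gt0//.
rewrite (_ : r = (1 - c) * r + c * r); last by ring.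
by rewrite lerD// ler_wpM2l// ltW// subr_gt0.
Qed.

End PeriodicDerivative.

Section Hamiltonian.
Context (R : realType) (n : nat) (H : bundle R n -> R) (tonelliH : tonelli H).
Local Notation V := ('rV[R]_n).
Implicit Types (x p q v : V).

Let G := blift H.

Let C1G : Ck 1 G.
Proof.
have [[cG dG] _ _] := tonelliH; split=> // v; split; first exact: (dG v).1.
by split => //; exact: (dG v).2.1.
Qed.

Let C1DG w : Ck 1 ('D_w G).
Proof. by have [[cG dG] _ _] := tonelliH; exact: (dG w).2. Qed.

Let perG : bperiodic G.
Proof. by move=> x p k; rewrite /G /blift /= tproj_int. Qed.

Lemma derive_dHdp x p v : 'D_(0 : V, v) G (x, p) = dotp (dHdp H x p) v.
Proof.
rewrite derive_pair_coordE// big1 ?add0r; last by move=> i _; rewrite mxE mul0r.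
by apply: eq_bigr => i _; rewrite mxE mulrC.
Qed.

Lemma dHdp_int x p k : dHdp H (x + intr_row R k) p = dHdp H x p.
Proof. by apply/rowP => i; rewrite !mxE; exact: bperiodic_derive. Qed.

Lemma dHdp_lipschitz (r : R) : exists2 K : R, 0 <= K &
  forall x p a b, `|p| <= r -> `|p + b| <= r ->
    `|dHdp H (x + a) (p + b) - dHdp H x p| <= K * (`|a| + `|b|).
Proof.
have /choice[K hK] : forall i : 'I_n, exists K : R, 0 <= K /\
  forall x p a b, `|p| <= r -> `|p + b| <= r ->
    `|dHdp H (x + a) (p + b) 0 i - dHdp H x p 0 i| <= K * (`|a| + `|b|).
  move=> i.
  have [K K0 hK] := C1_bperiodic_lipschitz r (C1DG (0, delta_mx 0 i))
    (bperiodic_derive (0, delta_mx 0 i) perG).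
  by exists K; split => // x p a b pr pbr; rewrite !mxE; exact: hK.
have K0 : 0 <= \sum_i K i by apply: sumr_ge0 => i _; exact: (hK i).1.
exists (\sum_i K i) => // x p a b pr pbr.
apply: rV_norm_le => [|i]; first by rewrite mulr_ge0// addr_ge0.
rewrite [X in `|X|]mxE [X in _ + X]mxE.
rewrite (le_trans ((hK i).2 _ _ _ _ pr pbr))// ler_wpM2r ?addr_ge0//.
rewrite (bigD1 i)//= lerDl; apply: sumr_ge0 => j _; exact: (hK j).1.
Qed.

Lemma H_quadratic_upper (r : R) : exists2 K : R, 0 <= K &
  forall x p q, `|p| <= r -> `|q| <= 1 ->
    G (x, p + q) <= G (x, p) + dotp (dHdp H x p) q + K * `|q| ^+ 2.
Proof.
have [K K0 hK] := dHdp_lipschitz (r + 1).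
exists (n%:R * K) => [|x p q pr q1]; first by rewrite mulr_ge0.
have [c /andP[c0 c1]] := @line_mvt _ _ G (x, p) (0, q) (C1G.2 _).1.
have -> : (x, p) + (0, q) = (x, p + q) by rewrite pair_rowD addr0.
have -> : (x, p) + c *: (0, q) = (x, p + c *: q).
  by rewrite pair_rowZ pair_rowD scaler0 addr0.
rewrite derive_dHdp => E.
rewrite -addrA addrC -lerBlDr E -lerBlDl -dotpBl.
rewrite (le_trans (ler_norm _))// (le_trans (dotp_le _ _))// -mulrA ler_wpM2l//.
rewrite expr2 mulrA ler_wpM2r//.
have cq : `|c *: q| <= `|q| by rewrite normrZ gtr0_norm// ler_piMl// ltW.
have := hK x p 0 (c *: q); rewrite addr0 normr0 add0r => /(_ _ _)/le_trans; apply.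
- by rewrite (le_trans pr)// lerDl.
- by rewrite (le_trans (ler_normD _ _))// lerD// (le_trans cq).
- by rewrite ler_wpM2l.
Qed.

(** Two applications of the mean value theorem produce a second derivative in the
    direction [q]. *)
Lemma H_convex x p q : G (x, p) + dotp (dHdp H x p) q <= G (x, p + q).
Proof.
have [->|q0] := eqVneq q 0; first by rewrite dotp0r !addr0.
have [_ convH _] := tonelliH.
have [c /andP[c0 c1]] := @line_mvt _ _ G (x, p) (0, q) (C1G.2 _).1.
have -> : (x, p) + (0, q) = (x, p + q) by rewrite pair_rowD addr0.
move=> E; rewrite -lerBrDl E -derive_dHdp -subr_ge0.
have dD := (C1DG (0, q)).2.
have dDc y : derivable ('D_(0, q) G) y (c *: (0, q)).
  by have [] := deriveZv c ((dD (0, q)).1 y).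
have [c' _ ->] := line_mvt (x, p) dDc.
rewrite (deriveZv c ((dD (0, q)).1 _)).2 mulr_ge0 ?(ltW c0)//.
exact: ltW (convH _ _ q0).
Qed.

Lemma blift_bounded (r : R) : exists2 M : R, 0 <= M &
  forall z p, `|p| <= r -> `|H (z, p)| <= M.
Proof.
have [M M0 hM] := @periodic_bounded _ _ _ r C1G.1 perG.
by exists M => // z p pr; rewrite -[z]trepK; exact: hM.
Qed.

Let lagr_set (z : bundle R n) := [set dotp p z.2 - H (z.1, p) | p in [set: V]].

(** Superlinearity makes the momenta outside a ball irrelevant. *)
Let lagr_has_sup z : has_sup (lagr_set z).
Proof.
split; first by exists (dotp 0 z.2 - H (z.1, 0)); exists 0.
have [_ _ superH] := tonelliH; have [r hr] := superH (n%:R * `|z.2|).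
have [M M0 hM] := blift_bounded r.
exists (n%:R * (`|r| * `|z.2|) + M) => _ [p _ <-].
have [rp|pr] := leP r (enorm p).
  apply: (@le_trans _ _ 0); last by rewrite addr_ge0// !mulr_ge0.
  rewrite subr_le0 (le_trans _ (hr z.1 p rp))// (le_trans (ler_norm _))//.
  rewrite (le_trans (dotp_le _ _))// -mulrA ler_wpM2l// mulrC ler_wpM2l//.
  exact: norm_le_enorm.
have pr' : `|p| <= r := ltW (le_lt_trans (norm_le_enorm p) pr).
apply: lerD.
  rewrite (le_trans (ler_norm _))// (le_trans (dotp_le _ _))// ler_wpM2l//.
  by rewrite ler_wpM2r// (le_trans pr')// ler_norm.
by rewrite (le_trans (ler_norm _))// normrN hM.
Qed.

Lemma lagrangian_ge z p : dotp p z.2 - H (z.1, p) <= lagrangian H z.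
Proof. by apply: sup_upper_bound; [exact: lagr_has_sup|exists p]. Qed.

Lemma lagrangian_le z (B : R) :
  (forall p, dotp p z.2 - H (z.1, p) <= B) -> lagrangian H z <= B.
Proof.
move=> h; apply: ge_sup; first by have [] := lagr_has_sup z.
by move=> _ [p _ <-].
Qed.

Lemma lagrangian_shift (c : V) z :
  lagrangian (Hshift H c) z = lagrangian H z - dotp c z.2.
Proof.
have ub : ubound [set dotp p z.2 - Hshift H c (z.1, p) | p in [set: V]]
    (lagrangian H z - dotp c z.2).
  move=> _ [p _ <-]; rewrite lerBrDr addrAC -dotpDl.
  exact: lagrangian_ge.
have ne : [set dotp p z.2 - Hshift H c (z.1, p) | p in [set: V]] !=set0.
  by exists (dotp 0 z.2 - Hshift H c (z.1, 0)); exists 0.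
apply/eqP; rewrite eq_le; apply/andP; split; first exact: ge_sup.
rewrite lerBlDr; apply: lagrangian_le => p.
rewrite -lerBlDr; apply: sup_upper_bound; first by split => //; exists (lagrangian H z - dotp c z.2).
exists (p - c) => //.
by rewrite /Hshift /= subrK dotpBl addrAC.
Qed.

Lemma continuous_H_fiber p : continuous (fun z : torus R n => H (z, p)).
Proof.
apply: torus_continuous.
apply: (continuous_of_comp (f := fun x : V => (x, p)) (g := G)); last exact: C1G.1.
apply: continuous_pairing; first by move=> x; exact: cvg_id.
exact: (@cst_continuous _ _ p).
Qed.

Lemma lagrangian_measurable :
  measurable_fun (setT : set (borel_bundle R n)) (lagrangian H).
Proof.
apply: lsc_measurable => a.
rewrite (_ : [set z | _] = \bigcup_p [set z : bundle R n | a < dotp p z.2 - H (z.1, p)]).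
  apply: bigcup_open => p _.
  have cp : continuous (fun z : bundle R n => dotp p z.2 - H (z.1, p)).
    have c1 := continuous_dotp (@cst_continuous _ _ p) (@continuous_bsnd R n).
    have c2 := continuous_of_comp (@continuous_bfst R n) (@continuous_H_fiber p).
    by move=> z; exact: (cvgB (c1 z) (c2 z)).
  by move/continuousP: cp => /(_ _ (@open_gt _ a)).
apply/seteqP; split => z /=; last first.
  by move=> [p _] /= /lt_le_trans; apply; exact: lagrangian_ge.
move=> az; have [_ [p _ <-] hp] := @sup_gt _ _ a (lagr_has_sup z).1 az.
by exists p.
Qed.

End Hamiltonian.

(** * The Lagrangian near an invariant graph *)

Lemma lipschitz_continuous (R : realType) (V W : normedModType R) (f : V -> W)
  (K : R) : 0 <= K -> (forall a b, `|f a - f b| <= K * `|a - b|) ->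
  continuous f.
Proof.
move=> K0 hK x; apply/cvgrPdist_le => e e0.
have K1 : 0 < K + 1 by rewrite ltr_wpDl.
have : \forall y \near x, `|x - y| < e / (K + 1).
  by apply: cvgr_dist_lt; [exact: cvg_id|exact: divr_gt0].
apply: filterS => y /ltW hy; rewrite (le_trans (hK x y))//.
rewrite (@le_trans _ _ ((K + 1) * `|x - y|))//.
  by rewrite ler_wpM2r// lerDl.
by rewrite mulrC -ler_pdivlMr.
Qed.

Lemma torus_bounded (R : realType) n (F : torus R n -> R) : continuous F ->
  exists2 K : R, 0 <= K & forall x, `|F x| <= K.
Proof.
move=> cF.
have cg : continuous (fun z : 'rV[R]_n * 'rV[R]_n => F (tproj z.1)).
  apply: (continuous_of_comp (g := fun x => F (tproj x))).
    by move=> z; exact: cvg_fst.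
  exact: continuous_of_comp (@continuous_tproj R n) cF.
have [|K K0 hK] := @periodic_bounded _ _ _ 0 cg.
  by move=> x p k /=; rewrite tproj_int.
exists K => // x; rewrite -[x]trepK; apply: (hK (trep x) 0).
by rewrite normr0.
Qed.

Lemma torus_row_bounded (R : realType) n m (F : torus R n -> 'rV[R]_m) :
  continuous F -> exists2 K : R, 0 <= K & forall x, `|F x| <= K.
Proof.
move=> cF.
have [K K0 hK] := torus_bounded (continuous_of_comp cF (@norm_continuous _ _)).
by exists K => // x; have := hK x; rewrite normr_id.
Qed.

Section GraphVelocity.
Context (R : realType) (n : nat) (H : bundle R n -> R) (tonelliH : tonelli H).
Context (u0 : torus R n -> R) (hu0 : C11_torus u0) (h : R).
Hypothesis hHJ : forall x, H (x, tgrad u0 x) = h.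
Local Notation V := ('rV[R]_n).

Definition graph_velocity (x : torus R n) : V := dHdp H (trep x) (tgrad u0 x).
Local Notation Vel := graph_velocity.

Lemma graph_velocity_tproj (x : V) : Vel (tproj x) = dHdp H x (tgrad u0 (tproj x)).
Proof. by rewrite /Vel; have [k ->] := trep_tproj x; rewrite dHdp_int. Qed.

Lemma tgrad_lipschitz : exists2 K : R, 0 <= K & forall a b : V,
  `|tgrad u0 (tproj a) - tgrad u0 (tproj b)| <= K * `|a - b|.
Proof.
have [_ [K hK]] := hu0.
exists (`|K| * Num.sqrt n%:R) => [|a b]; first by rewrite mulr_ge0// sqrtr_ge0.
rewrite (le_trans (norm_le_enorm _))// (le_trans (hK _ _))//.
apply: (@le_trans _ _ (`|K| * tdist (tproj a) (tproj b))).
  by rewrite ler_wpM2r ?tdist_ge0 ?ler_norm.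
rewrite -mulrA ler_wpM2l// (le_trans _ (enorm_le_norm (a - b)))//.
exact: tdist_tproj.
Qed.

Lemma tgrad_u0_bounded : exists2 r : R, 0 <= r & forall x, `|tgrad u0 x| <= r.
Proof. exact/torus_row_bounded/continuous_tgrad/hu0.1. Qed.

Lemma graph_velocity_lipschitz : exists2 K : R, 0 <= K & forall a b : V,
  `|Vel (tproj a) - Vel (tproj b)| <= K * `|a - b|.
Proof.
have [r r0 hr] := tgrad_u0_bounded.
have [K1 K10 hK1] := tgrad_lipschitz.
have [K2 K20 hK2] := dHdp_lipschitz tonelliH r.
exists (K2 * (1 + K1)) => [|a b]; first by rewrite mulr_ge0 ?addr_ge0.
rewrite !graph_velocity_tproj.
have := hK2 b (tgrad u0 (tproj b)) (a - b) (tgrad u0 (tproj a) - tgrad u0 (tproj b)).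
rewrite ![_ + (_ - _)]addrC !subrK => /(_ (hr _) (hr _)) /le_trans; apply.
by rewrite -mulrA ler_wpM2l// mulrDl mul1r lerD2l.
Qed.

Lemma continuous_graph_velocity : continuous Vel.
Proof.
have [K K0 hK] := graph_velocity_lipschitz.
exact: torus_continuous (lipschitz_continuous K0 hK).
Qed.

Lemma graph_velocity_bounded : exists2 r : R, 0 <= r & forall x, `|Vel x| <= r.
Proof. exact: torus_row_bounded continuous_graph_velocity. Qed.

(** Fenchel's inequality at the momentum [tgrad u0 + q]. The choice of [q] as [s]
    times the signs of [v - Vel x] makes the linear gain at least
    [s * `|v - Vel x|], and the second order cost is at most [K * s ^+ 2]. *)
Lemma graph_lower : exists2 K : R, 0 <= K & forall z s, 0 <= s <= 1 ->
  s * `|z.2 - Vel z.1| - K * s ^+ 2 <=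
  lagrangian H z - dotp (tgrad u0 z.1) z.2 + h.
Proof.
have [r r0 hr] := tgrad_u0_bounded.
have [K K0 hK] := H_quadratic_upper tonelliH r.
exists K => // -[x v] s /andP[s0 s1] /=.
set w := v - Vel x; set p := tgrad u0 x.
pose q : V := \row_i (s * Num.sg (w 0 i)).
have qs : `|q| <= s.
  apply: rV_norm_le => // i; rewrite mxE normrM ger0_norm// ler_piMr// normr_sg.
  by case: (_ == _).
have qw : s * `|w| <= dotp q w.
  have -> : dotp q w = s * \sum_i `|w 0 i|.
    rewrite mulr_sumr; apply: eq_bigr => i _; rewrite mxE -mulrA.
    by rewrite -normrEsg.
  rewrite ler_wpM2l//; apply: rV_norm_le => [|i]; first exact: sumr_ge0.
  by rewrite (bigD1 i)//= lerDl sumr_ge0.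
have hH : H (x, p + q) <= h + dotp (Vel x) q + K * s ^+ 2.
  have := hK (trep x) p q (hr x) (le_trans qs s1).
  rewrite /blift /= trepK hHJ => /le_trans; apply; rewrite lerD2l ler_wpM2l//.
  by rewrite lerXn2r ?nnegrE.
have := lagrangian_ge tonelliH (x, v) (p + q); rewrite /= dotpDl => hL.
have vE : dotp q v = dotp q w + dotp (Vel x) q by rewrite dotpBr [dotp _ q]dotpC subrK.
rewrite lerBlDr (le_trans qw)//; move: hL hH; rewrite vE; lra.
Qed.

(** Superlinearity confines the momenta that matter to a ball around
    [tgrad u0 x]; there convexity of [H] in the momentum leaves only
    [dotp (p - tgrad u0 x) (v - Vel x)]. *)
Lemma graph_upper : exists2 R0 : R, 0 <= R0 & forall z, `|z.2 - Vel z.1| <= 1 ->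
  lagrangian H z - dotp (tgrad u0 z.1) z.2 + h <= R0 * `|z.2 - Vel z.1|.
Proof.
have [r r0 hr] := tgrad_u0_bounded.
have [b b0 hb] := graph_velocity_bounded.
have [_ _ superH] := tonelliH.
have [t ht] := superH (n%:R * (b + 1) + 1).
(* Beyond the radius [t'], superlinearity beats both the linear term and the constants. *)
pose t' := Num.max t (n%:R * (r * (b + 1)) + `|h|).
have t'0 : 0 <= t'.
  by rewrite le_max; apply/orP; right; rewrite addr_ge0// !mulr_ge0// addr_ge0.
exists (n%:R * (t' + r)) => [|[x v] /= w1]; first by rewrite mulr_ge0// addr_ge0.
have vb : `|v| <= b + 1.
  by rewrite -[v](subrK (Vel x)) addrC (le_trans (ler_normD _ _))// lerD.
set w := v - Vel x in w1 *; set p0 := tgrad u0 x.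
suff hL : lagrangian H (x, v) <= dotp p0 v - h + n%:R * (t' + r) * `|w|.
  by move: hL; lra.
apply: lagrangian_le => // p /=.
have pv : `|dotp p0 v| <= n%:R * (r * (b + 1)).
  rewrite (le_trans (dotp_le _ _))// ler_wpM2l// ler_pM//.
  exact: hr.
have w0 := normr_ge0 w.
have [pt|pt] := leP t' (enorm p).
  have hp : (n%:R * (b + 1) + 1) * enorm p <= H (x, p).
    by apply: ht; rewrite (le_trans _ pt)// le_max lexx.
  have : dotp p v <= n%:R * (b + 1) * enorm p.
    rewrite (le_trans (ler_norm _))// (le_trans (dotp_le _ _))//.
    rewrite -mulrA ler_wpM2l// mulrC ler_pM//; exact: norm_le_enorm.
  have : n%:R * (r * (b + 1)) + `|h| <= enorm p.
    by rewrite (le_trans _ pt)// le_max lexx orbT.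
  have := ler_norm h; have : 0 <= n%:R * (t' + r) * `|w| by rewrite !mulr_ge0// addr_ge0.
  move: pv hp; rewrite ler_norml mulrDl mul1r => /andP[? _]; lra.
have hc := H_convex tonelliH (trep x) p0 (p - p0).
rewrite /blift /= trepK hHJ [p0 + _]addrC subrK in hc.
have : dotp (p - p0) w <= n%:R * (t' + r) * `|w|.
  rewrite (le_trans (ler_norm _))// (le_trans (dotp_le _ _))//.
  rewrite mulrA ler_wpM2r// ler_wpM2l// (le_trans (ler_normB _ _))// lerD//.
    by rewrite (le_trans (norm_le_enorm _))// ltW.
  exact: hr.
have -> : dotp p v = dotp p0 v + dotp (p - p0) v by rewrite dotpBl [X in _ = X]addrC subrK.
rewrite [dotp (p - p0) v](_ : _ = dotp (p - p0) w + dotp (Vel x) (p - p0)); last first.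
  by rewrite [X in _ = _ + X]dotpC -dotpDr subrK.
by move: hc; rewrite -/(Vel x); lra.
Qed.

End GraphVelocity.

(** * Lifts of torus maps *)

Section TrigLemmas.
Context (R : realType).
Implicit Types (x t : R).

Lemma cos_int_period x (m : int) : cos (x + 2 * pi * m%:~R) = cos x.
Proof.
have hn (k : nat) (y : R) : cos (y + 2 * pi * k%:R) = cos y.
  by rewrite mulr_natr mulr_natl periodicn//; exact: cosD2pi.
case: m => k; first exact: hn.
by rewrite NegzE rmorphN mulrN -(hn k.+1 (x - _)) subrK.
Qed.

Lemma sin_int_period x (m : int) : sin (x + 2 * pi * m%:~R) = sin x.
Proof. by rewrite -!cosBpihalf addrAC cos_int_period. Qed.

Lemma sin_linear_lower x : 0 <= x <= pi / 2 -> cos 1 / 2 * x <= sin x.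
Proof.
move=> /andP[x0 x2].
have c1 := @cos1_gt0 R.
have h1 (y : R) : 0 <= y <= 1 -> cos 1 * y <= sin y.
  move=> /andP[y0 y1].
  have cs : {within `[0, y], continuous (@sin R)}.
    by apply: continuous_subspaceT => z; exact: continuous_sin.
  have [c] := MVT_segment y0 (fun z _ => is_derive_sin z) cs.
  rewrite in_itv/= sin0 !subr0 => /andP[cz cy] ->; rewrite ler_wpM2r//.
  have p2 : 1 <= pi :> R by have := @pi_ge2 R; lra.
  have := @ltr_cos R 1 c; rewrite !in_itv/= ler01 p2 cz (le_trans cy (le_trans y1 p2)).
  by move=> /(_ erefl erefl) h; rewrite leNgt h -leNgt (le_trans cy).
have [xl|xg] := leP x 1.
  have := h1 x; rewrite x0 xl => /(_ erefl) /(le_trans _); apply.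
  by rewrite ler_wpM2r// ler_pdivrMr// mulr_natr mulr2n lerDl ltW.
apply: (@le_trans _ _ (sin 1)).
  apply: le_trans (h1 1 _); rewrite ?ler01 ?lexx// mulr1.
  rewrite -mulrA ler_piMr ?ltW//.
  by have := @pihalf_lt2 R; lra.
have [_ /ltW p] := andP (@pihalf_02 R).
have p1 := @pihalf_ge1 R.
have := @ltr_sin R 1 x; rewrite !in_itv/= x2 p1 => h.
apply: ltW; rewrite h//; apply/andP; split => //; lra.
Qed.

Lemma one_sub_cos_lower : exists2 c : R, 0 < c & forall t, `|t| <= 2^-1 ->
  c * t ^+ 2 <= 1 - cos (2 * pi * t).
Proof.
have c1 := @cos1_gt0 R; have p0 := @pi_gt0 R.
exists (2 * (cos 1 / 2 * pi) ^+ 2); first by rewrite mulr_gt0// exprn_gt0// !mulr_gt0// invr_gt0.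
move=> t ht.
have -> : 1 - cos (2 * pi * t) = 2 * sin (pi * `|t|) ^+ 2.
  have -> : cos (2 * pi * t) = cos (pi * `|t| *+ 2).
    rewrite -cos_norm normrM [X in X * _]ger0_norm ?mulr_ge0 ?ltW//.
    by congr cos; ring.
  by rewrite cos_mulr2n cos2sin2; ring.
rewrite -mulrA ler_wpM2l// -[X in _ * X <= _]real_normK ?num_real// -exprMn.
have h : 0 <= pi * `|t| <= pi / 2 by rewrite mulr_ge0 ?(ltW p0)//= ler_wpM2l ?(ltW p0).
rewrite lerXn2r ?nnegrE//.
- by rewrite !mulr_ge0 ?invr_ge0 ?(ltW c1) ?(ltW p0).
- apply: le_trans (sin_linear_lower h).
  by rewrite mulr_ge0 ?divr_ge0 ?(ltW c1)//; case/andP: h.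
- by rewrite -[leLHS]mulrA; exact: sin_linear_lower.
Qed.

End TrigLemmas.

Section LiftedMap.
Context (R : realType) (n : nat) (Psi : 'rV[R]_n -> 'rV[R]_n).
Hypothesis C1P : Ck 1 Psi.
Hypothesis liftP : forall x k, exists l, Psi (x + intr_row R k) = Psi x + intr_row R l.

(** The action of the torus map on the fundamental group. *)
Definition lift_degree : 'M[R]_n :=
  \matrix_(i, j) (Psi (intr_row R (delta_mx 0 i)) - Psi 0) 0 j.

Let intr_rowD k l : intr_row R (k + l) = intr_row R k + intr_row R l :> 'rV_n.
Proof. by rewrite /intr_row map_mxD. Qed.

Let a k := Psi (intr_row R k) - Psi 0.

Let shift_const x k : Psi (x + intr_row R k) - Psi x = a k.
Proof.
apply/rowP => j.
pose g (y : 'rV[R]_n) := (Psi (y + intr_row R k) - Psi y) 0 j.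
have -> : a k 0 j = g 0 by rewrite /g add0r.
rewrite -/(g x); apply: int_const.
  apply: continuous_coord.
  have c0 : continuous (fun y : 'rV[R]_n => y + intr_row R k).
    apply: (@lipschitz_continuous _ _ _ _ 1) => // y z.
    by rewrite opprD addrACA subrr addr0 mul1r.
  have c1 := continuous_of_comp c0 C1P.1.
  by move=> y; exact: (cvgB (c1 y) (C1P.1 y)).
move=> y; rewrite /g; have [l ->] := liftP y k.
by rewrite addrAC subrr add0r mxE; exact: intr_int.
Qed.

(** The increment over a lattice vector is continuous in the base point with integer
    values, hence constant; it is then additive in the lattice vector. *)
Lemma lift_degreeP x k : Psi (x + intr_row R k) = Psi x + intr_row R k *m lift_degree.
Proof.
have aD k' l : a (k' + l) = a k' + a l.
  by rewrite -(shift_const (intr_row R l) k') /a intr_rowD [intr_row R k' + _]addrC addrA subrK.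
have aB : zmod_morphism a.
  by move=> k' l; apply/eqP; rewrite eq_sym subr_eq -aD subrK.
pose aa : {additive 'rV[int]_n -> 'rV[R]_n} := HB.pack a (GRing.isZmodMorphism.Build _ _ a aB).
rewrite -[LHS](subrK (Psi x)) shift_const addrC; congr (_ + _).
rewrite -[a k]/(aa k) {1}[k]row_sum_delta raddf_sum; apply/rowP => j.
rewrite summxE mxE; apply: eq_bigr => i _.
by rewrite -[k 0 i]intz scaler_int raddfMz -scaler_int !mxE.
Qed.

Lemma derive_lift_int v x k : 'D_v Psi (x + intr_row R k) = 'D_v Psi x.
Proof.
rewrite /derive.
rewrite (_ : (fun h : R => h^-1 *: ((Psi \o shift (x + intr_row R k)) (h *: v) - Psi (x + intr_row R k))) =
   (fun h : R => h^-1 *: ((Psi \o shift x) (h *: v) - Psi x)))//.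
apply/funext => h /=; rewrite addrA !lift_degreeP; congr (_ *: _).
by rewrite opprD addrACA subrr addr0.
Qed.

Lemma lift_derive_bound : exists2 K : R, 0 <= K &
  forall x v, `|'D_v Psi x| <= K * `|v|.
Proof.
have hb : exists2 K : R, 0 <= K & forall (ij : 'I_n * 'I_n) (x : 'rV[R]_n), True ->
    `|'D_(delta_mx 0 ij.1) Psi x 0 ij.2| <= K.
  apply: uniform_bound => -[i j] /=.
  pose g (z : 'rV[R]_n * 'rV[R]_n) := 'D_(delta_mx 0 i) Psi z.1 0 j.
  have cg : continuous g.
    apply: (continuous_of_comp (f := fst) (g := fun x => 'D_(delta_mx 0 i) Psi x 0 j)).
      by move=> z; exact: cvg_fst.
    by apply: continuous_coord; exact: (C1P.2 _).2.1.
  have [|K K0 hK] := @periodic_bounded _ _ g 0 cg.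
    by move=> x p k; rewrite /g /= derive_lift_int.
  by exists K => // x _; apply: (hK x 0); rewrite normr0.
have [K K0 hK] := hb.
exists (n%:R * K) => [|x v]; first by rewrite mulr_ge0.
apply: rV_norm_le => [|j]; first by rewrite !mulr_ge0.
rewrite -derive_coord// derive_coordE; last exact: C1_coord.
rewrite (le_trans (ler_norm_sum _ _ _))// -mulrA mulr_natl -[X in _ *+ X]card_ord.
rewrite -sumr_const; apply: ler_sum => i _; rewrite normrM mulrC derive_coord//.
by apply: ler_pM => //; [exact: (hK (i, j))|exact: rV_norm_coord].
Qed.

Lemma lift_lipschitz : exists2 K : R, 0 <= K &
  forall x y, `|Psi x - Psi y| <= K * `|x - y|.
Proof.
have [K K0 hK] := lift_derive_bound.
exists K => // x y; apply: rV_norm_le => [|j]; first by rewrite mulr_ge0.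
rewrite mxE [X in _ + X]mxE.
have [c _] := @line_mvt _ _ (fun z => Psi z 0 j) y (x - y) ((C1_coord C1P j).2 _).1.
rewrite [y + (x - y)]addrC subrK => ->.
by rewrite derive_coord// (le_trans (rV_norm_coord _ _))// (le_trans (hK _ _)).
Qed.

End LiftedMap.

(** * Straightening the flow on the invariant torus *)

Lemma is_derive_affine (R : realType) (a b t : R) :
  is_derive t 1 (fun s : R => a + s * b) b.
Proof.
rewrite (_ : (fun s : R => a + s * b) = cst a + b *: (@idfun R)); last first.
  by apply/funext => s; rewrite -![(_ + _) s]/(_ + _) /= mulrC.
have h := is_deriveD (is_derive_cst a t 1) (is_deriveZ b (is_derive_id t 1)).
rewrite add0r in h.
have E : b *: 1 = b by rewrite /GRing.scale /= mulr1.
by rewrite -[X in is_derive _ _ _ X]E.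
Qed.

Section PhaseCalculus.
Context (R : realType) (n : nat).
Implicit Types (k : 'rV[int]_n) (y v : 'rV[R]_n).

Lemma phaseDr k y v : phase k (y + v) = phase k y + phase k v.
Proof. by rewrite /phase dotpDr mulrDr. Qed.

Lemma phaseZr k (a : R) v : phase k (a *: v) = a * phase k v.
Proof. by rewrite /phase dotpZr mulrCA. Qed.

Lemma phase_intr k (m : 'rV[int]_n) :
  exists l : int, phase k (intr_row R m) = 2 * pi * l%:~R.
Proof.
exists (\sum_i k 0 i * m 0 i); rewrite /phase /dotp rmorph_sum; congr (_ * _).
by apply: eq_bigr => i _; rewrite !mxE rmorphM.
Qed.

Lemma phase_le k v : `|phase k v| <= 2 * pi * n%:R * `|intr_row R k| * `|v|.
Proof.
rewrite /phase normrM ger0_norm ?mulr_ge0 ?pi_ge0// -!mulrA ler_wpM2l// ler_wpM2l ?pi_ge0//.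
exact: dotp_le.
Qed.

Lemma C1_trig_phase (f df : R -> R) k :
  (forall x : R, is_derive x 1 f (df x)) -> continuous df ->
  (forall v y, 'D_v (fun y => f (phase k y)) y = phase k v * df (phase k y)) /\
  Ck 1 (fun y => f (phase k y)).
Proof.
move=> hf cdf.
have cp : continuous (phase k : 'rV[R]_n -> R).
  have c1 := continuous_dotp (@cst_continuous _ _ (intr_row R k)) (fun x : 'rV[R]_n => @cvg_id _ (nbhs x)).
  move=> x; exact: (cvgMl_tmp (c1 x)).
have cf : continuous f.
  by move=> x; apply: differentiable_continuous; apply/derivable1_diffP; have [] := hf x.
have isd v y : is_derive (0 : R) 1 (fun s : R => f (phase k (y + s *: v))) (phase k v * df (phase k y)).
  have E : (fun s : R => f (phase k (y + s *: v))) = f \o (fun s => phase k y + s * phase k v).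
    by apply/funext => s /=; rewrite phaseDr phaseZr.
  have h2 := is_derive_affine (phase k y) (phase k v) 0.
  rewrite E mulrC; apply: is_derive1_comp; rewrite mul0r addr0; exact: hf.
have D v y : 'D_v (fun y => f (phase k y)) y = phase k v * df (phase k y).
  by rewrite derive_line; have [_ ->] := isd v y.
split=> //; split; first exact: (continuous_of_comp cp cf).
move=> v; split; first by move=> y; apply: derivable_line; have [] := isd v y.
split => //; rewrite (_ : 'D_v _ = fun y => phase k v * df (phase k y)); last exact/funext.
apply: continuous_mul; last exact: (continuous_of_comp cp cdf).
exact: cst_continuous.
Qed.

End PhaseCalculus.

Lemma C1_dotp (R : realType) n (a : 'rV[R]_n) :
  (forall v x, 'D_v (dotp a) x = dotp a v) /\ Ck 1 (dotp a).
Proof.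
have isd v x : is_derive (0 : R) 1 (fun s : R => dotp a (x + s *: v)) (dotp a v).
  rewrite (_ : (fun s : R => _) = (fun s => dotp a x + s * dotp a v)).
    exact: is_derive_affine.
  by apply/funext => s; rewrite dotpDr dotpZr.
have D v x : 'D_v (dotp a) x = dotp a v.
  by rewrite derive_line; have [_ ->] := isd v x.
split=> //; split.
  exact: (continuous_dotp (@cst_continuous _ _ a) (fun x : 'rV[R]_n => @cvg_id _ (nbhs x))).
move=> v; split; first by move=> y; apply: derivable_line; have [] := isd v y.
split => //; rewrite (_ : 'D_v _ = fun y => dotp a v); last exact/funext.
exact: cst_continuous.
Qed.

Lemma C1_sub (R : realType) (V : normedModType R) (f g : V -> R) :
  Ck 1 f -> Ck 1 g ->
  (forall v x, 'D_v (f \- g) x = 'D_v f x - 'D_v g x) /\ Ck 1 (f \- g).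
Proof.
move=> C1f C1g.
have D v x : 'D_v (f \- g) x = 'D_v f x - 'D_v g x.
  by apply: deriveB; [exact: (C1f.2 v).1|exact: (C1g.2 v).1].
split=> //; split; first by move=> x; exact: (cvgB (C1f.1 x) (C1g.1 x)).
move=> v; split.
  by move=> x; apply: derivableB; [exact: (C1f.2 v).1|exact: (C1g.2 v).1].
split=> //; rewrite (_ : 'D_v _ = fun x => 'D_v f x - 'D_v g x); last exact/funext.
by move=> x; exact: (cvgB ((C1f.2 v).2.1 x) ((C1g.2 v).2.1 x)).
Qed.

Section KAM.
Context (R : realType) (n : nat) (H : bundle R n -> R) (tonelliH : tonelli H).
Context (u0 : torus R n -> R) (hu0 : C11_torus u0) (h : R).
Hypothesis hHJ : forall x, H (x, tgrad u0 x) = h.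
Local Notation V := ('rV[R]_n).
Local Notation Vel := (graph_velocity H u0).
Context (omega : V) (phi : R -> bundle R n -> bundle R n) (psi psi' : torus R n -> torus R n).
Hypothesis flowphi : hamiltonian_flow H phi.
Hypothesis conj_psi : forall x t, psi (phi t (x, tgrad u0 x)).1 = tshift (psi x) (t *: omega).
Hypotheses (psiK : cancel psi psi') (psi'K : cancel psi' psi).
Context (Psi Psi' : V -> V).
Hypotheses (C1Psi : Ck 1 Psi) (hPsi : forall x, psi (tproj x) = tproj (Psi x)).
Hypotheses (C1Psi' : Ck 1 Psi') (hPsi' : forall x, psi' (tproj x) = tproj (Psi' x)).

Let liftPsi x k : exists l, Psi (x + intr_row R k) = Psi x + intr_row R l.
Proof. by apply/tprojP; rewrite -!hPsi tproj_int. Qed.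

Let liftPsi' x k : exists l, Psi' (x + intr_row R k) = Psi' x + intr_row R l.
Proof. by apply/tprojP; rewrite -!hPsi' tproj_int. Qed.

(** Along an orbit on the graph [Psi (X t) - t *: omega] differs from a constant by
    an integer vector, hence is constant; differentiate at [t = 0]. *)
Lemma KAM_velocity x : 'D_(Vel (tproj x)) Psi x = omega.
Proof.
have [phi0 [X [P hXP]]] := flowphi (tproj x, tgrad u0 (tproj x)).
have cX : continuous X.
  move=> t; apply: differentiable_continuous; apply/derivable1_diffP.
  by have [_ []] := hXP t.
have [e0 dX0 _] := hXP 0.
move: e0; rewrite phi0 => -[/tprojP [k Ek] P0].
have X0 : X 0 = x + intr_row R (- k).
  rewrite Ek; apply/rowP => i; rewrite !mxE rmorphN /=; ring.
have hV : dHdp H (X 0) (P 0) = Vel (tproj x).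
  by rewrite X0 -P0 dHdp_int graph_velocity_tproj.
rewrite hV in dX0.
have hint t : exists l, Psi (X t) - t *: omega = trep (psi (tproj x)) + intr_row R l.
  have := conj_psi (tproj x) t; have [-> _ _] := hXP t.
  rewrite /= hPsi /tshift => /tprojP [l ->]; exists l.
  by rewrite addrAC addrK.
apply/rowP => i.
have cPX : continuous (fun t : R => Psi (X t) 0 i).
  exact: continuous_coord (continuous_of_comp cX C1Psi.1).
have hc : forall t, (Psi (X t) - t *: omega - trep (psi (tproj x))) 0 i =
     (Psi (X 0) - 0 *: omega - trep (psi (tproj x))) 0 i.
  move=> t.
  apply: (@int_const R R (fun t => (Psi (X t) - t *: omega - trep (psi (tproj x))) 0 i)).
    rewrite (_ : (fun t => _) = (fun t : R => Psi (X t) 0 i + (- omega 0 i * t - trep (psi (tproj x)) 0 i))).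
      move=> s; apply: cvgD; first exact: cPX.
      apply: cvgB; last exact: cvg_cst.
      by apply: cvgMl_tmp; exact: cvg_id.
    by apply/funext => s; rewrite !mxE; ring.
  move=> s; have [l ->] := hint s.
  by rewrite addrAC subrr add0r mxE; exact: intr_int.
have E : (fun t : R => Psi (X t) 0 i) = (fun t => Psi (X 0) 0 i + t * omega 0 i).
  by apply/funext => t; have := hc t; rewrite !mxE; lra.
have d1 : is_derive (0 : R) 1 (fun t : R => Psi (X t) 0 i) ('D_(Vel (tproj x)) (fun y => Psi y 0 i) (X 0)).
  exact: is_derive_curve (C1_coord C1Psi i) dX0.
have d2 := is_derive_affine (Psi (X 0) 0 i) (omega 0 i) 0.
rewrite -(derive_lift_int C1Psi liftPsi (Vel (tproj x)) x (- k)) -X0 -derive_coord//.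
by have [_ <-] := d1; rewrite E; have [_ ->] := d2.
Qed.

(** Defined up to the lattice, and used only inside periodic functions. *)
Definition angle (x : torus R n) : V := trep (psi x).

Lemma KAM_trig_test (f df : R -> R) (k : 'rV[int]_n) :
  (forall x : R, is_derive x 1 f (df x)) -> continuous df ->
  (forall x (m : int), f (x + 2 * pi * m%:~R) = f x) ->
  C1_torus (fun x => f (phase k (angle x))) /\
  forall x v, dotp (tgrad (fun x => f (phase k (angle x))) (tproj x)) v =
    phase k ('D_v Psi x) * df (phase k (Psi x)).
Proof.
move=> hf cdf perf.
have E : tlift (fun x => f (phase k (angle x))) = (fun y => f (phase k y)) \o Psi.
  apply/funext => x; rewrite /tlift /angle hPsi /=.
  have [m ->] := trep_tproj (Psi x); rewrite phaseDr.
  by have [l ->] := phase_intr R k m; rewrite perf.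
have [Df C1f] := C1_trig_phase k hf cdf.
have [D C1] := C1_comp C1f C1Psi.
have hC1 : C1_torus (fun x => f (phase k (angle x))) by rewrite /C1_torus E.
by split=> // x v; rewrite -derive_tlift// E D Df.
Qed.

Lemma KAM_trig_bound : exists2 K : R, 0 <= K &
  forall (f df : R -> R) (k : 'rV[int]_n),
  (forall x : R, is_derive x 1 f (df x)) -> continuous df ->
  (forall x (m : int), f (x + 2 * pi * m%:~R) = f x) ->
  (forall x, `|df x| <= 1) ->
  forall x w, `|dotp (tgrad (fun x => f (phase k (angle x))) x) w| <=
    K * `|intr_row R k| * `|w|.
Proof.
have [K K0 hK] := lift_derive_bound C1Psi liftPsi.
exists (2 * pi * n%:R * K) => [|f df k hf cdf perf df1 x w].
  by rewrite !mulr_ge0 ?pi_ge0.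
rewrite -[x]trepK (KAM_trig_test k hf cdf perf).2 normrM.
rewrite (le_trans (ler_piMr _ (df1 _)))// (le_trans (phase_le _ _))//.
rewrite [leRHS](_ : _ = 2 * pi * n%:R * `|intr_row R k| * (K * `|w|)); last by ring.
by rewrite ler_wpM2l// !mulr_ge0 ?pi_ge0.
Qed.

Lemma KAM_trig_velocity (f df : R -> R) (k : 'rV[int]_n) :
  (forall x : R, is_derive x 1 f (df x)) -> continuous df ->
  (forall x (m : int), f (x + 2 * pi * m%:~R) = f x) ->
  (forall x (m : int), df (x + 2 * pi * m%:~R) = df x) ->
  forall x, dotp (tgrad (fun x => f (phase k (angle x))) x) (Vel x) =
    phase k omega * df (phase k (angle x)).
Proof.
move=> hf cdf perf perdf x; rewrite -[x]trepK (KAM_trig_test k hf cdf perf).2.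
rewrite KAM_velocity /angle hPsi; have [m ->] := trep_tproj (Psi (trep x)).
by rewrite phaseDr; have [l ->] := phase_intr R k m; rewrite perdf.
Qed.

Let PsiK_const : exists d : V, forall x, Psi' (Psi x) = x + d.
Proof.
exists (Psi' (Psi 0)) => x.
have hint y : exists l, Psi' (Psi y) = y + intr_row R l.
  by apply/tprojP; rewrite -hPsi' -hPsi psiK.
have c1 := continuous_of_comp C1Psi.1 C1Psi'.1.
apply/rowP => i.
have := @int_const R V (fun y => (Psi' (Psi y) - y) 0 i) _ _ x 0.
rewrite !mxE subr0 => <-; first by rewrite addrC subrK.
  apply: continuous_coord => y; exact: (cvgB (c1 y) (@cvg_id _ (nbhs y))).
by move=> y; have [l ->] := hint y; rewrite addrAC subrr add0r mxE; exact: intr_int.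
Qed.

Lemma lift_degree_inv : lift_degree Psi *m lift_degree Psi' = 1%:M.
Proof.
have [d hd] := PsiK_const.
apply/row_matrixP => i; rewrite !rowE mulmxA mulmx1.
pose k : 'rV[int]_n := delta_mx 0 i.
have kE : intr_row R k = delta_mx 0 i.
  by apply/rowP => j; rewrite !mxE; case: (_ && _).
have [m Em] : exists m, intr_row R k *m lift_degree Psi = intr_row R m.
  have [m Em] := liftPsi 0 k; exists m; move: Em.
  by rewrite lift_degreeP// => /addrI.
have := hd (0 + intr_row R k); rewrite lift_degreeP// Em lift_degreeP// hd -Em kE.
by rewrite !add0r addrC => /addIr.
Qed.

(** The function [x |-> dotp c (Psi x *m A' - x)] is periodic because the degree
    [A'] of the inverse map inverts that of [Psi]; its derivative along [Vel] is
    [dotp c (rho - Vel)] with [rho = omega *m A']. Integrated against a closed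
    measure, it compares the rotation vector of the measure with [rho]. *)
Lemma KAM_rotation : exists2 K : R, 0 <= K & exists rho : V,
  forall c, exists2 f : torus R n -> R, C1_torus f &
    forall x v, `|dotp (tgrad f x) v - dotp c (rho - v)| <= K * `|c| * `|v - Vel x|.
Proof.
have [K K0 hK] := lift_derive_bound C1Psi liftPsi.
pose A' := lift_degree Psi'.
have [M M0 hM] : exists2 M : R, 0 <= M & forall (v : V), `|v *m A'| <= M * `|v|.
  have [M M0 hM] : exists2 M : R, 0 <= M & forall (ij : 'I_n * 'I_n) (t : unit), True ->
      `|A' ij.1 ij.2| <= M.
    by apply: uniform_bound => ij; exists `|A' ij.1 ij.2|.
  exists (n%:R * M) => [|v]; first by rewrite mulr_ge0.
  apply: rV_norm_le => [|i]; first by rewrite !mulr_ge0.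
  rewrite mxE (le_trans (ler_norm_sum _ _ _))// -mulrA mulr_natl -[X in _ *+ X]card_ord.
  rewrite -sumr_const; apply: ler_sum => j _; rewrite normrM mulrC.
  by apply: ler_pM => //; [exact: (hM (j, i) tt I)|exact: rV_norm_coord].
exists (n%:R * (M * K)); first by rewrite !mulr_ge0.
exists (omega *m A') => c.
pose a : V := c *m A'^T.
have aE v : dotp a v = dotp c (v *m A') by rewrite dotp_mulmxl trmxK.
pose f (x : torus R n) := dotp a (Psi (trep x)) - dotp c (trep x).
have [Da C1a] := C1_dotp a; have [De C1e] := C1_dotp c.
have [Daa C1aa] := C1_comp C1a C1Psi.
have [Df C1f] := C1_sub C1aa C1e.
have E : tlift f = (dotp a \o Psi) \- dotp c.
  apply/funext => x; rewrite /tlift /f /=; have [k ->] := trep_tproj x.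
  rewrite lift_degreeP// !dotpDr [dotp a (_ *m _)]aE -mulmxA lift_degree_inv mulmx1.
  by ring.
have hC1 : C1_torus f by rewrite /C1_torus E.
exists f => // x v.
have -> : dotp (tgrad f x) v = dotp c ('D_v Psi (trep x) *m A') - dotp c v.
  by rewrite -{1}[x]trepK -derive_tlift// E Df Daa Da De aE.
rewrite dotpBr opprB addrA subrK -dotpBr -mulmxBl -(KAM_velocity (trep x)) trepK.
rewrite (_ : 'D_v Psi _ - _ = 'D_(v - Vel x) Psi (trep x)); last first.
  by rewrite !derive_jac// mulmxBl.
rewrite (le_trans (dotp_le _ _))// -!mulrA ler_wpM2l// [leRHS](_ : _ = `|c| * (M * (K * `|v - Vel x|))); last by ring.
rewrite ler_wpM2l// (le_trans (hM _))// ler_wpM2l//.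
Qed.

(** Replace [angle x'] by its translate closest to [angle x]: at coordinate distance
    at most [1 / 2], [1 - cos] controls the square of the distance, and the inverse
    lift is Lipschitz. *)
Lemma KAM_angle_dist : exists2 K : R, 0 <= K & forall x x',
  tdist x x' + `|Vel x - Vel x'| <= K * chi_dist (angle x) (angle x').
Proof.
have [c c0 hc] := @one_sub_cos_lower R.
have [K K0 hK] := lift_lipschitz C1Psi' liftPsi'.
have [L L0 hL] := graph_velocity_lipschitz tonelliH hu0.
exists ((Num.sqrt n%:R + L) * (K * Num.sqrt c^-1)) => [|x x'].
  by rewrite !mulr_ge0 ?addr_ge0 ?sqrtr_ge0.
set y := angle x; set y' := angle x'.
pose k : 'rV[int]_n := \row_i Num.floor (y 0 i - y' 0 i + 2^-1).
pose t := y - (y' + intr_row R k).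
have ht i : `|t 0 i| <= 2^-1.
  rewrite !mxE ler_norml.
  have := floor_le_tmp (y 0 i - y' 0 i + 2^-1).
  have := floorD1_gt (y 0 i - y' 0 i + 2^-1); rewrite intrD1.
  by move: (Num.floor _)%:~R => f h1 h2; apply/andP; split; lra.
have D2 : 0 <= \sum_(i < n) (1 - cos (2 * pi * (y 0 i - y' 0 i))).
  by apply: sumr_ge0 => i _; rewrite subr_ge0 cos_le1.
have tD : `|t| <= Num.sqrt c^-1 * chi_dist y y'.
  apply: rV_norm_le => [|i]; first by rewrite mulr_ge0 ?sqrtr_ge0.
  rewrite -sqrtrM ?invr_ge0 ?(ltW c0)// -sqrtr_sqr ler_sqrt; last first.
    by rewrite mulr_ge0 ?invr_ge0 ?(ltW c0).
  rewrite ler_pdivlMl// (le_trans (hc _ (ht i)))//.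
  have -> : cos (2 * pi * t 0 i) = cos (2 * pi * (y 0 i - y' 0 i)).
    rewrite -[RHS](cos_int_period _ (- k 0 i)) /t !mxE rmorphN /=; congr cos; ring.
  rewrite (bigD1 i)//= lerDl; apply: sumr_ge0 => j _.
  by rewrite subr_ge0 cos_le1.
have xE : x = tproj (Psi' y) by rewrite -hPsi' /y /angle trepK psiK.
have x'E : x' = tproj (Psi' (y' + intr_row R k)).
  by rewrite -hPsi' tproj_int /y' /angle trepK psiK.
have hPP : `|Psi' y - Psi' (y' + intr_row R k)| <= K * Num.sqrt c^-1 * chi_dist y y'.
  by rewrite (le_trans (hK _ _))// -mulrA ler_wpM2l.
rewrite -mulrA mulrDl {1 2}xE {1 2}x'E lerD//.
  rewrite (le_trans (tdist_tproj _ _))// (le_trans (enorm_le_norm _))//.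
  by rewrite ler_wpM2l ?sqrtr_ge0.
by rewrite (le_trans (hL _ _))// ler_wpM2l.
Qed.

Lemma KAM_inverse_velocity y : 'D_omega Psi' y = Vel (tproj (Psi' y)).
Proof.
have [d hd] := PsiK_const.
have hD x v : 'D_('D_v Psi x) Psi' (Psi x) = v.
  apply/rowP => i; rewrite -derive_coord//.
  have [<- _] := C1_comp (C1_coord C1Psi' i) C1Psi.
  rewrite (_ : _ \o Psi = (fun x : V => x 0 i + d 0 i)); last first.
    by apply/funext => z /=; rewrite hd mxE.
  rewrite derive_line (_ : (fun s : R => _) = (fun s => (x 0 i + d 0 i) + s * v 0 i)).
    by have [_ ->] := is_derive_affine (x 0 i + d 0 i) (v 0 i) 0.
  by apply/funext => s; rewrite !mxE; ring.
have [l El] : exists l, Psi (Psi' y) = y + intr_row R l.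
  by apply/tprojP; rewrite -hPsi -hPsi' psi'K.
rewrite -(derive_lift_int C1Psi' liftPsi' omega y l) -El.
by rewrite -{1}(KAM_velocity (Psi' y)) hD.
Qed.

End KAM.

(** * Measures carried by curves *)

(** The constant [M] added to the integrand makes it nonnegative, as required to pass
    from the uniform probability to Lebesgue measure. *)
Lemma uniform_integral_derive (R : realType) (g dg : R -> R) (M : R) :
  (forall s : R, is_derive s 1 g (dg s)) -> continuous dg ->
  (forall s, `|dg s| <= M) ->
  \int[uniform_prob (@ltr01 R)]_s dg s = g 1 - g 0.
Proof.
move=> hg cdg hM.
pose f s := dg s + M; pose F s := g s + (0 + s * M).
have f0 s : 0 <= f s by have := hM s; rewrite ler_norml /f => /andP[? _]; lra.
have cf : continuous f by move=> s; exact: (cvgD (cdg s) (@cst_continuous _ _ M s)).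
have mdg : measurable_fun setT dg by exact: continuous_measurable_fun.
have bdg : bmeas dg by split => //; exists M.
have hF (s : R) : is_derive s 1 F (f s) by exact: is_deriveD (hg s) (is_derive_affine 0 M s).
have cF : continuous F.
  by move=> s; apply: differentiable_continuous; apply/derivable1_diffP; have [] := hF s.
have E : (\int[uniform_prob (@ltr01 R)]_s (f s)%:E = (F 1 - F 0)%:E)%E.
  rewrite integral_uniform; last first.
  - by move=> s; rewrite lee_fin.
  - by apply/measurable_EFinP; exact: continuous_measurable_fun.
  rewrite subr0 invr1 mul1e (@continuous_FTC2 _ f F)//.
  - exact: continuous_subspaceT.
  - split; first by move=> s _; have [] := hF s.
    + by apply: cvg_at_right_filter; exact: cF.
    + by apply: cvg_at_left_filter; exact: cF.
  - by move=> s _; rewrite derive1E; have [] := hF s.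
have : (\int[uniform_prob (@ltr01 R)]_s f s = F 1 - F 0) by rewrite /Rintegral E.
by rewrite RintD// ?Rint_cst; [rewrite /F; lra|exact: bmeas_cst].
Qed.

Section CurveMeasure.
Context (R : realType) (n : nat).
Local Notation V := 'rV[R]_n.

Lemma curve_measure (X W : R -> V) : continuous X -> continuous W ->
  exists nu : probability (borel_bundle R n) R,
  forall f : bundle R n -> R, measurable_fun (setT : set (borel_bundle R n)) f ->
  (exists M, forall s, `|f (tproj (X s), W s)| <= M) ->
  [/\ nu.-integrable setT (EFin \o f),
      bmeas (fun s : measurableTypeR R => f (tproj (X s), W s)) &
      \int[nu]_z f z = \int[uniform_prob (@ltr01 R)]_s f (tproj (X s), W s)].
Proof.
move=> cX cW.
pose F : measurableTypeR R -> borel_bundle R n := fun s => (tproj (X s), W s).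
have cF : continuous (fun s : R => (tproj (X s), W s) : bundle R n).
  exact: (continuous_pairing (continuous_of_comp cX (@continuous_tproj R n)) cW).
have mF : measurable_fun setT F.
  apply: measurability => // _ [U oU <-]; rewrite setTI.
  apply: open_measurable; exact: (open_comp (fun s _ => cF s) oU).
pose mFp : {mfun measurableTypeR R >-> borel_bundle R n} := HB.pack F (isMeasurableFun.Build _ _ _ _ F mF).
exists (distribution (uniform_prob (@ltr01 R)) mFp) => f mf [M hM].
have bf : bmeas (f \o F) by split; [exact: measurableT_comp|exists M].
have intf := bmeas_integrable (uniform_prob (@ltr01 R)) bf.
have mEf : measurable_fun (setT : set (borel_bundle R n)) (EFin \o f) by exact/measurable_EFinP.
split=> //; first by apply: integrable_pushforward.
by rewrite /Rintegral integral_pushforward//.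
Qed.

End CurveMeasure.

(** * Closed measures and almost minimizers *)

Section RealIntegrable.
Context d (T : measurableType d) (R : realType) (mu : {measure set T -> \bar R}).
Implicit Types f g : T -> R.

Lemma real_integrableD f g : mu.-integrable setT (EFin \o f) ->
  mu.-integrable setT (EFin \o g) -> mu.-integrable setT (EFin \o (fun z => f z + g z)).
Proof. by move=> h1 h2; exact: (integrableD measurableT h1 h2). Qed.

Lemma real_integrableZ (a : R) f : mu.-integrable setT (EFin \o f) ->
  mu.-integrable setT (EFin \o (fun z => a * f z)).
Proof. by move=> h1; exact: (integrableZl measurableT a h1). Qed.

Lemma real_integrableB f g : mu.-integrable setT (EFin \o f) ->
  mu.-integrable setT (EFin \o g) -> mu.-integrable setT (EFin \o (fun z => f z - g z)).
Proof. by move=> h1 h2; exact: (integrableB measurableT h1 h2). Qed.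

End RealIntegrable.

Section ClosedMeasures.
Context (R : realType) (n : nat).
Local Notation V := 'rV[R]_n.
Local Notation B := (borel_bundle R n).
Implicit Types (mu : probability B R) (f : bundle R n -> R).

Lemma linear_growth_integrable mu f (a b : R) : 0 <= b ->
  (\int[mu]_z (enorm (z : bundle R n).2)%:E < +oo)%E ->
  measurable_fun (setT : set B) f -> (forall z, `|f z| <= a + b * `|z.2|) ->
  mu.-integrable setT (EFin \o f).
Proof.
move=> b0 hmu mf hf.
have me : measurable_fun (setT : set B) (fun z : bundle R n => enorm z.2).
  exact: (continuous_measurable_bundle (continuous_enorm (@continuous_bsnd R n))).
have ie : mu.-integrable setT (EFin \o (fun z : bundle R n => enorm z.2)).
  apply/integrableP; split; first exact/measurable_EFinP.
  apply: le_lt_trans hmu; apply: ge0_le_integral => //.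
  - by apply/measurableT_comp => //; exact/measurable_EFinP.
  - exact/measurable_EFinP.
  - by move=> z _ /=; rewrite lee_fin ger0_norm ?enorm_ge0.
have ic := bmeas_integrable mu (bmeas_cst B `|a|).
have := integrableD measurableT ic (integrableZl measurableT b ie).
apply: le_integrable => //; first exact/measurable_EFinP.
move=> z _ /=; rewrite lee_fin [leRHS]ger0_norm; last first.
  by rewrite addr_ge0// mulr_ge0// enorm_ge0.
rewrite (le_trans (hf z))// lerD ?ler_norm// ler_wpM2l//.
exact: norm_le_enorm.
Qed.

Context (mu : probability B R) (cmu : closed_measure mu).

Lemma closed_integrable f (a b : R) : 0 <= b -> continuous f ->
  (forall z, `|f z| <= a + b * `|z.2|) -> mu.-integrable setT (EFin \o f).
Proof.
move=> b0 cf; apply: linear_growth_integrable => //; first exact: cmu.1.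
exact: continuous_measurable_bundle.
Qed.

Lemma continuous_pair_dotp (F : torus R n -> V) : continuous F ->
  continuous (fun z : bundle R n => dotp (F z.1) z.2).
Proof.
move=> cF; exact: (continuous_dotp (continuous_of_comp (@continuous_bfst R n) cF) (@continuous_bsnd R n)).
Qed.

Lemma pair_dotp_integrable (F : torus R n -> V) : continuous F ->
  mu.-integrable setT (EFin \o (fun z : bundle R n => dotp (F z.1) z.2)).
Proof.
move=> cF; have [K K0 hK] := torus_row_bounded cF.
apply: (@closed_integrable _ 0 (n%:R * K)); first by rewrite mulr_ge0.
  exact: continuous_pair_dotp.
move=> z; rewrite add0r (le_trans (dotp_le _ _))// -mulrA ler_wpM2l// ler_wpM2r//.
Qed.

Lemma deviation_integrable (F : torus R n -> V) : continuous F ->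
  mu.-integrable setT (EFin \o (fun z : bundle R n => `|z.2 - F z.1|)).
Proof.
move=> cF; have [K K0 hK] := torus_row_bounded cF.
apply: (@closed_integrable _ K 1) => //.
  have c1 := continuous_of_comp (@continuous_bfst R n) cF.
  apply: (continuous_of_comp (g := @Num.norm R V)); last exact: norm_continuous.
  by move=> z; exact: (cvgB (@continuous_bsnd R n z) (c1 z)).
by move=> z; rewrite normr_id mul1r [leRHS]addrC (le_trans (ler_normB _ _))// lerD.
Qed.

Lemma closed_Rint0 (f : torus R n -> R) : C1_torus f ->
  \int[mu]_z dotp (tgrad f (z : bundle R n).1) (z : bundle R n).2 = 0.
Proof. by move=> C1f; rewrite /Rintegral cmu.2. Qed.

End ClosedMeasures.

Section NearMinimizer.
Context (R : realType) (n : nat) (H : bundle R n -> R) (tonelliH : tonelli H).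
Context (u0 : torus R n -> R) (hu0 : C11_torus u0) (h : R).
Hypothesis hHJ : forall x, H (x, tgrad u0 x) = h.
Local Notation V := ('rV[R]_n).
Local Notation Vel := (graph_velocity H u0).
Context (omega : V) (Y : V -> V).
Hypotheses (C1Y : Ck 1 Y)
  (liftY : forall x k, exists l, Y (x + intr_row R k) = Y x + intr_row R l)
  (velY : forall y, 'D_omega Y y = Vel (tproj (Y y))).

(** A line of rational direction [p / N] closes up on the torus, so that its image
    under [Y] carries a closed measure. With [p / N] within [1 / N] of [omega], the
    velocity of the image is within [K / N] of [Vel], and [graph_upper] bounds the
    action by [- h + R0 * K / N]. *)
Lemma near_minimizer (e : R) : 0 < e ->
  exists nu : probability (borel_bundle R n) R,
    [/\ closed_measure nu, nu.-integrable setT (EFin \o lagrangian H)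
      & \int[nu]_z lagrangian H z <= - h + e].
Proof.
move=> e0.
have [K K0 hK] := lift_derive_bound C1Y liftY.
have [R0 R00 hR0] := graph_upper tonelliH hu0 hHJ.
have [K1 K10 hK1] := graph_lower tonelliH hu0 hHJ.
pose N := (Num.truncn (K + R0 * K / e)).+1.
have N0 : 0 < N%:R :> R by rewrite ltr0n.
have NK : K + R0 * K / e <= N%:R by exact/ltW/truncnS_gt.
have NK1 : K / N%:R <= 1.
  rewrite ler_pdivrMr// mul1r (le_trans _ NK)// lerDl.
  by rewrite divr_ge0 ?mulr_ge0// ltW.
have NK2 : R0 * (K / N%:R) <= e.
  by rewrite mulrA ler_pdivrMr// [leRHS]mulrC -ler_pdivrMr// (le_trans _ NK)// lerDr.
(* The integer part of [N *: omega]: the direction [p / N] is rational. *)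
pose p : 'rV[int]_n := \row_i Num.floor (omega 0 i * N%:R).
pose p' := intr_row R p.
have hp : `|N%:R^-1 *: p' - omega| <= N%:R^-1.
  apply: rV_norm_le => [|i]; first by rewrite invr_ge0 ltW.
  rewrite !mxE distrC.
  have := floor_le_tmp (omega 0 i * N%:R).
  have := floorD1_gt (omega 0 i * N%:R); rewrite intrD1.
  move: (Num.floor _)%:~R => f h1 h2.
  have -> : omega 0 i - N%:R^-1 * f = N%:R^-1 * (omega 0 i * N%:R - f).
    by rewrite mulrBr mulrCA mulVf ?mulr1// gt_eqF.
  rewrite normrM ger0_norm ?invr_ge0 ?(ltW N0)// ler_piMr// ?invr_ge0 ?(ltW N0)//.
  by rewrite ler_norml; lra.
pose X (s : R) := Y (0 + s *: p').
pose W (s : R) := 'D_(N%:R^-1 *: p') Y (0 + s *: p').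
have cl : continuous (fun s : R => 0 + s *: p').
  apply: (@lipschitz_continuous _ _ _ _ `|p'|) => // a b.
  by rewrite !add0r -scalerBl normrZ mulrC.
have cX : continuous X by exact: continuous_of_comp cl C1Y.1.
have cW : continuous W by exact: continuous_of_comp cl (C1Y.2 _).2.1.
have hW s : `|W s - Vel (tproj (X s))| <= K / N%:R.
  rewrite -velY /W !derive_jac// -mulmxBl -derive_jac// (le_trans (hK _ _))//.
  by rewrite ler_wpM2l.
have W1' s := le_trans (hW s) NK1.
have [r r0 hr] := graph_velocity_bounded tonelliH hu0.
have Wb s : `|W s| <= r + 1.
  rewrite -[W s](subrK (Vel (tproj (X s)))) addrC (le_trans (ler_normD _ _))// lerD//.
have [nu hnu] := curve_measure cX cW.
have dotp_nu (F : torus R n -> V) : continuous F ->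
    exists M, forall s, `|dotp (F (tproj (X s))) (W s)| <= M.
  move=> cF; have [M M0 hM] := torus_row_bounded cF.
  exists (n%:R * (M * (r + 1))) => s; rewrite (le_trans (dotp_le _ _))// ler_wpM2l//.
  by rewrite ler_pM.
have cnu : closed_measure nu.
  have me : measurable_fun (setT : set (borel_bundle R n)) (fun z : bundle R n => enorm z.2).
    exact: (continuous_measurable_bundle (continuous_enorm (@continuous_bsnd R n))).
  split.
    have [|ie _ _] := hnu _ me.
      exists (Num.sqrt n%:R * (r + 1)) => s /=.
      rewrite ger0_norm ?enorm_ge0// (le_trans (enorm_le_norm _))//.
      by rewrite ler_wpM2l ?sqrtr_ge0.
    by have := integrable_fin_num measurableT ie; rewrite fin_numE => /andP[_]; rewrite -ltey.
  move=> f C1f.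
  have cg := continuous_tgrad C1f.
  have mg := continuous_measurable_bundle (continuous_pair_dotp cg).
  have [M hM] := dotp_nu _ cg.
  have [ig bg Eg] := hnu _ mg (ex_intro _ M hM).
  rewrite -[LHS]fineK; last exact: (integrable_fin_num measurableT ig).
  rewrite -/(Rintegral _ _ _) Eg.
  pose g (s : R) := tlift f (X s).
  have [Dg C1g] := C1_comp C1f C1Y.
  have hg (s : R) : is_derive s 1 g (N%:R * dotp (tgrad f (tproj (X s))) (W s)).
    have := @is_derive_line R _ _ (tlift f \o Y) 0 p' s ((C1g.2 p').1 _).
    rewrite Dg /W derive_tlift//.
    by rewrite !derive_jac// -scalemxAl dotpZr mulrA divff ?mul1r// gt_eqF.
  have cdg : continuous (fun s => N%:R * dotp (tgrad f (tproj (X s))) (W s)).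
    apply: continuous_mul; first exact: cst_continuous.
    apply: continuous_dotp => //.
    exact: (continuous_of_comp (continuous_of_comp cX (@continuous_tproj R n)) cg).
  have g01 : g 1 - g 0 = 0.
    rewrite /g /X scale0r scale1r; have [l ->] := liftY 0 p.
    by rewrite tlift_int addr0 subrr.
  have : \int[uniform_prob ltr01]_s (N%:R * dotp (tgrad f (tproj (X s))) (W s)) = 0.
    rewrite (@uniform_integral_derive R g _ (N%:R * M) hg cdg)// => s.
    by rewrite normrM normr_nat ler_wpM2l.
  rewrite RintZ// => /eqP; rewrite mulf_eq0 gt_eqF//= => /eqP E0.
  by congr EFin.
have mL := lagrangian_measurable tonelliH.
have cu := continuous_tgrad hu0.1.
have [M hM] := dotp_nu _ cu.
have hG s : 0 <= lagrangian H (tproj (X s), W s) - dotp (tgrad u0 (tproj (X s))) (W s) + h <= R0 * (K / N%:R).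
  apply/andP; split.
    have := hK1 (tproj (X s), W s) 0; rewrite lexx ler01 => /(_ erefl).
    by rewrite expr0n /= mulr0 mul0r subrr.
  rewrite (le_trans (hR0 (tproj (X s), W s) (W1' s)))// ler_wpM2l//; exact: hW.
have [|iL _ _] := hnu _ mL.
  exists (M + `|h| + R0 * (K / N%:R)) => s.
  have := hM s; have /andP[] := hG s; rewrite !ler_norml => ? ? /andP[? ?].
  have RK : 0 <= R0 * (K / N%:R) by rewrite !mulr_ge0// invr_ge0 ltW.
  by have := ler_norm h; have := ler_norm (- h); rewrite normrN; lra.
exists nu; split => //.
have ig := pair_dotp_integrable cnu cu.
have ih := bmeas_integrable nu (bmeas_cst (borel_bundle R n) h).
have E : \int[nu]_z lagrangian H z + h =
   \int[nu]_z (lagrangian H z - dotp (tgrad u0 (z : bundle R n).1) (z : bundle R n).2 + h).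
  by rewrite RintegralD//; [rewrite RintegralB// (closed_Rint0 cnu hu0.1) subr0 Rint_cst|exact: real_integrableB].
rewrite addrC -lerBlDr opprK E.
have mG : measurable_fun (setT : set (borel_bundle R n))
   (fun z : bundle R n => lagrangian H z - dotp (tgrad u0 z.1) z.2 + h).
  apply: measurable_funD => //; apply: measurable_funB => //.
  exact: (continuous_measurable_bundle (continuous_pair_dotp cu)).
have [|iG bG EG] := hnu _ mG.
  by exists (R0 * (K / N%:R)) => s; have /andP[? ?] := hG s; rewrite ger0_norm.
rewrite EG (le_trans _ NK2)//.
rewrite (le_trans (ler_norm _))// Rint_norm// => s.
by have /andP[? ?] := hG s; rewrite ger0_norm.
Qed.

End NearMinimizer.

(** * Deviation of Mather measures from the invariant torus *)

(** The negative part is dominated by [g], so that a finite integral leaves a finite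
    positive part. *)
Lemma integrable_of_lt_pinfty d (T : measurableType d) (R : realType)
    (mu : {measure set T -> \bar R}) (l g : T -> R) :
  measurable_fun setT l -> mu.-integrable setT (EFin \o g) ->
  (forall z, - l z <= g z) -> (\int[mu]_z (l z)%:E < +oo)%E ->
  mu.-integrable setT (EFin \o l).
Proof.
move=> ml ig lg hl.
have mE : measurable_fun setT (EFin \o l) by exact/measurable_EFinP.
have g0 : mu.-integrable setT ((EFin \o l)^\-)%E.
  have ig' := integrable_abse ig.
  apply: (le_integrable measurableT _ _ ig'); first exact: measurable_funeneg.
  move=> z _ /=; rewrite funenegE /= gee0_abs ?le_max ?lexx ?orbT//.
  rewrite ge_max !lee_fin normr_id normr_ge0 andbT.
  by rewrite (le_trans (lg z))// ler_norm.
have fn := integrable_fin_num measurableT g0.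
have hp : (\int[mu]_z ((EFin \o l)^\+ z) < +oo)%E.
  move: hl; rewrite -[fun z => (l z)%:E]/(EFin \o l) integralE; move: fn.
  case: (\int[mu]_z ((EFin \o l)^\- z))%E => // r _.
  by case: (\int[mu]_z (EFin \o l)^\+ z)%E => //= r' _; rewrite ltry.
have ip : mu.-integrable setT ((EFin \o l)^\+)%E.
  apply/integrableP; split; first exact: measurable_funepos.
  by under eq_integral do rewrite gee0_abs//.
by rewrite (funeposneg (EFin \o l)); exact: integrableB.
Qed.

Section Minimizers.
Context (R : realType) (n : nat) (H : bundle R n -> R) (tonelliH : tonelli H).
Context (u0 : torus R n -> R) (hu0 : C11_torus u0) (h : R).
Hypothesis hHJ : forall x, H (x, tgrad u0 x) = h.
Local Notation V := ('rV[R]_n).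
Local Notation B := (borel_bundle R n).
Local Notation Vel := (graph_velocity H u0).
Hypothesis near : forall e : R, 0 < e ->
  exists nu : probability (borel_bundle R n) R,
    [/\ closed_measure nu, nu.-integrable setT (EFin \o lagrangian H)
      & \int[nu]_z lagrangian H z <= - h + e].
Implicit Types (mu nu : probability B R) (c : V).

Definition deviation mu : R := \int[mu]_z `|(z : bundle R n).2 - Vel (z : bundle R n).1|.

Let cVel : continuous Vel := continuous_graph_velocity tonelliH hu0.
Let cu := continuous_tgrad hu0.1.

Lemma deviation_ge0 mu : 0 <= deviation mu.
Proof. exact: Rintegral_ge0. Qed.

Let flow_integrable mu c : closed_measure mu ->
  mu.-integrable setT (EFin \o (fun z : bundle R n => dotp c z.2)).
Proof.
move=> cmu; exact: (pair_dotp_integrable cmu (F := fun=> c) (@cst_continuous _ _ c)).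
Qed.

(** The action of a minimizer is finite because that of the measures in [near] is. *)
Lemma mather_integrable c mu : mather_measure (Hshift H c) mu ->
  mu.-integrable setT (EFin \o lagrangian H).
Proof.
move=> [cmu hmin]; have [nu [cnu inu _]] := near ltr01.
have LE : lagrangian (Hshift H c) = (fun z => lagrangian H z - dotp c z.2).
  by apply/funext => z; exact: lagrangian_shift.
have iLnu := real_integrableB inu (flow_integrable c cnu).
have lt : (action (Hshift H c) mu < +oo)%E.
  apply: le_lt_trans (hmin nu cnu) _; rewrite /action LE.
  by have := integrable_fin_num measurableT iLnu; rewrite fin_numE => /andP[_]; rewrite -ltey.
have ic := flow_integrable c cmu.
have [M M0 hM] := blift_bounded tonelliH 0.
have iM := bmeas_integrable mu (bmeas_cst B M).
have iL : mu.-integrable setT (EFin \o (fun z : bundle R n => lagrangian H z - dotp c z.2)).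
  apply: (@integrable_of_lt_pinfty _ B R mu (fun z : bundle R n => lagrangian H z - dotp c z.2)
    (fun z : bundle R n => M + dotp c z.2)).
  - apply: measurable_funB; first exact: lagrangian_measurable.
    exact: (continuous_measurable_bundle (continuous_pair_dotp (@cst_continuous _ _ c))).
  - exact: real_integrableD.
  - move=> z; have := lagrangian_ge tonelliH z 0.
    have := hM z.1 0; rewrite normr0 lexx => /(_ erefl); rewrite dotpC dotp0r ler_norml => /andP[? ?].
    by lra.
  - by move: lt; rewrite /action LE.
have := real_integrableD iL ic.
by congr (_.-integrable _ _); apply/funext => z /=; rewrite subrK.
Qed.

Lemma mather_compare c mu nu : mather_measure (Hshift H c) mu ->
  closed_measure nu -> nu.-integrable setT (EFin \o lagrangian H) ->
  \int[mu]_z lagrangian H z - \int[mu]_z dotp c (z : bundle R n).2 <=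
  \int[nu]_z lagrangian H z - \int[nu]_z dotp c (z : bundle R n).2.
Proof.
move=> hmu cnu inu; have imu := mather_integrable hmu.
have icmu := flow_integrable c hmu.1; have icnu := flow_integrable c cnu.
have := hmu.2 nu cnu; rewrite /action.
rewrite (_ : lagrangian (Hshift H c) = (fun z => lagrangian H z - dotp c z.2)); last first.
  by apply/funext => z; exact: lagrangian_shift.
rewrite -!RintegralB// -lee_fin /Rintegral !fineK//.
- exact: (integrable_fin_num measurableT (real_integrableB inu icnu)).
- exact: (integrable_fin_num measurableT (real_integrableB imu icmu)).
Qed.

Lemma deviation_le_action : exists2 K : R, 0 <= K & forall mu (s : R),
  closed_measure mu -> mu.-integrable setT (EFin \o lagrangian H) -> 0 <= s <= 1 ->
  s * deviation mu - K * s ^+ 2 <= \int[mu]_z lagrangian H z + h.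
Proof.
have [K K0 hK] := graph_lower tonelliH hu0 hHJ.
exists K => // mu s cmu imu s01.
have idev := deviation_integrable cmu cVel.
have iu := pair_dotp_integrable cmu cu.
have icst (a : R) := bmeas_integrable mu (bmeas_cst B a).
have -> : s * deviation mu - K * s ^+ 2 =
    \int[mu]_z (s * `|(z : bundle R n).2 - Vel (z : bundle R n).1| - K * s ^+ 2).
  by rewrite RintegralB//; [rewrite RintegralZl// Rint_cst|exact: real_integrableZ].
have -> : \int[mu]_z lagrangian H z + h = \int[mu]_z
    (lagrangian H z - dotp (tgrad u0 (z : bundle R n).1) (z : bundle R n).2 + h).
  rewrite RintegralD//; last exact: real_integrableB.
  by rewrite RintegralB// (closed_Rint0 cmu hu0.1) subr0 Rint_cst.
apply: le_Rintegral => //.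
- by apply: real_integrableB => //; exact: real_integrableZ.
- by apply: real_integrableD => //; exact: real_integrableB.
- by move=> z _; exact: hK.
Qed.

Lemma Hshift0 : Hshift H 0 = H.
Proof. by apply/funext => -[x p]; rewrite /Hshift /= addr0. Qed.

Lemma mather_action_le mu : mather_measure H mu ->
  \int[mu]_z lagrangian H z <= - h.
Proof.
rewrite -{1}Hshift0 => hmu; apply/ler_addgt0Pr => e /near[nu [cnu inu hnu]].
apply: le_trans hnu.
have := mather_compare hmu cnu inu.
have E (m : probability B R) : \int[m]_z dotp 0 (z : bundle R n).2 = 0.
  by rewrite -[RHS](Rint_cst m); apply: eq_Rintegral => z _; rewrite dotpC dotp0r.
by rewrite !E !subr0.
Qed.

(** The action is at most [- h], so that [s * deviation mu <= K * s ^+ 2] for all small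
    [s]. *)
Lemma mather_deviation0 mu : mather_measure H mu -> deviation mu = 0.
Proof.
move=> hmu; have [K K0 hK] := deviation_le_action.
have imu : mu.-integrable setT (EFin \o lagrangian H).
  by apply: (@mather_integrable 0); rewrite Hshift0.
apply/eqP; rewrite eq_le deviation_ge0 andbT; apply/ler_addgt0Pr => e e0; rewrite add0r.
(* Any [s <= e / K] would do; [K + 1] avoids dividing by zero. *)
pose s := Num.min 1 (e / (K + 1)).
have K1 : 0 < K + 1 by rewrite ltr_wpDl.
have s0 : 0 < s by rewrite lt_min ltr01 divr_gt0.
have := hK mu s hmu.1 imu; rewrite (ltW s0) ge_min lexx => /(_ erefl).
have := mather_action_le hmu => h1 h2.
have h3 : s * deviation mu <= s * (K * s) by move: h1 h2; rewrite expr2; lra.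
rewrite ler_pM2l// in h3; rewrite (le_trans h3)//.
have : s * (K + 1) <= e by rewrite -ler_pdivlMr// ge_min lexx orbT.
by lra.
Qed.

Context (Kr : R) (rho : V).
Hypothesis Kr0 : 0 <= Kr.
Hypothesis hrot : forall c, exists2 f : torus R n -> R, C1_torus f &
    forall x v, `|dotp (tgrad f x) v - dotp c (rho - v)| <= Kr * `|c| * `|v - Vel x|.

Lemma rotation_le mu c : closed_measure mu ->
  `|\int[mu]_z dotp c (z : bundle R n).2 - dotp c rho| <= Kr * `|c| * deviation mu.
Proof.
move=> cmu; have [f C1f hf] := hrot c.
have cf := continuous_tgrad C1f.
have i1 := flow_integrable c cmu; have i2 := pair_dotp_integrable cmu cf.
have i3 := deviation_integrable cmu cVel.
have i4 := bmeas_integrable mu (bmeas_cst B (dotp c rho)).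
have i5 := real_integrableB i1 i4.
have i6 := real_integrableD i5 i2.
have -> : \int[mu]_z dotp c (z : bundle R n).2 - dotp c rho = \int[mu]_z
   (dotp c (z : bundle R n).2 - dotp c rho + dotp (tgrad f (z : bundle R n).1) (z : bundle R n).2).
  by rewrite RintegralD// RintegralB// (closed_Rint0 cmu C1f) addr0 Rint_cst.
rewrite (le_trans (le_normr_Rintegral _ i6))// -RintegralZl//.
apply: le_Rintegral => //.
- exact: (integrable_abse i6).
- exact: real_integrableZ.
- move=> z _ /=; rewrite (le_trans _ (hf _ _))// le_eqVlt; apply/orP; left; apply/eqP.
  by congr `|_|; rewrite dotpBr; ring.
Qed.

(** The comparison of [mu] with [mu0] gives
    [s * deviation mu - K * s ^+ 2 <= Kr * `|c| * deviation mu], since only the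
    difference of the rotation vectors enters and that of [mu0] is [rho]. With [s]
    twice the coefficient on the right the quadratic term is of order
    [`|c| ^+ 2]. *)
Lemma mather_deviation_le : exists2 A : R, 0 < A & forall c mu mu0,
  A * `|c| <= 1 -> mather_measure (Hshift H c) mu -> mather_measure H mu0 ->
  deviation mu <= A * `|c|.
Proof.
have [K K0 hK] := deviation_le_action.
(* [A1] replaces [Kr] to be positive. *)
pose A1 := Kr + 1; have A10 : 0 < A1 by rewrite ltr_wpDl.
exists (4 * (K + 1) * A1) => [|c mu mu0 cA hmu hmu0]; first by rewrite !mulr_gt0// ltr_wpDl.
have [c0|c0] := eqVneq c 0.
  by rewrite c0 normr0 mulr0; move: hmu; rewrite c0 Hshift0 => /mather_deviation0 ->.
have cp : 0 < `|c| by rewrite normr_gt0.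
have hmu0' : mather_measure (Hshift H 0) mu0 by rewrite Hshift0.
have imu := mather_integrable hmu; have imu0 := mather_integrable hmu0'.
pose s := 2 * A1 * `|c|.
have s01 : 0 <= s <= 1.
  rewrite /s !mulr_ge0 ?(ltW A10)//= (le_trans _ cA)// ler_wpM2r// ler_wpM2r ?(ltW A10)//.
  by lra.
have h1 := hK mu s hmu.1 imu s01.
have h2 := mather_compare hmu hmu0.1 imu0.
have h3 := mather_action_le hmu0.
have := rotation_le c hmu.1; have := rotation_le c hmu0.1.
rewrite (mather_deviation0 hmu0) mulr0 normr_le0 subr_eq0 => /eqP h4.
rewrite ler_norml => /andP[_ h5].
have d0 := deviation_ge0 mu.
have h6 : Kr * `|c| * deviation mu <= A1 * `|c| * deviation mu.
  by rewrite ler_wpM2r// ler_wpM2r// /A1; lra.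
have h7 : A1 * `|c| * deviation mu <= A1 * `|c| * (4 * K * A1 * `|c|).
  by move: h1 h2 h3 h4 h5 h6; rewrite /s; move: (deviation mu) => dd; rewrite !exprMn; nra.
rewrite ler_pM2l in h7; last by rewrite mulr_gt0.
rewrite (le_trans h7)// ler_wpM2r// ler_wpM2r ?(ltW A10)//.
by lra.
Qed.

End Minimizers.

(** * Transport cost of a coupling over the torus *)

(** The integral of a nonnegative function is a supremum over the simple functions
    below it, hence monotone in all cases. This spares the measurability of the
    distance [bdist], defined from representatives of the points of the torus, for
    the product of the Borel structures. *)
Lemma ge0_le_integral_nonmeasurable d (T : measurableType d) (R : realType)
    (mu : {measure set T -> \bar R}) (f g : T -> \bar R) :
  (forall x, (0 <= f x)%E) -> (forall x, (f x <= g x)%E) ->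
  (\int[mu]_x f x <= \int[mu]_x g x)%E.
Proof.
move=> f0 fg; have g0 x : (0 <= g x)%E := le_trans (f0 x) (fg x).
rewrite !ge0_integralTE//; apply: le_ereal_sup => _ [k hk <-]; exists k => // x.
exact: le_trans (hk x) (fg x).
Qed.

Section Marginals.
Context d1 d2 (T1 : measurableType d1) (T2 : measurableType d2) (R : realType).
Context (Pi : probability (T1 * T2)%type R).

Lemma integral_marginal1 (P : probability T1 R) (g : T1 -> \bar R) :
  (forall A, measurable A -> Pi (A `*` setT) = P A) ->
  measurable_fun setT g -> (forall x, (0 <= g x)%E) ->
  (\int[Pi]_z g z.1 = \int[P]_x g x)%E.
Proof.
move=> hPi mg g0.
rewrite [RHS](eq_measure_integral (pushforward Pi (@fst T1 T2))); last first.
  move=> A mA _; apply: (etrans (esym (hPi A mA))); rewrite /pushforward; congr (Pi _).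
  by apply/seteqP; split => z /=; [case|].
by rewrite ge0_integral_pushforward.
Qed.

Lemma integral_marginal2 (Q : probability T2 R) (g : T2 -> \bar R) :
  (forall A, measurable A -> Pi (setT `*` A) = Q A) ->
  measurable_fun setT g -> (forall x, (0 <= g x)%E) ->
  (\int[Pi]_z g z.2 = \int[Q]_x g x)%E.
Proof.
move=> hPi mg g0.
rewrite [RHS](eq_measure_integral (pushforward Pi (@snd T1 T2))); last first.
  move=> A mA _; apply: (etrans (esym (hPi A mA))); rewrite /pushforward; congr (Pi _).
  by apply/seteqP; split => z /=; [case|].
by rewrite ge0_integral_pushforward.
Qed.

End Marginals.

Lemma measurable_chi_dist d (T : measurableType d) (R : realType) n (Y : T -> 'rV[R]_n) :
  (forall k : 'rV[int]_n, measurable_fun setT (fun z => cos (phase k (Y z)))) ->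
  (forall k : 'rV[int]_n, measurable_fun setT (fun z => sin (phase k (Y z)))) ->
  measurable_fun setT (fun z : T * T => chi_dist (Y z.1) (Y z.2)).
Proof.
move=> mC mS.
under eq_fun do rewrite chi_distE.
apply: (measurableT_comp (f := @Num.sqrt R)).
  by apply: continuous_measurable_fun; exact: sqrt_continuous.
apply: measurable_sum => i.
apply: measurable_funB => //; apply: measurable_funD; apply: measurable_funM.
- exact: (measurableT_comp (mC _) measurable_fst).
- exact: (measurableT_comp (mC _) measurable_snd).
- exact: (measurableT_comp (mS _) measurable_fst).
- exact: (measurableT_comp (mS _) measurable_snd).
Qed.

Section TransportBound.
Context (R : realType) (n : nat).
Local Notation V := ('rV[R]_n).
Local Notation B := (borel_bundle R n).
Context (Vel Y : torus R n -> V) (cVel : continuous Vel).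
Hypothesis mC : forall k : 'rV[int]_n,
  measurable_fun (setT : set B) (fun z : bundle R n => cos (phase k (Y z.1))).
Hypothesis mS : forall k : 'rV[int]_n,
  measurable_fun (setT : set B) (fun z : bundle R n => sin (phase k (Y z.1))).
Context (Kd : R) (Kd0 : 0 <= Kd).
Hypothesis hdist : forall x x',
  tdist x x' + `|Vel x - Vel x'| <= Kd * chi_dist (Y x) (Y x').

(** Triangle inequality through the graph of [Vel]. *)
Lemma bdist_le (z w : bundle R n) : bdist z w <= (1 + Num.sqrt n%:R) *
  (`|z.2 - Vel z.1| + `|w.2 - Vel w.1| + Kd * chi_dist (Y z.1) (Y w.1)).
Proof.
have t0 := tdist_ge0 z.1 w.1; have e0 := enorm_ge0 (z.2 - w.2).
have s0 : 0 <= Num.sqrt n%:R :> R by exact: sqrtr_ge0.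
have h1 : bdist z w <= tdist z.1 w.1 + enorm (z.2 - w.2).
  rewrite /bdist -[leRHS]ger0_norm ?addr_ge0// -sqrtr_sqr ler_sqrt ?sqr_ge0//.
  by rewrite sqrrD lerD2r lerDl mulrn_wge0// mulr_ge0.
have h2 := enorm_le_norm (z.2 - w.2).
have h3 : `|z.2 - w.2| <= `|z.2 - Vel z.1| + `|Vel z.1 - Vel w.1| + `|w.2 - Vel w.1|.
  rewrite -[z.2 - w.2](_ : (z.2 - Vel z.1) + (Vel z.1 - Vel w.1) + - (w.2 - Vel w.1) = _).
    by rewrite (le_trans (ler_normD _ _))// normrN lerD2r ler_normD.
  by apply/rowP => i; rewrite !mxE; ring.
have h4 := hdist z.1 w.1.
have h5 := normr_ge0 (z.2 - Vel z.1); have h6 := normr_ge0 (w.2 - Vel w.1).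
have h7 := normr_ge0 (Vel z.1 - Vel w.1).
have h8 : Num.sqrt n%:R * `|z.2 - w.2| <= Num.sqrt n%:R *
   (`|z.2 - Vel z.1| + `|w.2 - Vel w.1| + Kd * chi_dist (Y z.1) (Y w.1)).
  by rewrite ler_wpM2l//; lra.
by rewrite mulrDl mul1r; lra.
Qed.

Let mdev : measurable_fun (setT : set B) (fun z : bundle R n => `|z.2 - Vel z.1|%:E).
Proof.
apply/measurable_EFinP; apply: continuous_measurable_bundle.
have c1 := continuous_of_comp (@continuous_bfst R n) cVel.
apply: (continuous_of_comp (g := @Num.norm R V)); last exact: norm_continuous.
by move=> z; exact: (cvgB (@continuous_bsnd R n z) (c1 z)).
Qed.

Lemma W1_le_coupling (mu nu : probability B R) (Pi : probability (B * B)%type R) (a b q : R) :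
  (forall A, measurable A -> Pi (A `*` setT) = mu A) ->
  (forall A, measurable A -> Pi (setT `*` A) = nu A) ->
  (\int[mu]_z (`|(z : bundle R n).2 - Vel (z : bundle R n).1|)%:E <= a%:E)%E ->
  (\int[nu]_z (`|(z : bundle R n).2 - Vel (z : bundle R n).1|)%:E <= b%:E)%E ->
  (\int[Pi]_z (chi_dist (Y (z.1 : bundle R n).1) (Y (z.2 : bundle R n).1))%:E <= q%:E)%E ->
  (W1 mu nu <= ((1 + Num.sqrt n%:R) * (a + b + Kd * q))%:E)%E.
Proof.
move=> h1 h2 ha hb hq.
pose f1 (z : B * B) := (`|(z.1 : bundle R n).2 - Vel (z.1 : bundle R n).1|)%:E.
pose f2 (z : B * B) := (`|(z.2 : bundle R n).2 - Vel (z.2 : bundle R n).1|)%:E.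
pose f3 (z : B * B) := (chi_dist (Y (z.1 : bundle R n).1) (Y (z.2 : bundle R n).1))%:E.
have m1 : measurable_fun setT f1 by exact: (measurableT_comp mdev measurable_fst).
have m2 : measurable_fun setT f2 by exact: (measurableT_comp mdev measurable_snd).
have m3 : measurable_fun setT f3.
  by apply/measurable_EFinP; exact: (measurable_chi_dist mC mS).
have f10 z : (0 <= f1 z)%E by rewrite lee_fin.
have f20 z : (0 <= f2 z)%E by rewrite lee_fin.
have f30 z : (0 <= f3 z)%E by rewrite lee_fin sqrtr_ge0.
have s0 : 0 <= 1 + Num.sqrt n%:R :> R by rewrite addr_ge0// sqrtr_ge0.
apply: (@le_trans _ _ (\int[Pi]_z (bdist (z.1 : bundle R n) z.2)%:E)%E).
  apply: ereal_inf_lbound; exists Pi => // A mA; split; [exact: h1|exact: h2].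
apply: (@le_trans _ _ (\int[Pi]_z ((1 + Num.sqrt n%:R)%:E * (f1 z + f2 z + Kd%:E * f3 z)))%E).
  apply: ge0_le_integral_nonmeasurable => z; first by rewrite lee_fin sqrtr_ge0.
  by have := bdist_le z.1 z.2; rewrite -lee_fin.
have m33 : measurable_fun setT (fun z => Kd%:E * f3 z)%E by exact: measurable_funeM.
have f33 z : (0 <= Kd%:E * f3 z)%E by rewrite mule_ge0.
have m12 : measurable_fun setT (fun z => f1 z + f2 z)%E by exact: emeasurable_funD.
have f12 z : (0 <= f1 z + f2 z)%E by rewrite adde_ge0.
rewrite ge0_integralZl_EFin//; last 2 first.
- by move=> z _; rewrite adde_ge0.
- exact: emeasurable_funD.
rewrite EFinM lee_wpmul2l ?lee_fin//.
rewrite ge0_integralD// ge0_integralD// ge0_integralZl_EFin//.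
rewrite !EFinD EFinM leeD//; last by rewrite lee_wpmul2l// lee_fin.
apply: leeD.
- by rewrite (integral_marginal1 h1 mdev).
- by rewrite (integral_marginal2 h2 mdev).
Qed.

End TransportBound.

(** * Fourier coefficients of closed measures *)

Section RateOptimization.
Context (R : realType).

(** Take [m.+1] of order [a `^ (- (2 / (g + 1)))], which balances the two terms that
    depend on [m]. For [a = 0] let [m] tend to infinity. *)
Lemma rate_optimization (a C D g : R) (x : \bar R) :
  0 <= a <= 1 -> 0 <= C -> 0 <= D -> 1 <= g ->
  (forall m : nat, (x <= (C * (a + m.+1%:R^-1 + D * a ^+ 2 * m.+1%:R `^ g))%:E)%E) ->
  (x <= (C * (2 + D * 2 `^ g) * a `^ (2 / (g + 1)))%:E)%E.
Proof.
move=> /andP[a0 a1] C0 D0 g1 hx.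
have g10 : 0 < g + 1 by lra.
set b := 2 / (g + 1).
have b0 : 0 < b by rewrite divr_gt0.
have b1 : b <= 1 by rewrite ler_pdivrMr// mul1r; lra.
move: a0; rewrite le_eqVlt => /predU1P[aE|a0].
  have -> : a `^ b = 0 by rewrite -aE powR0// gt_eqF.
  rewrite mulr0; apply/lee_addgt0Pr => e e0; rewrite add0e.
  have := hx (Num.truncn (C / e)); rewrite -aE expr0n /= mulr0 mul0r addr0 add0r => h.
  apply: le_trans h _; rewrite lee_fin ler_pdivrMr ?ltr0n// [e * _]mulrC -ler_pdivrMr//.
  exact/ltW/truncnS_gt.
set t := a `^ (- b).
have t1 : 1 <= t.
  by rewrite /t -[leLHS](powRr0 a) ger_powR ?a0//; lra.
have t0 : 0 <= t by rewrite (le_trans ler01).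
set N : R := (Num.truncn t).+1%:R.
have tN : t <= N by exact/ltW/truncnS_gt.
have N0 : 0 < N by rewrite ltr0n.
have N2 : N <= 2 * t.
  have := truncn_le t; rewrite t0 => h; rewrite /N -natr1; lra.
have Ninv : N^-1 <= a `^ b.
  rewrite -[leRHS]invrK lef_pV2 ?posrE ?invr_gt0 ?powR_gt0//.
  by rewrite -powRN.
have Npow : a ^+ 2 * N `^ g <= 2 `^ g * a `^ b.
  have h : N `^ g <= (2 * t) `^ g.
    by rewrite ge0_ler_powR ?nnegrE ?(ltW N0) ?mulr_ge0//; lra.
  (* The exponents match: [b = 2 - b * g]. *)
  have -> : a `^ b = a ^+ 2 * t `^ g.
    rewrite /t -powRrM -powR_mulrn ?(ltW a0)// -powRD ?(gt_eqF a0) ?implybT//.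
    congr (_ `^ _); rewrite /b; field; lra.
  by rewrite mulrCA -powRM// ler_wpM2l// exprn_ge0// ltW.
have := hx (Num.truncn t) => /le_trans; apply.
rewrite lee_fin -/N -[leRHS]mulrA ler_wpM2l//.
have h1 : a <= a `^ b by rewrite ger1_powR// a0.
have h2 : D * a ^+ 2 * N `^ g <= D * (2 `^ g * a `^ b) by rewrite -mulrA ler_wpM2l.
by rewrite mulrDl -(mulrA D (2 `^ g)) lerD// mulr_natl mulr2n lerD.
Qed.

End RateOptimization.

Section KAMFourier.
Context (R : realType) (n : nat) (H : bundle R n -> R) (tonelliH : tonelli H).
Context (u0 : torus R n -> R) (hu0 : C11_torus u0).
Local Notation V := ('rV[R]_n).
Local Notation B := (borel_bundle R n).
Local Notation Vel := (graph_velocity H u0).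
Context (omega : V) (phi : R -> bundle R n -> bundle R n) (psi : torus R n -> torus R n).
Hypothesis flowphi : hamiltonian_flow H phi.
Hypothesis conj_psi : forall x t, psi (phi t (x, tgrad u0 x)).1 = tshift (psi x) (t *: omega).
Context (Psi : V -> V).
Hypotheses (C1Psi : Ck 1 Psi) (hPsi : forall x, psi (tproj x) = tproj (Psi x)).
Local Notation angle := (angle psi).

Let cVel : continuous Vel := continuous_graph_velocity tonelliH hu0.
Let isin (x : R) := is_derive_sin x.
Let icos (x : R) := is_derive_cos x.
Let iNcos (x : R) : is_derive x 1 (fun t : R => - cos t) (sin x).
Proof. by rewrite -[sin x]opprK; exact: is_deriveN. Qed.
Let csin : continuous (@sin R) := @continuous_sin R.
Let ccos : continuous (@cos R) := @continuous_cos R.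

Lemma measurable_cos_angle (k : 'rV[int]_n) :
  measurable_fun (setT : set B) (fun z : bundle R n => cos (phase k (angle z.1))).
Proof.
apply: continuous_measurable_bundle.
apply: (continuous_of_comp (g := fun x => cos (phase k (angle x))) (@continuous_bfst R n)).
apply: torus_continuous.
have cN : continuous (fun x : R => - sin x) by move=> x; apply: cvgN; exact: csin.
by have [[]] := KAM_trig_test C1Psi hPsi k icos cN (@cos_int_period R).
Qed.

Lemma measurable_sin_angle (k : 'rV[int]_n) :
  measurable_fun (setT : set B) (fun z : bundle R n => sin (phase k (angle z.1))).
Proof.
apply: continuous_measurable_bundle.
apply: (continuous_of_comp (g := fun x => sin (phase k (angle x))) (@continuous_bfst R n)).
apply: torus_continuous.
by have [[]] := KAM_trig_test C1Psi hPsi k isin ccos (@sin_int_period R).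
Qed.

(** Closedness is tested against [sin (phase k psi)] and [cos (phase k psi)]. At
    [v = Vel x] their derivatives are [phase k omega] times the integrands of
    interest; the rest is controlled by [`|v - Vel x|]. *)
Lemma KAM_fourier : exists2 K : R, 0 <= K &
  forall mu : probability B R, closed_measure mu -> forall k : 'rV[int]_n,
  `|phase k omega| * `|\int[mu]_z cos (phase k (angle (z : bundle R n).1))|
     <= K * `|intr_row R k| * deviation H u0 mu /\
  `|phase k omega| * `|\int[mu]_z sin (phase k (angle (z : bundle R n).1))|
     <= K * `|intr_row R k| * deviation H u0 mu.
Proof.
have [K K0 hK] := KAM_trig_bound C1Psi hPsi.
exists K => // mu cmu k.
have main (f df : R -> R) :
    (forall x : R, is_derive x 1 f (df x)) -> continuous df ->
    (forall x (m : int), f (x + 2 * pi * m%:~R) = f x) ->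
    (forall x (m : int), df (x + 2 * pi * m%:~R) = df x) ->
    (forall x, `|df x| <= 1) ->
    measurable_fun (setT : set B) (fun z : bundle R n => df (phase k (angle z.1))) ->
    `|phase k omega| * `|\int[mu]_z df (phase k (angle (z : bundle R n).1))|
     <= K * `|intr_row R k| * deviation H u0 mu.
  move=> hf cdf perf perdf df1 mdf.
  have [C1F _] := KAM_trig_test C1Psi hPsi k hf cdf perf.
  have hV := KAM_trig_velocity flowphi conj_psi C1Psi hPsi k hf cdf perf perdf.
  have hB := hK f df k hf cdf perf df1.
  set F := (fun x => f (phase k (angle x))) in C1F hV hB.
  have cF := continuous_tgrad C1F.
  have i1 := pair_dotp_integrable cmu cF.
  have bdf : bmeas (fun z : B => df (phase k (angle (z : bundle R n).1))) by split => //; exists 1.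
  have i2 := bmeas_integrable mu bdf.
  have i3 := real_integrableZ (phase k omega) i2.
  have i4 := real_integrableB i3 i1.
  rewrite -normrM -RintegralZl//.
  rewrite (_ : \int[mu]_z (phase k omega * df (phase k (angle (z : bundle R n).1))) =
    \int[mu]_z (phase k omega * df (phase k (angle (z : bundle R n).1)) -
                dotp (tgrad F (z : bundle R n).1) (z : bundle R n).2)); last first.
    by rewrite RintegralB// (closed_Rint0 cmu C1F) subr0.
  rewrite (le_trans (le_normr_Rintegral _ i4))// -RintegralZl//; last first.
    exact: deviation_integrable.
  apply: le_Rintegral => //.
  - exact: (integrable_abse i4).
  - apply: real_integrableZ; exact: deviation_integrable.
  - move=> z _ /=; rewrite -hV distrC -dotpBr; exact: hB.
split.
- apply: (main sin cos) => //.
  + exact: sin_int_period.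
  + exact: cos_int_period.
  + by move=> x; rewrite ler_norml cos_geN1 cos_le1.
  + exact: measurable_cos_angle.
- apply: (main (fun t => - cos t) sin) => //.
  + by move=> x m; rewrite cos_int_period.
  + exact: sin_int_period.
  + by move=> x; rewrite ler_norml sin_geN1 sin_le1.
  + exact: measurable_sin_angle.
Qed.

End KAMFourier.

(** * The rate for a given Diophantine exponent *)

Lemma intr_row_ge1 (R : realType) n (k : 'rV[int]_n) : k != 0 -> 1 <= `|intr_row R k|.
Proof.
move=> k0; have [i ki] : exists i, k 0 i != 0.
  apply/existsP; apply: contraNT k0; rewrite negb_exists => /forallP h.
  by apply/eqP/rowP => i; rewrite mxE; apply/eqP; have := h i; rewrite negbK.
apply: le_trans (rV_norm_coord _ i).
by rewrite mxE -intr_norm ler1z -gtz0_ge1 normr_gt0.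
Qed.

Section KAMRate.
Context (R : realType) (n : nat) (H : bundle R n -> R) (tonelliH : tonelli H).
Context (u0 : torus R n -> R) (hu0 : C11_torus u0) (h : R).
Hypothesis hHJ : forall x, H (x, tgrad u0 x) = h.
Local Notation V := ('rV[R]_n).
Local Notation B := (borel_bundle R n).
Local Notation Vel := (graph_velocity H u0).
Context (omega : V) (hKAM : KAM_torus H u0 omega).

Let C0 : R := n%:R * 8 ^+ n + 1 + Num.sqrt (2 * n%:R) * (64 ^+ n * 4 ^+ n + 1).

(** The small divisor estimate: a coefficient of frequency [k] is at most
    [K * `|k| * deviation mu / `|phase k omega|], hence, for frequencies up to [4 N],
    at most a multiple of [`|c| * N `^ (1 + tau)]; this is the [e] of
    [fourier_coupling]. *)
Lemma KAM_W1_bound : exists2 A : R, 0 < A & exists2 C : R, 0 < C &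
  forall sigma tau : R, 0 < sigma -> -1 <= tau -> diophantine sigma tau omega ->
  exists2 D : R, 0 <= D & forall (c : V) (mu mu0 : probability B R),
    A * enorm c <= 1 -> mather_measure (Hshift H c) mu -> mather_measure H mu0 ->
    forall m : nat, (W1 mu mu0 <= (C * (A * enorm c + m.+1%:R^-1 +
       D * (A * enorm c) ^+ 2 * m.+1%:R `^ ((1 + tau) * 2 + n.+1%:R)))%:E)%E.
Proof.
have [phi [flowphi _ [psi [[psi' [psiK psi'K [Psi [C1Psi hPsi]] [Psi' [C1Psi' hPsi']]]] conj_psi]]]] := hKAM.
have liftPsi' x k : exists l, Psi' (x + intr_row R k) = Psi' x + intr_row R l.
  by apply/tprojP; rewrite -!hPsi' tproj_int.
have near := near_minimizer tonelliH hu0 hHJ C1Psi' liftPsi'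
  (KAM_inverse_velocity flowphi conj_psi psiK psi'K C1Psi hPsi C1Psi' hPsi').
have [Kr Kr0 [rho hrot]] := KAM_rotation flowphi conj_psi psiK C1Psi hPsi C1Psi' hPsi'.
have [A A0 hA] := mather_deviation_le tonelliH hu0 hHJ near Kr0 hrot.
have [Kd Kd0 hKd] := KAM_angle_dist tonelliH hu0 psiK C1Psi' hPsi'.
have [K K0 hK] := KAM_fourier tonelliH hu0 flowphi conj_psi C1Psi hPsi.
have cVel := continuous_graph_velocity tonelliH hu0.
have C00 : 0 <= C0.
  by rewrite /C0 !addr_ge0// mulr_ge0// ?sqrtr_ge0// ?addr_ge0// ?mulr_ge0// exprn_ge0.
have s0 : 0 < 1 + Num.sqrt n%:R :> R by rewrite ltr_pwDl// sqrtr_ge0.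
have Kdc0 : 0 <= Kd * C0 by rewrite mulr_ge0.
exists A => //; exists ((1 + Num.sqrt n%:R) * (1 + Kd * C0)).
  by rewrite mulr_gt0// ltr_pwDl.
move=> sigma tau sig0 tau1 dioph.
set th := 1 + tau; have th0 : 0 <= th by rewrite /th; lra.
pose E := K / sigma * (Num.sqrt n%:R * 4) `^ th.
have E0 : 0 <= E by rewrite mulr_ge0 ?powR_ge0// divr_ge0// ltW.
exists (E ^+ 2) => [|c mu mu0 cA hmu hmu0 m]; first by rewrite exprn_ge0.
set a := A * enorm c in cA *.
have Aa : A * `|c| <= a by rewrite ler_wpM2l ?(ltW A0)// norm_le_enorm.
have a0 : 0 <= a by rewrite mulr_ge0 ?(ltW A0) ?enorm_ge0.
have dmu : deviation H u0 mu <= a by rewrite (le_trans (hA c mu mu0 (le_trans Aa cA) hmu hmu0)).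
have dmu0 := mather_deviation0 tonelliH hu0 hHJ near hmu0.
have devE (nu : probability B R) : closed_measure nu ->
    (\int[nu]_z (`|(z : bundle R n).2 - Vel (z : bundle R n).1|)%:E = (deviation H u0 nu)%:E)%E.
  move=> cnu; rewrite /deviation /Rintegral fineK//.
  exact: (integrable_fin_num measurableT (deviation_integrable cnu cVel)).
set N : R := m.+1%:R; have N0 : 0 < N by rewrite ltr0n.
have phase_lower (k : 'rV[int]_n) : k != 0 ->
    sigma * enorm (intr_row R k) `^ (- tau) <= `|phase k omega|.
  move=> k0; rewrite (le_trans (dioph k k0))// /phase dotpC normrM ler_peMl//.
  by rewrite ger0_norm ?mulr_ge0 ?pi_ge0//; have := @pi_ge2 R; lra.
have q0 (k : 'rV[int]_n) : k != 0 -> 0 < enorm (intr_row R k).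
  by move=> /(intr_row_ge1 R) h1; rewrite (lt_le_trans ltr01)// (le_trans h1)// norm_le_enorm.
have ph0 (k : 'rV[int]_n) : k != 0 -> 0 < `|phase k omega|.
  by move=> k0; rewrite (lt_le_trans _ (phase_lower k k0))// mulr_gt0// powR_gt0// q0.
have [||||Pi [Pi1 Pi2 hPi]] := @fourier_coupling _ B R n mu mu0
    (fun z : B => angle psi (z : bundle R n).1) _ _ _ m (E * a * N `^ th).
- by move=> k; exact: (measurable_cos_angle C1Psi hPsi).
- by move=> k; exact: (measurable_sin_angle C1Psi hPsi).
- move=> k k0; have := hK mu0 hmu0.1 k; rewrite dmu0 mulr0.
  rewrite !pmulr_rle0 ?ph0// !normr_le0 => -[/eqP h1 /eqP h2].
  by rewrite h1 h2.
- move=> k k0 kN.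
  have kb : `|intr_row R k| <= 4 * N.
    apply: rV_norm_le => [|i]; first by rewrite mulr_ge0 ?(ltW N0).
    rewrite mxE -intr_norm /N -natrM -[leRHS]/((4 * m.+1)%:Z%:~R) ler_int.
    exact: kN.
  have qb : enorm (intr_row R k) `^ th <= (Num.sqrt n%:R * 4) `^ th * N `^ th.
    rewrite -powRM ?mulr_ge0 ?sqrtr_ge0 ?(ltW N0)//.
    rewrite ge0_ler_powR ?nnegrE ?enorm_ge0 ?mulr_ge0 ?sqrtr_ge0 ?(ltW N0)//.
    by rewrite (le_trans (enorm_le_norm _))// -mulrA ler_wpM2l ?sqrtr_ge0.
  have main (I : R) : `|phase k omega| * `|I| <= K * `|intr_row R k| * deviation H u0 mu ->
      `|I| <= E * a * N `^ th.
    move=> hI.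
    have qk := q0 k k0; set q := enorm (intr_row R k) in qb qk.
    have h1 : sigma * q `^ (- tau) * `|I| <= K * q * a.
      rewrite (@le_trans _ _ (`|phase k omega| * `|I|))//.
        by rewrite ler_wpM2r// phase_lower.
      rewrite (le_trans hI)// ler_pM ?mulr_ge0 ?deviation_ge0//.
      by rewrite ler_wpM2l// norm_le_enorm.
    have h2 : sigma * `|I| <= K * q `^ th * a.
      have -> : q `^ th = q * q `^ tau.
        by rewrite /th powRD ?(gt_eqF qk) ?implybT// powRr1// ltW.
      have -> : sigma * `|I| = q `^ tau * (sigma * q `^ (- tau) * `|I|).
        rewrite powRN; field; rewrite gt_eqF// powR_gt0//.
      rewrite [leRHS](_ : _ = q `^ tau * (K * q * a)); last by ring.
      by rewrite ler_wpM2l ?powR_ge0.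
    rewrite -(ler_pM2l sig0) (le_trans h2)//.
    rewrite [leRHS](_ : _ = K * ((Num.sqrt n%:R * 4) `^ th * N `^ th) * a); last first.
      by rewrite /E; field; rewrite gt_eqF.
    by rewrite ler_wpM2r// ler_wpM2l.
  by have [h1 h2] := hK mu hmu.1 k; split; exact: main.
have mC k := measurable_cos_angle C1Psi hPsi k.
have mS k := measurable_sin_angle C1Psi hPsi k.
have := W1_le_coupling cVel mC mS Kd0 hKd Pi1 Pi2 (a := a) (b := 0) _ _ hPi.
rewrite !devE ?dmu0; [|exact: hmu0.1|exact: hmu.1].
rewrite !lee_fin => /(_ dmu (lexx _)) /le_trans; apply.
rewrite lee_fin addr0 -/C0 -/N -[leRHS]mulrA ler_wpM2l ?(ltW s0)//.
have -> : (E * a * N `^ th) ^+ 2 * N ^+ n.+1 = E ^+ 2 * a ^+ 2 * N `^ (th * 2 + n.+1%:R).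
  rewrite [N `^ (th * 2 + _)]powRD ?(gt_eqF N0) ?implybT// [N `^ (th * 2)]powRrM !powR_mulrn ?powR_ge0 ?(ltW N0)//.
  by rewrite !exprMn; ring.
set X := E ^+ 2 * a ^+ 2 * _.
have X0 : 0 <= X by apply: mulr_ge0 (powR_ge0 _ _); rewrite mulr_ge0// exprn_ge0.
have N1 : 0 <= N^-1 by rewrite invr_ge0 ltW.
have key (p x y z : R) : 0 <= p * z -> 0 <= y -> 0 <= x ->
  z + p * (y + x) <= (1 + p) * (z + y + x) by lra.
by rewrite [Kd * (C0 * _)]mulrA; apply: key => //; rewrite mulr_ge0.
Qed.

Lemma KAM_W1_rate (sigma tau : R) : 0 < sigma -> -1 <= tau ->
  diophantine sigma tau omega ->
  exists2 C : R, 0 < C & exists2 r : R, 0 < r &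
  forall (c : V) (mu mu0 : probability B R), enorm c <= r ->
    mather_measure (Hshift H c) mu -> mather_measure H mu0 ->
    (W1 mu mu0 <= (C * enorm c `^ (2 / ((1 + tau) * 2 + n.+2%:R)))%:E)%E.
Proof.
move=> sig0 tau1 dioph.
have [A A0 [C C0' hC]] := KAM_W1_bound.
have [D D0 hD] := hC sigma tau sig0 tau1 dioph.
set g := (1 + tau) * 2 + n.+1%:R.
have g1 : 1 <= g.
  by rewrite /g -natr1; have : 0 <= n%:R :> R by []; lra.
exists (C * (2 + D * 2 `^ g) * A `^ (2 / (g + 1))).
  by rewrite !mulr_gt0 ?powR_gt0// ltr_pwDl// mulr_ge0// powR_ge0.
exists A^-1 => [|c mu mu0 cA hmu hmu0]; first by rewrite invr_gt0.
have cA1 : A * enorm c <= 1 by rewrite mulrC -ler_pdivlMr// div1r.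
have -> : (1 + tau) * 2 + n.+2%:R = g + 1 by rewrite /g -[n.+2%:R]natr1 addrA.
rewrite -[X in (X)%:E]mulrA -powRM ?(ltW A0) ?enorm_ge0//.
apply: (rate_optimization _ (ltW C0') D0 g1).
  by rewrite cA1 mulr_ge0 ?(ltW A0) ?enorm_ge0.
exact: hD.
Qed.

End KAMRate.

(** * A constant independent of the Diophantine exponent *)

Lemma le_powR_exponent (R : realType) (x a b : R) : 0 <= x <= 1 -> 0 < a -> a <= b ->
  x `^ b <= x `^ a.
Proof.
move=> /andP[x0 x1] a0 ab; move: x0; rewrite le_eqVlt => /predU1P[<-|x0].
  by rewrite !powR0// gt_eqF// (lt_le_trans a0).
by rewrite ger_powR// x0.
Qed.

Lemma near0_enorm_le (R : realType) n (r : R) : 0 < r ->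
  \forall c \near (0 : 'rV[R]_n), enorm c <= r.
Proof.
move=> r0; have ce := continuous_enorm (fun x : 'rV[R]_n => @cvg_id _ (nbhs x)).
have e0 : enorm (0 : 'rV[R]_n) < r by rewrite /enorm dotp0r sqrtr0.
have h : \forall c \near (0 : 'rV[R]_n), enorm c < r by exact: (cvgr_lt _ (ce 0) _ e0).
by apply: filterS h => c /ltW.
Qed.

(** The single frequency [1] bounds [omega] from below, and in dimension one
    [dotp omega k] is [omega] times [k]. *)
Lemma diophantine_dim1 (R : realType) (sigma tau : R) (omega : 'rV[R]_1) :
  diophantine sigma tau omega -> diophantine sigma (-1) omega.
Proof.
have enorm1 (u : 'rV[R]_1) : enorm u = `|u 0 0|.
  by rewrite /enorm /dotp big_ord1 -expr2 sqrtr_sqr.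
move=> dioph k k0; rewrite opprK powRr1 ?enorm_ge0// enorm1 /dotp big_ord1 normrM ler_wpM2r//.
have d10 : delta_mx 0 0 != 0 :> 'rV[int]_1.
  by apply/eqP => /rowP /(_ 0); rewrite !mxE !eqxx.
have := dioph _ d10.
by rewrite enorm1 /dotp big_ord1 !mxE !eqxx normr1 powR1 !mulr1.
Qed.

Section UniformConstant.
Context (R : realType) (n : nat) (hn : (0 < n)%N).
Context (H : bundle R n -> R) (tonelliH : tonelli H).
Context (u0 : torus R n -> R) (hu0 : C11_torus u0) (h : R).
Hypothesis hHJ : forall x, H (x, tgrad u0 x) = h.
Context (omega : 'rV[R]_n) (hKAM : KAM_torus H u0 omega).

Let rate (C r tau : R) := forall (c : 'rV[R]_n) (mu mu0 : probability (borel_bundle R n) R),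
  enorm c <= r -> mather_measure (Hshift H c) mu -> mather_measure H mu0 ->
  (W1 mu mu0 <= (C * enorm c `^ (n%:R + tau + 1)^-1)%:E)%E.

Let ell_gt0 (tau : R) : n%:R - 1 <= tau -> 0 < (n%:R + tau + 1)^-1.
Proof. by move=> ht; rewrite invr_gt0; have : 0 < n%:R :> R; [rewrite ltr0n|lra]. Qed.

Let rate_exponent (tau' e : R) sigma : 0 < sigma -> -1 <= tau' -> diophantine sigma tau' omega ->
  0 < e -> e <= 2 / ((1 + tau') * 2 + n.+2%:R) ->
  exists2 C : R, 0 < C & exists2 r : R, 0 < r &
    forall (c : 'rV[R]_n) (mu mu0 : probability (borel_bundle R n) R),
    enorm c <= r -> mather_measure (Hshift H c) mu -> mather_measure H mu0 ->
    (W1 mu mu0 <= (C * enorm c `^ e)%:E)%E.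
Proof.
move=> sig0 tau1 dioph e0 he.
have [C C0 [r r0 hr]] := KAM_W1_rate tonelliH hu0 hHJ hKAM sig0 tau1 dioph.
exists C => //; exists (Num.min r 1) => [|c mu mu0]; first by rewrite lt_min r0 ltr01.
rewrite le_min => /andP[cr c1] hmu hmu0.
apply: le_trans (hr c mu mu0 cr hmu hmu0) _; rewrite lee_fin ler_wpM2l ?(ltW C0)//.
by rewrite le_powR_exponent// enorm_ge0.
Qed.

(** In dimension at least two the exponent of [KAM_W1_rate] for [tau] is at least the
    one wanted; in dimension one it is so for the exponent [-1]. *)
Lemma KAM_W1_holder (sigma tau : R) : 0 < sigma -> n%:R - 1 <= tau ->
  diophantine sigma tau omega ->
  exists2 C : R, 0 < C & exists2 r : R, 0 < r & rate C r tau.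
Proof.
move=> sig0 ht dioph; have l0 := ell_gt0 ht.
have [n1|n1] := eqVneq n 1%N.
  have dioph' : diophantine sigma (-1) omega.
    move: omega dioph; rewrite n1 => om; exact: diophantine_dim1.
  apply: (rate_exponent sig0 (lexx _) dioph' l0).
  have t0 : 0 <= tau by move: ht; rewrite n1; lra.
  rewrite n1 subrr mul0r add0r ler_pdivlMr ?ltr0n// mulrC ler_pdivrMr; lra.
have n2 : 2 <= n%:R :> R by rewrite ler_nat ltn_neqAle eq_sym n1.
have tau1 : -1 <= tau by lra.
apply: (rate_exponent sig0 tau1 dioph l0).
have E : n.+2%:R = n%:R + 2 :> R by rewrite -addn2 natrD.
rewrite E ler_pdivlMr; last by lra.
by rewrite mulrC ler_pdivrMr; lra.
Qed.

(** If the set [S] of Diophantine exponents of [omega] has a least element, its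
    constant serves for all the others, whose rates are weaker. Otherwise [S]
    contains some [t < tau], and for small [c] the surplus
    [enorm c `^ (e' - e)] absorbs the constant of [t], leaving [1]. *)
Lemma KAM_W1_holder_uniform : exists2 C : R, 0 < C & forall sigma tau : R, 0 < sigma ->
  n%:R - 1 <= tau -> diophantine sigma tau omega ->
  exists2 r : R, 0 < r & rate C r tau.
Proof.
pose S (t : R) := n%:R - 1 <= t /\ exists2 s : R, 0 < s & diophantine s t omega.
have [[t0 [[ht0 [s0 s00 dioph0]] tmin]]|hno] := pselect (exists t0, S t0 /\ forall t, S t -> t0 <= t).
  have [C C0 [r r0 hr]] := KAM_W1_holder s00 ht0 dioph0.
  exists C => // sigma tau sig0 ht dioph.
  have t0t : t0 <= tau by apply: tmin; split => //; exists sigma.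
  exists (Num.min r 1) => [|c mu mu0]; first by rewrite lt_min r0 ltr01.
  rewrite le_min => /andP[cr c1] hmu hmu0.
  apply: le_trans (hr c mu mu0 cr hmu hmu0) _; rewrite lee_fin ler_wpM2l ?(ltW C0)//.
  have l0 := ell_gt0 ht; have l00 := ell_gt0 ht0.
  rewrite le_powR_exponent ?enorm_ge0//.
  by move: l0 l00; rewrite !invr_gt0 => l0 l00; rewrite lef_pV2 ?posrE//; lra.
exists 1 => // sigma tau sig0 ht dioph.
have [t [[ht' [s s_gt0 diopht]] ttau]] : exists t, S t /\ t < tau.
  apply: contrapT => hn'; apply: hno; exists tau; split; first by split => //; exists sigma.
  move=> t St; rewrite leNgt; apply/negP => ttau; apply: hn'; by exists t.
have [C C0 [r r0 hr]] := KAM_W1_holder s_gt0 ht' diopht.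
have l0 := ell_gt0 ht; have l0' := ell_gt0 ht'.
set e := (n%:R + tau + 1)^-1 in l0 *; set e' := (n%:R + t + 1)^-1 in l0' hr.
have ee' : 0 < e' - e.
  rewrite subr_gt0; move: l0 l0'; rewrite /e /e' !invr_gt0 => l0 l0'.
  by rewrite ltf_pV2 ?posrE//; lra.
(* Below the radius [r1], [C * enorm c `^ (e' - e) <= 1]. *)
pose r1 := C^-1 `^ (e' - e)^-1.
have r10 : 0 < r1 by rewrite powR_gt0// invr_gt0.
exists (Num.min r r1) => [|c mu mu0]; first by rewrite lt_min r0.
rewrite le_min => /andP[cr c1] hmu hmu0.
apply: le_trans (hr c mu mu0 cr hmu hmu0) _; rewrite lee_fin -/e -/e' mul1r.
have x0 := enorm_ge0 c; move: x0; rewrite le_eqVlt => /predU1P[<-|x0].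
  by rewrite !powR0 ?gt_eqF// mulr0.
have -> : e' = (e' - e) + e by rewrite subrK.
rewrite powRD ?(gt_eqF x0) ?implybT// mulrA ler_piMl ?powR_ge0//.
rewrite -ler_pdivlMl// mulr1.
rewrite [leRHS](_ : _ = r1 `^ (e' - e)).
  by rewrite ge0_ler_powR ?nnegrE ?(ltW x0) ?(ltW r10) ?(ltW ee').
by rewrite /r1 -powRrM mulVf ?gt_eqF// powRr1// invr_ge0 ltW.
Qed.

End UniformConstant.

Theorem theorem4p3 (R : realType) (n : nat) (hn : (0 < n)%N)
  (H : bundle R n -> R) (hH : tonelli H)
  (hHc : \forall c \near (0 : 'rV[R]_n), tonelli (Hshift H c))
  (hHcvg : C2_cvg_Hshift H)
  (u0 : torus R n -> R) (hu0 : C11_torus u0)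
  (hHJ : forall x : torus R n, H (x, tgrad u0 x) = alpha H 0)
  (omega : 'rV[R]_n) (hKAM : KAM_torus H u0 omega) :
  exists C : R, 0 < C /\
    forall sigma tau : R, 0 < sigma -> n%:R - 1 <= tau ->
      diophantine sigma tau omega ->
      \forall c \near (0 : 'rV[R]_n),
        forall mu_c mu_0 : probability (borel_bundle R n) R,
          mather_measure (Hshift H c) mu_c -> mather_measure H mu_0 ->
          (W1 mu_c mu_0 <= (C * enorm c `^ (n%:R + tau + 1)^-1)%:E)%E.
Proof.
have [C C0 hC] := KAM_W1_holder_uniform hn hH hu0 hHJ hKAM.
exists C; split => // sigma tau sig0 ht dioph.
have [r r0 hr] := hC sigma tau sig0 ht dioph.
apply: filterS (near0_enorm_le n r0) => c cr mu_c mu_0; exact: hr.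
Qed.
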